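(* Let $\beta>0$ and suppose: (1) for every $N\in\mathbb N$ and $x_1,\dots,x_N\in\mathbb R^d$, $\mu\mapsto c(\mu,\rho)$ is continuous on $\mathcal P(\{x_1,\dots,x_N\})$ uniformly in $\rho\in\mathbb H$; (2) for every $x\in\mathbb R^d$, the set $\{\rho(x)-\rho(0):\rho\in\mathbb H\}$ is a bounded subset of $\mathbb R$. Let $u,w\in C(\mathcal P_p)$ be, respectively, a viscosity subsolution and a viscosity supersolution of $\beta u(\mu)+\sup_{\rho\in\mathbb H}\{-c(\mu,\rho)-Lu(\mu,\rho)\}=0$, $\mu\in\mathcal P_p$, for some $q\in[1,p]\cup\{0\}$. Then $u\le w$ on $\mathcal P_p$.
   Context: Fix $d\in\mathbb N$. $\mathcal P$: Borel probability measures on $\mathbb R^d$ (weak topology); for $r\in[1,\infty)$, $\mathcal P_r$: those with finite $r$-th moment, with Wasserstein-$r$ metric; $\mathcal P_0:=\mathcal P$; $|x|^0:=1$; $\mathcal P(\{x_1,\dots,x_N\})$ denotes probability measures supported in $\{x_1,\dots,x_N\}$; $\mu(\varphi)=\int\varphi\,d\mu$. Fix $p\in[1,\infty)\cup\{0\}$, a Polish space $\mathbb H$ of measurable real functions on $\mathbb R^d$, a measurable $c:\mathcal P_p\times\mathbb H\to\mathbb R\cup\{+\infty\}$ and $\beta\ge0$. $C^2(\mathcal P_q)$: functions $f:\mathcal P_q\to\mathbb R$ with continuous $\frac{\partial f}{\partial\mu}$ on $\mathbb R^d\times\mathcal P_q$ and continuous $\frac{\partial^2 f}{\partial\mu^2}$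 on $\mathbb R^d\times\mathbb R^d\times\mathcal P_q$ (symmetric in $x,y$), with $|\frac{\partial f}{\partial\mu}(x,\mu)|\le c_K(1+|x|^q)$, $|\frac{\partial^2 f}{\partial\mu^2}(x,y,\mu)|\le c_K(1+|x|^q+|y|^q)$ for $\mu$ in any compact $K\subset\mathcal P_q$, and for all $\mu,\nu\in\mathcal P_q$: $f(\nu)-f(\mu)=\int_0^1\int\frac{\partial f}{\partial\mu}(x,t\nu+(1-t)\mu)(\nu-\mu)(dx)dt$, $f(\nu)-f(\mu)-\int\frac{\partial f}{\partial\mu}(x,\mu)(\nu-\mu)(dx)=\int_0^1\int_0^t\iint\frac{\partial^2f}{\partial\mu^2}(x,y,s\nu+(1-s)\mu)(\nu-\mu)^{\otimes2}(dx,dy)ds\,dt$. For $\mu\in\mathcal P_p$, $\rho\in\mathbb H$: $Lf(\mu,\rho)=\frac12\iint\frac{\partial^2f}{\partial\mu^2}(x,y,\mu)\sigma(dx)\sigma(dy)$, $\sigma(dx)=(\rho(x)-\mu(\rho))\mu(dx)$, when $\rho\in L^1(\mu)$ and the integrand lies in $L^1(|\sigma|\otimes|\sigma|)$, else $+\infty$. $H(\mu;f)=\beta f(\mu)+\sup_{\rho\in\mathbb H}\{-c(\mu,\rho)-Lf(\mu,\rho)\}$. $\mu\preceq\nu$ iff $\operatorname{supp}\mu\subseteq\operatorname{supp}\nu$; $D_{\bar\mu}=\{\mu\in\mathcal P_p:\mu\preceq\bar\mu\}$; limits in $\mathcal P_p$. $u:\mathcal P_p\to\overline{\mathbb R}$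 is a viscosity subsolution if $\liminf_{\mu\to\bar\mu,\mu\preceq\bar\mu}H(\mu;f)\le0$ for all $\bar\mu\in\mathcal P_p$, $f\in C^2(\mathcal P_q)$ with $f(\bar\mu)=\limsup_{\mu\to\bar\mu,\mu\preceq\bar\mu}u(\mu)$ and $f\ge u$ on $D_{\bar\mu}$; a viscosity supersolution if $\limsup_{\mu\to\bar\mu,\mu\preceq\bar\mu}H(\mu;f)\ge0$ for all $\bar\mu$, $f$ with $f(\bar\mu)=\liminf_{\mu\to\bar\mu,\mu\preceq\bar\mu}u(\mu)$ and $f\le u$ on $D_{\bar\mu}$. *)

(* Defs.v *)
From HB Require Import structures.
From mathcomp Require Import all_boot all_order all_algebra.
From mathcomp Require Import all_classical all_reals all_analysis.
From mathcomp Require Import measurable_realfun lebesgue_measure.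
Set Implicit Arguments. Unset Strict Implicit. Unset Printing Implicit Defensive.
Import Order.TTheory GRing.Theory Num.Theory.
Import numFieldNormedType.Exports.
Local Open Scope classical_set_scope.
Local Open Scope ring_scope.

Definition Rd (R : realType) (d : nat) := g_sigma_algebraType (@open 'rV[R]_d).

Section Defs.
Context {R : realType} {d : nat}.

Definition meas := {measure set (Rd R d) -> \bar R}.

Definition enorm (x : 'rV[R]_d) : R := Num.sqrt (\sum_i (x ord0 i) ^+ 2).

Definition isprob (mu : meas) := mu setT = 1%E.

(* P_q : probability measures with finite q-th moment (|x|^0 = 1 via powR) *)
Definition Pq (q : R) (mu : meas) :=
  isprob mu /\ (\int[mu]_x ((enorm x) `^ q)%:E < +oo)%E.

Definition coupling (mu nu : meas)
  (pi : {measure set (Rd R d * Rd R d) -> \bar R}) :=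
  (forall A : set (Rd R d), measurable A -> pi (A `*` setT) = mu A) /\
  (forall B : set (Rd R d), measurable B -> pi (setT `*` B) = nu B).

(* Neighbourhoods of mu in P_q : for q = 0 the weak topology, for q >= 1
   the Wasserstein-q topology (W_q(mu,nu) < eps iff some coupling has
   q-cost < eps^q). Neighbourhoods are taken relative to P_q. *)
Definition Pnbhs (q : R) (mu : meas) : set_system meas := fun A =>
  if q == 0 then
    exists n (f : 'I_n -> 'rV[R]_d -> R) (eps : R), 0 < eps /\
      (forall i, continuous (f i) /\ exists M : R, forall x, `|f i x| <= M) /\
      (forall nu, Pq q nu ->
        (forall i, (`| \int[nu]_x (f i x)%:E - \int[mu]_x (f i x)%:E | < eps%:E)%E)
        -> A nu)
  else
    exists eps : R, 0 < eps /\
      (forall nu, Pq q nu ->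
        (exists pi, coupling mu nu pi /\
           (\int[pi]_z ((enorm (z.1 - z.2 : 'rV[R]_d)) `^ q)%:E < (eps `^ q)%:E)%E)
        -> A nu).

Definition contP (q : R) (f : meas -> R) :=
  forall mu, Pq q mu -> forall e : R, 0 < e -> Pnbhs q mu [set nu | `|f nu - f mu| < e].

Definition cont1 (q : R) (g : 'rV[R]_d -> meas -> R) :=
  forall x mu, Pq q mu -> forall e : R, 0 < e -> exists delta : R, 0 < delta /\
    Pnbhs q mu [set nu | forall y, enorm (y - x) < delta -> `|g y nu - g x mu| < e].

Definition cont2 (q : R) (g : 'rV[R]_d -> 'rV[R]_d -> meas -> R) :=
  forall x y mu, Pq q mu -> forall e : R, 0 < e -> exists delta : R, 0 < delta /\
    Pnbhs q mu [set nu | forall x' y', enorm (x' - x) < delta -> enorm (y' - y) < delta ->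
                         `|g x' y' nu - g x y mu| < e].

Definition compactP (q : R) (K : set meas) :=
  K `<=` Pq q /\
  forall F : set_system meas, ProperFilter F -> F K ->
    exists mu, K mu /\ forall A B, F A -> Pnbhs q mu B -> A `&` B !=set0.

Lemma maxr0_ge0 (t : R) : 0 <= Num.max t 0.
Proof. by rewrite le_max lexx orbT. Qed.

Definition nng (t : R) : {nonneg R} := NngNum (maxr0_ge0 t).

(* the mixture t nu + (1 - t) mu (used for t in [0,1]) *)
Definition mix (t : R) (nu mu : meas) : meas :=
  measure_add (mscale (nng t) nu) (mscale (nng (1 - t)) mu).

Definition sint (nu mu : meas) (g : 'rV[R]_d -> R) : \bar R :=
  (\int[nu]_x (g x)%:E - \int[mu]_x (g x)%:E)%E.

Definition sint2 (nu mu : meas) (g : 'rV[R]_d -> 'rV[R]_d -> R) : \bar R :=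
  (\int[nu]_x sint nu mu (g x) - \int[mu]_x sint nu mu (g x))%E.

Definition isC2 (q : R) (f : meas -> R) (Df : 'rV[R]_d -> meas -> R)
    (D2f : 'rV[R]_d -> 'rV[R]_d -> meas -> R) :=
  cont1 q Df /\ cont2 q D2f /\
      (forall x y mu, Pq q mu -> D2f x y mu = D2f y x mu) /\
      (forall K, compactP q K -> exists cK : R, forall mu, K mu -> forall x y,
          `|Df x mu| <= cK * (1 + (enorm x) `^ q) /\
          `|D2f x y mu| <= cK * (1 + (enorm x) `^ q + (enorm y) `^ q)) /\
      (forall mu nu, Pq q mu -> Pq q nu ->
          (f nu - f mu)%:E =
          (\int[lebesgue_measure]_(t in `[0%R, 1%R]) sint nu mu (fun x => Df x (mix t nu mu)))%E) /\
      (forall mu nu, Pq q mu -> Pq q nu ->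
          ((f nu - f mu)%:E - sint nu mu (fun x => Df x mu))%E =
          (\int[lebesgue_measure]_(t in `[0%R, 1%R])
             \int[lebesgue_measure]_(s in `[0%R, t])
                sint2 nu mu (fun x y => D2f x y (mix s nu mu)))%E).

(* L f(mu, rho), expressed through D2f; sigma(dx) = (rho x - mu(rho)) mu(dx),
   so |sigma|(x)|sigma| has density |rho x - m| |rho y - m| w.r.t. mu (x) mu *)
Definition Lop (D2f : 'rV[R]_d -> 'rV[R]_d -> meas -> R) (mu : meas)
    (rho : 'rV[R]_d -> R) : \bar R :=
  let m := fine (\int[mu]_x (rho x)%:E) in
  if `[< (\int[mu]_x `|rho x|%:E < +oo)%E /\
         (\int[mu]_x \int[mu]_y
            (`|D2f x y mu| * `|rho x - m| * `|rho y - m|)%:E < +oo)%E >]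
  then ((2^-1)%:E * \int[mu]_x \int[mu]_y
            (D2f x y mu * (rho x - m) * (rho y - m))%:E)%E
  else +oo%E.

Definition Ham {H : Type} (beta : R) (c : meas -> H -> \bar R)
    (ev : H -> 'rV[R]_d -> R) (f : meas -> R)
    (D2f : 'rV[R]_d -> 'rV[R]_d -> meas -> R) (mu : meas) : \bar R :=
  ((beta * f mu)%:E +
   ereal_sup [set (- c mu rho - Lop D2f mu (ev rho))%E | rho in [set: H]])%E.

Definition supp (mu : meas) : set 'rV[R]_d :=
  [set x | forall U : set 'rV[R]_d, open U -> U x -> (0 < mu U)%E].

Definition preceq (mu nu : meas) := supp mu `<=` supp nu.

Definition nbhsD (p : R) (mubar : meas) : set_system meas :=
  [set A | exists B, Pnbhs p mubar B /\ forall mu, B mu -> preceq mu mubar -> A mu].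

Definition limsupF (F : set_system meas) (g : meas -> \bar R) : \bar R :=
  ereal_inf [set ereal_sup (g @` A) | A in F].

Definition liminfF (F : set_system meas) (g : meas -> \bar R) : \bar R :=
  ereal_sup [set ereal_inf (g @` A) | A in F].

Definition subsolution {H : Type} (p q beta : R) (c : meas -> H -> \bar R)
    (ev : H -> 'rV[R]_d -> R) (u : meas -> \bar R) :=
  forall mubar, Pq p mubar ->
  forall f Df D2f, isC2 q f Df D2f ->
    (f mubar)%:E = limsupF (nbhsD p mubar) u ->
    (forall mu, Pq p mu -> preceq mu mubar -> (u mu <= (f mu)%:E)%E) ->
    (liminfF (nbhsD p mubar) (Ham beta c ev f D2f) <= 0)%E.

Definition supersolution {H : Type} (p q beta : R) (c : meas -> H -> \bar R)
    (ev : H -> 'rV[R]_d -> R) (u : meas -> \bar R) :=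
  forall mubar, Pq p mubar ->
  forall f Df D2f, isC2 q f Df D2f ->
    (f mubar)%:E = liminfF (nbhsD p mubar) u ->
    (forall mu, Pq p mu -> preceq mu mubar -> ((f mu)%:E <= u mu)%E) ->
    (0 <= limsupF (nbhsD p mubar) (Ham beta c ev f D2f))%E.

Definition supported_in (N : nat) (xs : 'I_N -> 'rV[R]_d) (mu : meas) :=
  isprob mu /\ mu (~` range xs) = 0%E.

Definition openPH {H : topologicalType} (p : R) : set_system (meas * H) :=
  fun O => forall (mu : meas) (rho : H), O (mu, rho) -> Pq p mu /\
     exists A B, Pnbhs p mu A /\ nbhs rho B /\
       forall nu (sg : H), Pq p nu -> A nu -> B sg -> O (nu, sg).

Definition measurable_c {H : topologicalType} (p : R) (c : meas -> H -> \bar R) :=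
  forall Bs : set (\bar R), measurable Bs ->
    <<s [set z : meas * H | Pq p z.1], openPH p >>
      [set z : meas * H | Pq p z.1 /\ Bs (c z.1 z.2)].

End Defs.

(* Main.v *)
(* By continuity of [u], [w] and density it suffices to compare them at finitely
   supported measures, and by induction on the number of atoms one may assume
   [u <= w] as soon as one of the weights [a_0, .., a_n] vanishes. In the open
   simplex put [z_i = ln (a_i / a_0)], [kap z = 1 / a_0 = 1 + sum_i exp z_i], and
   [G = kap u], [W = kap w]. Homogenizing in this way turns
   [beta u + sup_rho (- c - L u) = 0] into
     [beta G + sup_rho (- kap c - 1/2 (D^2 G [r, r] - sum_i r_i^2 d_i G)) = 0]
   with [r_i = rho x_i - rho x_0]: for each fixed [rho] the differential operator
   has constant coefficients and kills [kap], and [r] is bounded by hypothesis (2).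

   Comparison then needs no doubling of variables. The sup-convolution [g] of [G]
   satisfies, for each [rho], second-difference inequalities in the directions
   [r] and [- r^2 / 2], which are linear in [g] and translation invariant, hence
   survive averaging over small translations; the average is smooth enough to be
   a classical subsolution up to an error, so that it can be used, minus a
   multiple of [kap], as a test function for the supersolution [W] at a maximum
   of the difference divided by [kap]. Such a maximum exists because [u <= w] on
   the boundary of the simplex. *)

Require Import Defs.
From HB Require Import structures.
From mathcomp Require Import all_boot all_order all_algebra.
From mathcomp Require Import all_classical all_reals all_analysis.
From mathcomp Require Import measurable_realfun lebesgue_measure.
From mathcomp Require Import ring lra.
Import Order.TTheory GRing.Theory Num.Theory.
Import numFieldNormedType.Exports.
Set Implicit Arguments. Unset Strict Implicit. Unset Printing Implicit Defensive.
Local Open Scope classical_set_scope.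
Local Open Scope ring_scope.

(** * Scalar products and quadratic forms on row vectors *)

Section Euclid.
Context {R : realType} {n : nat}.
Implicit Types (a b x y z : 'rV[R]_n) (X : 'M[R]_n).

(** The constant coefficients have a simple origin. On atoms, [L] sees [rho] only through the signed
    weights (rho x_i - mu(rho)) a_i, and the derivative of ln (a_i / a_0) along them is rho x_i -
    rho x_0, whatever the weights are. The sup-convolution is not smooth enough for the subsolution
    inequality to be evaluated on it pointwise. The inequality is instead obtained for increments,
    by contradiction: if a second difference along r were too negative, a parabola would touch the
    sup-convolution from above inside that segment and produce a jet of G violating the subsolution
    property. This works for one [rho] at a time, and each single inequality is linear although
    their supremum is not. The main obstacle is the cost. It is continuous uniformly in [rho], but
    nothing bounds it from above uniformly in [rho], and kap multiplies it. Freezing kap therefore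
    costs a relative error 1 + del, which is removed by scaling the smoothed function. This in turn
    requires a lower bound on the cost, and that bound is itself extracted from the subsolution
    inequality. *)

Definition dot a b : R := \sum_i a ord0 i * b ord0 i.
Definition sq a : R := dot a a.
Definition qf X a : R := \sum_i \sum_j X i j * (a ord0 i * a ord0 j).

Lemma dot_sum a b : dot a b = \sum_i a ord0 i * b ord0 i.
Proof. by []. Qed.

Lemma sqE a : sq a = dot a a.
Proof. by []. Qed.

Lemma qf_sum X a : qf X a = \sum_i \sum_j X i j * (a ord0 i * a ord0 j).
Proof. by []. Qed.

Lemma dot0l x : dot 0 x = 0.
Proof. by rewrite /dot big1 // => i _; rewrite mxE mul0r. Qed.

Lemma sq0 : sq 0 = 0.
Proof. exact: dot0l. Qed.

Lemma dotC a b : dot a b = dot b a.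
Proof. by apply: eq_bigr => i _; rewrite mulrC. Qed.

Lemma dotDl a b x : dot (a + b) x = dot a x + dot b x.
Proof. by rewrite /dot -big_split; apply: eq_bigr => i _; rewrite mxE mulrDl. Qed.

Lemma dotZl k a x : dot (k *: a) x = k * dot a x.
Proof. by rewrite /dot mulr_sumr; apply: eq_bigr => i _; rewrite mxE mulrA. Qed.

Lemma dotDr x a b : dot x (a + b) = dot x a + dot x b.
Proof. by rewrite !(dotC x) dotDl. Qed.

Lemma dotZr k x a : dot x (k *: a) = k * dot x a.
Proof. by rewrite !(dotC x) dotZl. Qed.

Lemma dotNl a x : dot (- a) x = - dot a x.
Proof. by rewrite -scaleN1r dotZl mulN1r. Qed.

Lemma dotNr x a : dot x (- a) = - dot x a.
Proof. by rewrite dotC dotNl dotC. Qed.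

Definition dotE := (dotDl, dotDr, dotZl, dotZr, dotNl, dotNr).

Lemma sq_ge0 a : 0 <= sq a.
Proof. by apply: sumr_ge0 => i _; rewrite -expr2 sqr_ge0. Qed.

Lemma sq_eq0 a : sq a = 0 -> a = 0.
Proof.
move/eqP; rewrite psumr_eq0 => [|i _]; last by rewrite -expr2 sqr_ge0.
move/allP => h; apply/rowP => i; rewrite mxE.
by have := h i (mem_index_enum _); rewrite -expr2 sqrf_eq0 => /eqP.
Qed.

Lemma coord_le_norm a i : `|a ord0 i| <= `|a|.
Proof.
rewrite /Num.norm /= mx_normrE.
exact: (le_bigmax _ (fun ij : 'I_1 * 'I_n => `|a ij.1 ij.2|) (ord0, i)).
Qed.

Lemma norm_leP a r : 0 <= r -> (forall i, `|a ord0 i| <= r) -> `|a| <= r.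
Proof.
move=> r0 h; rewrite /Num.norm /= mx_normrE.
by apply/bigmax_leP; split => // -[i j] _ /=; rewrite ord1.
Qed.

Lemma coord_sq_le a i : a ord0 i ^+ 2 <= sq a.
Proof.
rewrite /sq /dot (bigD1 i) //= -expr2 lerDl.
by apply: sumr_ge0 => j _; rewrite -expr2 sqr_ge0.
Qed.

Lemma norm_sq_le a : `|a| ^+ 2 <= sq a.
Proof.
have h : `|a| <= Num.sqrt (sq a).
  apply: norm_leP => [|i]; first exact: sqrtr_ge0.
  by rewrite -sqrtr_sqr ler_sqrt ?sq_ge0 // coord_sq_le.
rewrite -(sqr_sqrtr (sq_ge0 a)) ler_pXn2r // nnegrE ?normr_ge0 ?sqrtr_ge0 //.
Qed.

Lemma dot_le a b r s : `|a| <= r -> `|b| <= s -> `|dot a b| <= n%:R * (r * s).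
Proof.
move=> ha hb; apply: (le_trans (ler_norm_sum _ _ _)).
have -> : n%:R * (r * s) = \sum_(i < n) (r * s).
  by rewrite sumr_const card_ord mulr_natl.
apply: ler_sum => i _; rewrite normrM ler_pM //.
  exact: le_trans (coord_le_norm a i) ha.
exact: le_trans (coord_le_norm b i) hb.
Qed.

Lemma sq_le a r : `|a| <= r -> sq a <= n%:R * r ^+ 2.
Proof.
move=> h; rewrite -[sq a]ger0_norm ?sq_ge0 // expr2; exact: dot_le.
Qed.

Lemma qfDl X Y a : qf (X + Y) a = qf X a + qf Y a.
Proof.
rewrite /qf -big_split; apply: eq_bigr => i _; rewrite -big_split.
by apply: eq_bigr => j _; rewrite mxE mulrDl.
Qed.

Lemma qfZl k X a : qf (k *: X) a = k * qf X a.
Proof.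
rewrite /qf mulr_sumr; apply: eq_bigr => i _; rewrite mulr_sumr.
by apply: eq_bigr => j _; rewrite mxE -mulrA.
Qed.

Lemma qfNl X a : qf (- X) a = - qf X a.
Proof. by rewrite -scaleN1r qfZl mulN1r. Qed.

Lemma qf1 a : qf 1%:M a = sq a.
Proof.
apply: eq_bigr => i _; rewrite (bigD1 i) //= big1 ?addr0 => [|j ij].
  by rewrite mxE eqxx mul1r.
by rewrite mxE eq_sym (negbTE ij) mul0r.
Qed.

Lemma qf_diag x a : qf (diag_mx x) a = \sum_i x ord0 i * a ord0 i ^+ 2.
Proof.
apply: eq_bigr => i _; rewrite (bigD1 i) //= big1 ?addr0 => [|j ij].
  by rewrite mxE eqxx mulr1n expr2.
by rewrite mxE eq_sym (negbTE ij) mul0r.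
Qed.

Lemma qf_rank1 x a : qf (x^T *m x) a = dot x a ^+ 2.
Proof.
rewrite expr2 /dot mulr_suml; apply: eq_bigr => i _; rewrite mulr_sumr.
apply: eq_bigr => j _; rewrite mxE big_ord1 mxE; ring.
Qed.

Lemma qfZr k X a : qf X (k *: a) = k ^+ 2 * qf X a.
Proof.
rewrite /qf mulr_sumr; apply: eq_bigr => i _; rewrite mulr_sumr.
by apply: eq_bigr => j _; rewrite !mxE; ring.
Qed.

End Euclid.

#[global] Opaque dot sq qf.

(** * Continuity and compactness in terms of distances *)

Lemma near_dist {R : realType} {V : normedModType R} (x : V) (P : V -> Prop) :
  (\forall y \near x, P y) <-> exists2 d : R, 0 < d & forall y, `|y - x| < d -> P y.
Proof.
split=> [/nbhs_normP[d /= d0 h]|[d d0 h]].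
  by exists d => // y yd; apply: h; rewrite /= distrC.
by apply/nbhs_normP; exists d => // y /=; rewrite distrC; exact: h.
Qed.

Lemma continuous_eps {R : realType} {V : normedModType R} (f : V -> R) :
  continuous f <->
  forall z e, 0 < e -> exists2 d, 0 < d & forall z', `|z' - z| < d -> `|f z' - f z| < e.
Proof.
split=> [cf z e e0|h z].
  have /cvgrPdistC_lt/(_ e e0) := cf z.
  by move=> /near_dist.
by apply/cvgrPdistC_lt => e e0; apply/near_dist; exact: h.
Qed.

(** The local hypothesis concerns all small [e], not a single one: it is a property along the filter
    [0^'+], for which compactness in its near-covering form gives a common [e]. *)
Lemma compact_unif {R : realType} {V : normedModType R} (K : set V) (P : R -> V -> Prop) :
  compact K ->
  (forall z, K z -> exists2 d, 0 < d &
     forall e z', 0 < e < d -> `|z' - z| < d -> P e z') ->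
  exists2 e, 0 < e & forall z, K z -> P e z.
Proof.
move=> /compact_near_coveringP cK h.
have he : \forall e \near 0^'+, K `<=` P e.
  apply: cK => z Kz; have [d d0 hd] := h z Kz.
  exists ([set z' | `|z' - z| < d], [set e | 0 < e < d]) => /=.
    split; first by apply/near_dist; exists d.
    by near=> e; apply/andP; split; near: e; [exact: nbhs_right_gt|exact: nbhs_right_lt].
  by move=> [z' e] /= [zd ed]; apply: hd.
have [e [eK e0]] : exists e : R, K `<=` P e /\ 0 < e.
  apply: (@filter_ex _ (0^'+)); near=> e; split; last by near: e; exact: nbhs_right_gt.
  by near: e.
by exists e.
Unshelve. all: by end_near. Qed.

Lemma ball_compact {R : realType} {n} (r : R) : compact [set z : 'rV[R]_n | `|z| <= r].
Proof.
apply: bounded_closed_compact.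
  by exists r; split; [exact: num_real|move=> x rx z /= zr; apply: le_trans zr (ltW rx)].
apply: (@closed_comp _ _ (fun z : 'rV[R]_n => `|z|) [set x | x <= r]).
  by move=> z _; exact: norm_continuous.
exact: closed_le.
Qed.

Lemma continuous_sum {R : realType} {T : topologicalType} {I : Type} (s : seq I)
    (P : pred I) (F : I -> T -> R) :
  (forall i, P i -> continuous (F i)) -> continuous (fun x => \sum_(i <- s | P i) F i x).
Proof.
by move=> h; apply: continuous_big => //; exact: add_continuous.
Qed.

Section ContinuousReal.
Context {R : realType} {T : topologicalType}.
Implicit Types f g : T -> R.

Lemma continuous_add f g :
  continuous f -> continuous g -> continuous (fun x => f x + g x).
Proof. by move=> cf cg x; exact: (cvgD (cf x) (cg x)). Qed.

Lemma continuous_sub f g :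
  continuous f -> continuous g -> continuous (fun x => f x - g x).
Proof. by move=> cf cg x; exact: (cvgB (cf x) (cg x)). Qed.

Lemma continuous_mul f g :
  continuous f -> continuous g -> continuous (fun x => f x * g x).
Proof. by move=> cf cg x; exact: (cvgM (cf x) (cg x)). Qed.

Lemma continuous_inv f :
  (forall x, f x != 0) -> continuous f -> continuous (fun x => (f x)^-1).
Proof. by move=> f0 cf x; exact: (cvgV (f0 x) (cf x)). Qed.

Lemma continuous_const (c : R) : continuous (fun _ : T => c).
Proof. by move=> x; exact: cvg_cst. Qed.

End ContinuousReal.

Lemma continuous_coord {R : realType} {n} (i : 'I_n) :
  continuous (fun z : 'rV[R]_n => z ord0 i).
Proof. exact: coord_continuous. Qed.

(** Handles inner maps such as segments, translations and projections by one norm estimate. The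
    proof uses [|L| + 1], because the sign of [L] is arbitrary. *)
Lemma continuous_lipschitz {R : realType} {V W : normedModType R} (h : V -> W) (f : W -> R) (L : R) :
  (forall x y, `|h x - h y| <= L * `|x - y|) -> continuous f -> continuous (f \o h).
Proof.
move=> hL /continuous_eps cf; apply/continuous_eps => z e e0.
have [d d0 hd] := cf (h z) e e0; have L1 : 0 < `|L| + 1 by rewrite ltr_wpDl.
exists (d / (`|L| + 1)); first exact: divr_gt0.
move=> z' z'd; apply: hd; apply: (le_lt_trans (hL _ _)).
apply: (@le_lt_trans _ _ ((`|L| + 1) * `|z' - z|)).
  rewrite ler_wpM2r //; apply: le_trans (ler_norm L) _; by rewrite lerDl.
by rewrite mulrC -ltr_pdivlMr.
Qed.

(** First-order condition at an extremum, without derivatives: at [x = - (m * t)] with [t] small and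
    positive, the linear term beats the quadratic one. *)
Lemma linear_coeff_eq0 {R : realType} (m C d : R) : 0 < d ->
  (forall x, `|x| < d -> 0 <= x * m + x ^+ 2 * C) -> m = 0.
Proof.
move=> d0 h; apply/eqP/negP => /negP m0.
have m1 : 0 < `|m| by rewrite normr_gt0.
pose t := Num.min (d / 2 / `|m|) (2^-1 / (`|C| + 1)).
have c1 : 0 < `|C| + 1 by rewrite ltr_wpDl.
have t0 : 0 < t by rewrite lt_min !divr_gt0.
have td : `|- (m * t)| < d.
  rewrite normrN normrM (gtr0_norm t0).
  have : t <= d / 2 / `|m| by rewrite ge_min lexx.
  rewrite ler_pdivlMr // mulrC => h'; apply: le_lt_trans h' _.
  by rewrite ltr_pdivrMr // ltr_pMr // ltr1n.
have tC : t * C <= 2^-1.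
  have : t <= 2^-1 / (`|C| + 1) by rewrite ge_min lexx orbT.
  rewrite ler_pdivlMr // => h'; apply: le_trans h'.
  rewrite ler_pM2l //; apply: le_trans (ler_norm C) _.
  by rewrite lerDl.
have := h _ td.
have -> : - (m * t) * m + (- (m * t)) ^+ 2 * C = (m ^+ 2 * t) * (t * C - 1) by ring.
have m2 : 0 < m ^+ 2 * t by rewrite mulr_gt0 // exprn_even_gt0.
rewrite pmulr_rge0 //; lra.
Qed.

(** * Jets and sup-convolutions *)

Section Jets.
Context {R : realType} {n : nat}.
Implicit Types (f : 'rV[R]_n -> R) (z p y : 'rV[R]_n) (X : 'M[R]_n).

(** Superjets in Peano form, so that no test function has to be constructed; [X] may be any matrix,
    symmetric or not. The remainder uses the Euclidean square, the ball the maximum norm. *)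
Definition upper_jet f z p X := forall e, 0 < e -> exists2 d, 0 < d &
  forall y, `|y| < d -> f (z + y) <= f z + dot p y + 2^-1 * qf X y + e * sq y.

Definition lower_jet f z p X := forall e, 0 < e -> exists2 d, 0 < d &
  forall y, `|y| < d -> f z + dot p y + 2^-1 * qf X y - e * sq y <= f (z + y).

End Jets.

Lemma sq_continuous {R : realType} {n : nat} : continuous (@sq R n).
Proof.
rewrite (_ : sq = fun z : 'rV[R]_n => \sum_i z ord0 i * z ord0 i).
  by apply: continuous_sum => i _; apply: continuous_mul; exact: continuous_coord.
by apply/funext => z; rewrite sqE dot_sum.
Qed.

(** Competitors are restricted to a ball because the [G] of interest carries the unbounded factor
    [kap]. The supremum is then attained, and [m] records a maximizer. *)
Record is_sup_conv {R : realType} {n : nat} (G : 'rV[R]_n -> R) (r k : R)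
    (g : 'rV[R]_n -> R) (m : 'rV[R]_n -> 'rV[R]_n) : Prop := IsSupConv {
  argmax_le : forall z, `|m z| <= r;
  sup_conv_ge : forall z y, `|y| <= r -> G y - k * sq (z - y) <= g z;
  sup_convE : forall z, g z = G (m z) - k * sq (z - m z) }.

Lemma sup_conv_exists {R : realType} {n : nat} (G : 'rV[R]_n -> R) (r k : R) :
  continuous G -> 0 <= r -> exists g m, is_sup_conv G r k g m.
Proof.
move=> cG r0.
have /choice[m hm] z : exists y, `|y| <= r /\
    forall y', `|y'| <= r -> G y' - k * sq (z - y') <= G y - k * sq (z - y).
  have cf : {within [set y : 'rV[R]_n | `|y| <= r], continuous (fun y => G y - k * sq (z - y))}.
    apply: continuous_subspaceT; apply: continuous_sub => //.
    apply: continuous_mul; first exact: continuous_const.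
    apply: (@continuous_lipschitz _ _ _ (fun y => z - y) (@sq R n) 1); last exact: sq_continuous.
    by move=> x y; rewrite opprB mul1r addrC addrA subrK distrC.
  have ne : [set y : 'rV[R]_n | `|y| <= r] !=set0 by exists 0; rewrite /= normr0.
  have [y] := EVT_max_rV ne (@ball_compact R n r) cf.
  by rewrite inE /= => yr h; exists y; split => // y' y'r; apply: h; rewrite inE.
by exists (fun z => G (m z) - k * sq (z - m z)), m; split => // z; case: (hm z).
Qed.

Section SupConvolution.
Context {R : realType} {n : nat}.
Variables (G : 'rV[R]_n -> R) (r k : R) (sup_conv : 'rV[R]_n -> R) (sc_argmax : 'rV[R]_n -> 'rV[R]_n).
Hypotheses (r0 : 0 <= r) (k0 : 0 < k) (sc : is_sup_conv G r k sup_conv sc_argmax).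
Implicit Types (z y rho v : 'rV[R]_n).

Lemma sq_subB z z' y : sq (z - y) - sq (z' - y) = dot (z - z') (z + z' - y - y).
Proof.
by rewrite !sqE !dotE (dotC z' z) (dotC y z) (dotC y z'); ring.
Qed.

(** The maximizer at one point is a competitor at the other, which leaves only a difference of two
    penalties: no modulus of continuity of [G] enters. *)
Lemma sup_conv_lipschitz s z z' : `|z| <= s -> `|z'| <= s ->
  `|sup_conv z - sup_conv z'| <= k * (n%:R * (2 * s + 2 * r)) * `|z - z'|.
Proof.
wlog h : z z' / sup_conv z' <= sup_conv z.
  move=> hw; case: (leP (sup_conv z') (sup_conv z)) => [/hw//|/ltW/hw h zs z's].
  by rewrite distrC (distrC z); exact: h.
move=> zs z's; rewrite ger0_norm ?subr_ge0 //.
have := sup_conv_ge sc z' (argmax_le sc z) => h1; have h2 := sup_convE sc z.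
apply: (@le_trans _ _ (k * `|dot (z - z') (z + z' - sc_argmax z - sc_argmax z)|)).
  rewrite -sq_subB.
  apply: (@le_trans _ _ (k * (sq (z' - sc_argmax z) - sq (z - sc_argmax z)))); first lra.
  by rewrite ler_pM2l // distrC ler_norm.
rewrite -mulrA ler_pM2l //.
rewrite -mulrA (mulrC (_ + _)); apply: dot_le => //.
apply: (le_trans (ler_normB _ _)); apply: (@le_trans _ _ (`|z| + `|z'| + r + r)); last lra.
apply: lerD; last exact: (argmax_le sc).
apply: (le_trans (ler_normB _ _)); apply: lerD; last exact: (argmax_le sc).
exact: ler_normD.
Qed.

(** The competitor [z] itself pays no penalty, so the penalty at the maximizer is at most the
    oscillation of [G]. *)
Lemma sc_argmax_dist M z : (forall y, `|y| <= r -> `|G y| <= M) -> `|z| <= r ->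
  k * sq (z - sc_argmax z) <= 2 * M.
Proof.
move=> hM zr; have := sup_conv_ge sc z zr; rewrite (sup_convE sc) subrr.
rewrite sq0.
have := hM _ zr; have := hM _ (argmax_le sc z).
rewrite !ler_norml => /andP[? ?] /andP[? ?]; lra.
Qed.

Lemma sup_conv_continuous : continuous sup_conv.
Proof.
apply/continuous_eps => z e e0; pose L := k * (n%:R * (2 * (`|z| + 1) + 2 * r)) + 1.
have L0 : 0 < L.
  by rewrite ltr_wpDl // mulr_ge0 ?(ltW k0) // mulr_ge0 // addr_ge0 // mulr_ge0 // addr_ge0.
exists (Num.min 1 (e / L)); first by rewrite lt_min ltr01 divr_gt0.
move=> z'; rewrite lt_min => /andP[z1 z2].
have zs : `|z| <= `|z| + 1 by rewrite lerDl.
have z's : `|z'| <= `|z| + 1.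
  rewrite -[z'](subrK z) addrC; apply: (le_trans (ler_normD _ _)); rewrite lerD2l; exact: ltW.
apply: (le_lt_trans (sup_conv_lipschitz z's zs)).
apply: (@le_lt_trans _ _ (L * `|z' - z|)); first by rewrite ler_wpM2r // /L lerDl.
by rewrite mulrC -ltr_pdivlMr.
Qed.

(* The quadratic [X] below is flat across the line [z + t rho] in the direction
   of [rho]: moving [t] along with [y] trades the large curvature [2 k] of the
   penalty for [- 2 Th]. *)
Lemma sup_conv_second_diff z rho v (h tau Th th : R) : 0 < h -> 0 < tau ->
  (forall t, `|t| <= h -> sup_conv (z + t *: rho + tau *: v) - sup_conv (z + t *: rho)
     + k * tau ^+ 2 * sq v <= th * tau) ->
  (forall t, `|t| <= h -> `|sc_argmax (z + t *: rho)| < r) ->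
  sup_conv (z + h *: rho) + sup_conv (z - h *: rho) - 2 * sup_conv z < - (2 * h ^+ 2 * Th) ->
  exists t p X, [/\ `|t| <= h, upper_jet G (sc_argmax (z + t *: rho)) p X &
    2^-1 * qf X rho + dot p v <= th - Th].
Proof.
move=> h0 tau0 hth hin hlt.
(* The slope [b] equalizes the values of [D] at [h] and [- h]. The assumption on the second
   difference says that this common value is below [D 0], so [D] has an interior maximum. *)
pose b := (sup_conv (z + h *: rho) - sup_conv (z - h *: rho)) / (2 * h).
pose D t := sup_conv (z + t *: rho) + Th * t ^+ 2 - b * t.
have bh : b * h = (sup_conv (z + h *: rho) - sup_conv (z - h *: rho)) / 2.
  by rewrite /b; field; rewrite gt_eqF.
have cD : continuous D.
  apply: continuous_sub; last by apply: continuous_mul; [exact: continuous_const|move=> ?; exact: cvg_id].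
  apply: continuous_add; last by apply: continuous_mul; [exact: continuous_const|exact: exprn_continuous].
  apply: (@continuous_lipschitz R R 'rV[R]_n (fun t => z + t *: rho) sup_conv `|rho|).
    by move=> x y; rewrite opprD addrACA subrr add0r -scalerBl normrZ mulrC.
  exact: sup_conv_continuous.
have [t th1 tmax] : exists2 t, t \in `[(- h), h] & forall s, s \in `[(- h), h] -> D s <= D t.
  by apply: EVT_max; [lra|exact: continuous_subspaceT].
have tmax' s : `|s| <= h -> D s <= D t.
  by move=> sh; apply: tmax; rewrite in_itv /= -ler_norml.
have tlt : `|t| < h.
  rewrite lt_neqAle; move: (th1); rewrite in_itv /= -ler_norml => ->; rewrite andbT.
  apply/negP => /eqP tE; have := tmax' 0; rewrite normr0 (ltW h0) => /(_ isT).
  rewrite /D scale0r addr0 expr0n /= !mulr0 addr0 subr0.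
  have [tE'|tE'] : t = h \/ t = - h.
  - by have [t0|t0] := leP 0 t; [left; rewrite -tE ger0_norm|right; rewrite -tE ltr0_norm ?opprK].
  - by rewrite tE'; lra.
  - by rewrite tE' scaleNr sqrrN mulrN; lra.
set zt := z + t *: rho; set yh := sc_argmax zt.
have [e eE] : exists e, e = yh - zt by exists (yh - zt).
(* Two independent moves: [yh + y] serves as a competitor at the parameter [t + a], while [D] is
   maximal at [t]. *)
have key a y : `|t + a| <= h -> `|yh + y| <= r ->
    G (yh + y) <= G yh + k * (sq (e + y - a *: rho) - sq e) - Th * (2 * t * a + a ^+ 2) + b * a.
  move=> ta yr; have := tmax' _ ta; have := sup_conv_ge sc (z + (t + a) *: rho) yr.
  rewrite /D -/zt (sup_convE sc zt) -/yh.
  have -> : z + (t + a) *: rho - (yh + y) = - (e + y - a *: rho).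
    by rewrite eE /zt scalerDl; apply/rowP => i; rewrite !mxE; ring.
  have -> : zt - yh = - e by rewrite eE opprB.
  rewrite !sqE !dotNl !dotNr !opprK; lra.
have yin : `|yh| < r by apply: hin; exact: ltW.
pose s := sq rho.
(* Moving only along the segment, with [y = 0], gives the first-order condition in [a]. *)
have foc : 2 * k * dot e rho + 2 * Th * t - b = 0.
  apply/eqP; rewrite -oppr_eq0; apply/eqP.
  apply: (@linear_coeff_eq0 _ _ (k * s - Th) (h - `|t|)); first lra.
  move=> x xh; have tx : `|t + x| <= h by apply: (le_trans (ler_normD _ _)); lra.
  have := key x 0 tx; rewrite !addr0 (ltW yin) => /(_ isT).
  have -> : sq (e - x *: rho) - sq e = - 2 * x * dot e rho + x ^+ 2 * s.
    by rewrite /s !sqE !dotE (dotC rho e); ring.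
  lra.
(* Keeping the competitor [yh] at the point shifted by [tau *: v] compares the gradient [2 k e] of
   the penalty with the difference of [sup_conv] along [v]. *)
have slope : 2 * k * dot e v <= th.
  have := hth t (ltW tlt); rewrite -/zt => ht.
  have := sup_conv_ge sc (zt + tau *: v) (ltW yin) => h1.
  have : sup_conv zt = G yh - k * sq e.
    rewrite (sup_convE sc) -/yh (_ : zt - yh = - e); last by rewrite eE opprB.
    by rewrite !sqE dotNl dotNr opprK.
  have E : sq (zt + tau *: v - yh) = sq e - 2 * tau * dot e v + tau ^+ 2 * sq v.
    have -> : zt + tau *: v - yh = tau *: v - e by rewrite eE; apply/rowP => i; rewrite !mxE; ring.
    by rewrite !sqE !dotE (dotC v e); ring.
  move: h1; rewrite E => h1 h2; rewrite -(ler_pM2r tau0); lra.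
(* Chosen so that [qf X rho = - 2 * Th]. If [rho = 0], then [s], [c] and the [a] below are all 0 by
   the convention on division, and the second-difference assumption forces [Th < 0]. *)
pose c := 2 * k / s + 2 * Th / s ^+ 2.
exists t, ((2 * k) *: e), ((2 * k)%:M - c *: (rho^T *m rho)); split; first exact: ltW.
- move=> eps eps0; pose d := Num.min ((h - `|t|) / (1 + `|n%:R * `|rho| / s|)) (r - `|yh|).
  have d1 : 0 < 1 + `|n%:R * `|rho| / s| by rewrite ltr_wpDr.
  exists d; first by rewrite lt_min divr_gt0 //; lra.
  move=> y; rewrite lt_min => /andP[y1 y2].
  (* Moving along with the projection of [y] on [rho] leaves only the orthogonal part of [y] in the
     penalty. *)
  pose a := dot rho y / s.
  have ah : `|t + a| <= h.
    apply: (le_trans (ler_normD _ _)); rewrite -lerBrDl.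
    move: y1; rewrite ltr_pdivlMr // => /ltW; apply: le_trans.
    rewrite /a normrM; apply: (@le_trans _ _ (n%:R * (`|rho| * `|y|) * `|s^-1|)).
      by rewrite ler_wpM2r //; exact: dot_le.
    rewrite !normrM normr_id (ger0_norm (ler0n _ n)) mulrDr mulr1.
    by rewrite -subr_ge0; have := normr_ge0 y; lra.
  have yr : `|yh + y| <= r by apply: (le_trans (ler_normD _ _)); lra.
  apply: (le_trans (key _ _ ah yr)).
  have qX : qf ((2 * k)%:M - c *: (rho^T *m rho)) y = 2 * k * sq y - c * dot rho y ^+ 2.
    by rewrite qfDl qfNl qfZl qf_rank1 -scalemx1 qfZl qf1.
  have as1 : a * s = dot rho y.
    rewrite /a; have [s0|s0] := eqVneq s 0; last by rewrite divfK.
    by rewrite (sq_eq0 s0) /a s0 mulr0 dot0l.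
  have E : k * (sq (e + y - a *: rho) - sq e) - Th * (2 * t * a + a ^+ 2) + b * a =
      2 * k * dot e y + (k * sq y - k * a * (a * s) - Th * a ^+ 2)
      - a * (2 * k * dot e rho + 2 * Th * t - b).
    have -> : sq (e + y - a *: rho) = sq e + 2 * dot e y + sq y + a ^+ 2 * s
        - 2 * a * dot e rho - 2 * a * dot rho y.
      by rewrite /s !sqE !dotE (dotC y e) (dotC rho e) (dotC y rho); ring.
    rewrite -as1; ring.
  have F : c * dot rho y ^+ 2 = 2 * (k * a * (a * s) + Th * a ^+ 2).
    rewrite /c; have [s0|s0] := eqVneq s 0.
      have -> : a = 0 by rewrite /a s0 invr0 mulr0.
      have -> : dot rho y = 0 by rewrite -as1 s0 mulr0.
      by rewrite !(mulr0, expr0n) /=; ring.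
    by rewrite /a; field.
  rewrite -!addrA lerD2l !addrA E foc mulr0 subr0 dotZl qX.
  by have : 0 <= eps * sq y by [rewrite mulr_ge0 ?sq_ge0 // ltW]; lra.
- rewrite qfDl qfNl qfZl qf_rank1 -scalemx1 qfZl qf1 dotZl -/s.
  have [s0|s0] := eqVneq s 0.
    have rho0 := sq_eq0 s0; rewrite s0 rho0 in hth hlt *.
    have := hth 0; rewrite normr0 (ltW h0) => /(_ isT).
    move: hlt; rewrite !scaler0 subr0 !addr0.
    have hh : 0 < h ^+ 2 by rewrite exprn_gt0.
    have -> : sup_conv z + sup_conv z - 2 * sup_conv z = 0 by ring.
    rewrite oppr_gt0 -mulrA pmulr_rlt0 // pmulr_rlt0 // => Th0 _.
    by rewrite dot0l expr0n /= !mulr0 subr0 mulr0 add0r; lra.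
  have -> : c * dot rho rho ^+ 2 = 2 * k * s + 2 * Th by rewrite /c -sqE -/s; field.
  lra.
Qed.

End SupConvolution.

Lemma continuous_unif {R : realType} {n} (f : 'rV[R]_n -> R) (r e : R) :
  continuous f -> 0 < e -> exists2 d, 0 < d &
    forall z z', `|z| <= r -> `|z' - z| < d -> `|f z' - f z| < e.
Proof.
move=> /continuous_eps cf e0.
have [|d d0 hd] := @compact_unif _ _ _
  (fun d z => forall z', `|z' - z| < d -> `|f z' - f z| < e) (@ball_compact R n r).
  move=> z _; have e2 : 0 < e / 2 by lra.
  have [d d0 hd] := cf z _ e2; exists (d / 2); first lra.
  move=> x z' /andP[x0 xd] z'd z'' z''d.
  have h1 : `|f z' - f z| < e / 2 by apply: hd; lra.
  have h2 : `|f z'' - f z| < e / 2.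
    by apply: hd; apply: (le_lt_trans (ler_distD z' _ _)); lra.
  by apply: (le_lt_trans (ler_distD (f z) _ _)); rewrite (distrC (f z)); lra.
by exists d => // z z' zr; exact: hd.
Qed.

Lemma fin_delta {R : realType} {I : finType} (P : I -> R -> Prop) :
  (forall i, exists2 d, 0 < d & forall d', 0 < d' <= d -> P i d') ->
  exists2 d, 0 < d & forall i, P i d.
Proof.
move=> h; suff [d d0 hd] : exists2 d, 0 < d & forall i, i \in enum I ->
    forall d', 0 < d' <= d -> P i d'.
  by exists d => // i; apply: (hd i); rewrite ?mem_enum // d0 lexx.
elim: (enum I) => [|i s [d d0 hd]]; first by exists 1.
have [d1 d10 hd1] := h i; exists (Num.min d d1); first by rewrite lt_min d0.
move=> j; rewrite inE => /predU1P[-> x|js x]; rewrite le_min => /and3P[x0 xd xd1].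
  by apply: hd1; rewrite x0.
by apply: hd => //; rewrite x0.
Qed.

Lemma is_derive_eps {R : realType} (F : R -> R) (t l : R) :
  (forall e, 0 < e -> exists2 d, 0 < d &
    forall h, `|h| < d -> `|F (t + h) - F t - h * l| <= e * `|h|) ->
  is_derive t 1 F l.
Proof.
move=> H; have cv : h^-1 *: ((F \o shift t) (h *: 1) - F t) @[h --> 0^'] --> l.
  apply/cvgrPdistC_lt => e e0; have e2 : 0 < e / 2 by lra.
  have [d d0 hd] := H _ e2; near=> h.
  have h0 : h != 0 by near: h; exact: nbhs_dnbhs_neq.
  have hd' : `|h| < d.
    by near: h; apply: dnbhs0_lt.
  rewrite /= [h *: 1]mulr1 (addrC h) [_ *: _]mulrC.
  have -> : (F (t + h) - F t) * h^-1 - l = (F (t + h) - F t - h * l) / h by field.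
  rewrite normrM normfV ltr_pdivrMr ?normr_gt0 //.
  apply: (le_lt_trans (hd _ hd')); rewrite ltr_pM2r ?normr_gt0 //; lra.
split; first by apply/cvg_ex; exists l.
by apply: cvg_lim.
Unshelve. all: by end_near. Qed.

(** * Smoothing by iterated averages *)

Section UnitIntegral.
Context {R : realType}.
Implicit Types f g : R -> R.

Definition I01 f := (\int[@lebesgue_measure R]_(x in `[0%R, 1%R]) f x)%R.

Lemma I01_integrable f : continuous f ->
  (@lebesgue_measure R).-integrable `[0%R, 1%R] (EFin \o f).
Proof.
move=> cf; apply: continuous_compact_integrable; first exact: segment_compact.
exact: continuous_subspaceT.
Qed.

Lemma I01_const c : I01 (fun=> c) = c.
Proof. rewrite /I01 Rintegral_cst //=.
have -> : lebesgue_measure (`[0, 1]%classic : set R) = 1%E by rewrite lebesgue_measure_itv /= lte_fin ltr01 oppr0 adde0.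
by rewrite mulr1. Qed.

Lemma I01D f g : continuous f -> continuous g -> I01 (fun x => f x + g x) = I01 f + I01 g.
Proof. by move=> cf cg; rewrite /I01 RintegralD //; exact: I01_integrable. Qed.

Lemma I01Z c f : continuous f -> I01 (fun x => c * f x) = c * I01 f.
Proof. by move=> cf; rewrite /I01 RintegralZl //; exact: I01_integrable. Qed.

Lemma I01_ge0 f : (forall x, 0 <= x <= 1 -> 0 <= f x) -> 0 <= I01 f.
Proof. by move=> h; apply: Rintegral_ge0 => x /=; rewrite in_itv /=; exact: h. Qed.

(** The interval from -2 to 2 contains every [s * x + t] with 0 <= s * x <= 1 and |t| < 1, which is
    all that the averages visit. *)
Lemma primitive f : continuous f ->
  exists F : R -> R, forall x : R, - 2 < x -> x < 2 -> is_derive x 1 F (f x).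
Proof.
move=> cf; exists (fun x => (\int[@lebesgue_measure R]_(t in `[(- 2)%R, x]) f t)%R) => x x1 x2.
have [|d <-] := @continuous_FTC1_closed R f (- 2) x 2 x2 _ x1 (cf x).
  apply: continuous_compact_integrable; first exact: segment_compact.
  exact: continuous_subspaceT.
by rewrite derive1E; exact: derivableP.
Qed.

Lemma I01_primitive f F (s t : R) : continuous f ->
  (forall x : R, - 2 < x -> x < 2 -> is_derive x 1 F (f x)) ->
  0 < s <= 1 -> `|t| < 1 -> I01 (fun x => f (s * x + t)) = (F (s + t) - F t) / s.
Proof.
move=> cf dF /andP[s0 s1]; rewrite ltr_norml => /andP[t1 t2].
have cphi : continuous (fun x => f (s * x + t)).
  apply: (@continuous_lipschitz R R R (fun x => s * x + t) f s) => // x y.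
  by rewrite opprD addrACA subrr addr0 -mulrBr normrM (gtr0_norm s0).
have dG (x : R) : 0 <= x -> x <= 1 -> is_derive x 1 (fun x => s^-1 * F (s * x + t)) (f (s * x + t)).
  move=> x0 x1.
  have sx0 : 0 <= s * x by rewrite mulr_ge0 // ltW.
  have sx1 : s * x <= 1 by rewrite -[1]mul1r ler_pM // ltW.
  have d1 : is_derive (s * x + t) 1 F (f (s * x + t)) by apply: dF; lra.
  have d2 : is_derive x 1 (fun x : R => s * x + t) s.
    by apply: is_derive_eq; rewrite addr0 [_ *: _]mulr1.
  have d3 := @is_derive1_comp R F (fun x : R => s * x + t) x _ _ d1 d2.
  have d4 := is_deriveZ s^-1 d3.
  apply: (is_derive_eq d4); rewrite /GRing.scale /=; field; by rewrite gt_eqF.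
rewrite /I01 /Rintegral.
rewrite (@continuous_FTC2 R _ (fun x => s^-1 * F (s * x + t)) 0 1) //.
- by rewrite /= !mulr0 !mulr1 add0r -mulrBr mulrC.
- exact: continuous_subspaceT.
- have cG x : 0 <= x -> x <= 1 -> {for x, continuous (fun x => s^-1 * F (s * x + t))}.
    move=> x0 x1; have [dd _] := dG x x0 x1.
    by apply: differentiable_continuous; apply/derivable1_diffP.
  split.
  + by move=> x; rewrite in_itv /= => /andP[/ltW x0 /ltW x1]; have [] := dG x x0 x1.
  + by apply: cvg_at_right_filter; apply: cG.
  + by apply: cvg_at_left_filter; apply: cG.
- move=> x; rewrite in_itv /= => /andP[/ltW x0 /ltW x1].
  by rewrite derive1E; have [] := dG x x0 x1.
Qed.

End UnitIntegral.

Section Averaging.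
Context {R : realType} {n : nat}.
Notation V := 'rV[R]_n.
Implicit Types (f g : V -> R) (z d : V) (a s : R) (i : 'I_n).

(* [S] behaves like the convolution with a probability supported in the ball of
   radius [a]. *)
Record averaging a (S : (V -> R) -> V -> R) : Prop := Averaging {
  av_continuous : forall f, continuous f -> continuous (S f);
  av_const : forall c z, S (fun=> c) z = c;
  av_add : forall f g z, continuous f -> continuous g ->
    S (fun x => f x + g x) z = S f z + S g z;
  av_scale : forall c f z, continuous f -> S (fun x => c * f x) z = c * S f z;
  av_ge0 : forall f z, continuous f ->
    (forall x, `|x - z| <= a -> 0 <= f x) -> 0 <= S f z;
  av_shift : forall f d z, S (fun x => f (x + d)) z = S f (z + d) }.

Lemma averaging_id : averaging 0 (fun f => f).
Proof. by split => // f z _; apply; rewrite subrr normr0. Qed.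

Lemma averaging_comp a b S T : averaging a S -> averaging b T ->
  averaging (a + b) (fun f => S (T f)).
Proof.
move=> hS hT; split.
- by move=> f cf; apply: (av_continuous hS); exact: (av_continuous hT).
- move=> c z; rewrite (_ : T _ = fun=> c) ?(av_const hS) //.
  by apply/funext => x; rewrite (av_const hT).
- move=> f g z cf cg; rewrite -(av_add hS); try exact: (av_continuous hT).
  by congr (S _ z); apply/funext => x; rewrite (av_add hT).
- move=> c f z cf; rewrite -(av_scale hS); last exact: (av_continuous hT).
  by congr (S _ z); apply/funext => x; rewrite (av_scale hT).
- move=> f z cf h; apply: (av_ge0 hS); first exact: (av_continuous hT).
  move=> x xz; apply: (av_ge0 hT) => // y yx; apply: h.
  by apply: (le_trans (ler_distD x _ _)); rewrite addrC lerD.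
- move=> f d z; rewrite -(av_shift hS).
  by congr (S _ z); apply/funext => x; rewrite (av_shift hT).
Qed.

Lemma averaging_le a b S : a <= b -> averaging a S -> averaging b S.
Proof.
move=> ab [h1 h2 h3 h4 h5 h6]; split => // f z cf h; apply: h5 => // x xz.
by apply: h; exact: le_trans xz ab.
Qed.

Definition evec i : V := delta_mx ord0 i.

Lemma evec_norm i (t : R) : `|t *: evec i| <= `|t|.
Proof.
apply: norm_leP => // j; rewrite !mxE eqxx /=.
by case: (j == i); rewrite ?mulr1 ?mulr0 ?normr0.
Qed.

(** Averaging over the one-sided segment from [z] to [z + s *: evec i] makes the derivative along
    [evec i] a plain difference quotient of [f]. *)
Definition avg s i f z := I01 (fun x => f (z + (s * x) *: evec i)).

Lemma continuous_segment f z (w : V) : continuous f -> continuous (fun x : R => f (z + x *: w)).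
Proof.
move=> cf; apply: (@continuous_lipschitz R R V (fun x => z + x *: w) f `|w|) cf.
by move=> x y; rewrite opprD addrACA subrr add0r -scalerBl normrZ mulrC.
Qed.

Lemma continuous_avg_integrand s i f z : continuous f ->
  continuous (fun x : R => f (z + (s * x) *: evec i)).
Proof.
move=> cf; have := @continuous_segment f z (s *: evec i) cf.
rewrite (_ : (fun x => f (z + (s * x) *: evec i)) = fun x => f (z + x *: (s *: evec i))) //.
by apply/funext => x; rewrite scalerA mulrC.
Qed.

Lemma averaging_avg s i : 0 <= s -> averaging s (avg s i).
Proof.
move=> s0.
have add f g z : continuous f -> continuous g ->
    avg s i (fun x => f x + g x) z = avg s i f z + avg s i g z.
  by move=> cf cg; rewrite /avg I01D //; exact: continuous_avg_integrand.
have scale c f z : continuous f -> avg s i (fun x => c * f x) z = c * avg s i f z.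
  by move=> cf; rewrite /avg I01Z //; exact: continuous_avg_integrand.
have const c z : avg s i (fun=> c) z = c by exact: I01_const.
have ge0 f z : continuous f -> (forall x, `|x - z| <= s -> 0 <= f x) -> 0 <= avg s i f z.
  move=> cf h; apply: I01_ge0 => x /andP[x0 x1]; apply: h.
  rewrite addrAC subrr add0r; apply: (le_trans (evec_norm _ _)).
  by rewrite ger0_norm ?mulr_ge0 // -[leRHS]mulr1 ler_wpM2l.
have shift f d z : avg s i (fun x => f (x + d)) z = avg s i f (z + d).
  by rewrite /avg; congr I01; apply/funext => x; rewrite addrAC.
split => // f cf; apply/continuous_eps => z e e0; have e2 : 0 < e / 2 by lra.
have [d d0 hd] := continuous_unif (`|z| + s) cf e2.
exists d => // z' z'd; set w := z' - z in z'd.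
have cw : continuous (fun x => f (x + w)).
  apply: (@continuous_lipschitz R V V (fun x => x + w) f 1) cf => x y.
  by rewrite opprD addrACA subrr addr0 mul1r.
have near x : `|x - z| <= s -> `|f (x + w) - f x| < e / 2.
  move=> xz; apply: hd; last by rewrite addrC addrA addNr add0r.
  by rewrite -[x](subrK z) addrC; apply: (le_trans (ler_normD _ _)); rewrite lerD2l.
have E : avg s i f z' = avg s i (fun x => f (x + w)) z by rewrite shift /w addrC subrK.
have c1 : continuous (fun x => -1 * f x) by apply: continuous_mul => //; exact: continuous_const.
have c2 : continuous (fun x => -1 * f (x + w)) by apply: continuous_mul => //; exact: continuous_const.
have c3 : continuous (fun x => f (x + w) + -1 * f x) by exact: continuous_add.
have c4 : continuous (fun x => f x + -1 * f (x + w)) by exact: continuous_add.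
have k : continuous (fun _ : V => e / 2) by exact: continuous_const.
have h1 : 0 <= avg s i (fun x => e / 2 + (f (x + w) + -1 * f x)) z.
  apply: ge0; first exact: continuous_add.
  by move=> x /near; rewrite ltr_norml; lra.
have h2 : 0 <= avg s i (fun x => e / 2 + (f x + -1 * f (x + w))) z.
  apply: ge0; first exact: continuous_add.
  by move=> x /near; rewrite ltr_norml; lra.
rewrite add // const add // !scale // in h1; rewrite add // const add // !scale // in h2.
by rewrite E ltr_norml; lra.
Qed.

(** The expansion is locally uniform in [z], so that it can be averaged over translations. *)
Definition partial i f f' := forall r e, 0 < e -> exists2 d, 0 < d &
  forall z (t : R), `|z| <= r -> `|t| < d ->
    `|f (z + t *: evec i) - f z - t * f' z| <= e * `|t|.

Lemma continuous_shift f d : continuous f -> continuous (fun x : V => f (x + d)).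
Proof.
move=> cf; apply: (@continuous_lipschitz R V V (fun x : V => x + d) f 1) cf.
by move=> x y; rewrite opprD addrACA subrr addr0 mul1r.
Qed.

Lemma av_partial a S i f f' : 0 <= a -> averaging a S -> continuous f -> continuous f' ->
  partial i f f' -> partial i (S f) (S f').
Proof.
move=> a0 hS cf cf' pf r e e0; have [d d0 hd] := pf (r + a) e e0.
exists d => // z t zr td; pose w := t *: evec i.
have k (c : R) : continuous (fun _ : V => c) by exact: continuous_const.
have cw := @continuous_shift f w cf.
have E (b c c1 c2 : R) : S (fun x : V => b + (c * f (x + w) + (c1 * f x + c2 * f' x))) z =
    b + (c * S f (z + w) + (c1 * S f z + c2 * S f' z)).
  have m1 u g : continuous g -> continuous (fun x : V => u * g x) by move=> cg; apply: continuous_mul.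
  have c3 : continuous (fun x : V => c1 * f x + c2 * f' x) by apply: continuous_add; exact: m1.
  have c4 := m1 c _ cw.
  rewrite (av_add hS) ?(av_const hS) //; last exact: continuous_add.
  rewrite (av_add hS) // (av_scale hS) // (av_shift hS) (av_add hS); try exact: m1.
  by rewrite !(av_scale hS).
have est x : `|x - z| <= a -> `|f (x + w) - f x - t * f' x| <= e * `|t|.
  move=> xz; apply: hd => //.
  rewrite -[x](subrK z) addrC; apply: (le_trans (ler_normD _ _)); exact: lerD.
have cc (b c c1 c2 : R) : continuous (fun x : V => b + (c * f (x + w) + (c1 * f x + c2 * f' x))).
  by do !(apply: continuous_add => //); apply: continuous_mul.
have h1 : 0 <= S (fun x : V => e * `|t| + (1 * f (x + w) + ((-1) * f x + (- t) * f' x))) z.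
  by apply: (av_ge0 hS) => // x /est; rewrite ler_norml; lra.
have h2 : 0 <= S (fun x : V => e * `|t| + ((-1) * f (x + w) + (1 * f x + t * f' x))) z.
  by apply: (av_ge0 hS) => // x /est; rewrite ler_norml; lra.
by rewrite E in h1; rewrite E in h2; rewrite ler_norml -/w; lra.
Qed.

(** Through a primitive [F] of [f] on the line, the average is a difference of values of [F]. Its
    increment in [t] is estimated by the mean value theorem at the two ends [s] and 0. *)
Lemma avg_partial s i f : 0 < s <= 1 -> continuous f ->
  partial i (avg s i f) (fun z => s^-1 * (f (z + s *: evec i) - f z)).
Proof.
move=> /andP[s0 s1] cf r e e0; have es : 0 < e * s / 2 by rewrite divr_gt0 // mulr_gt0.
have [d d0 hd] := continuous_unif (r + 1) cf es.
exists (Num.min d 1); first by rewrite lt_min d0 ltr01.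
move=> z t zr; rewrite lt_min => /andP[td t1].
pose phi x := f (z + x *: evec i).
have cphi : continuous phi by exact: continuous_segment.
have [F dF] := primitive cphi.
have E u : `|u| < 1 -> avg s i f (z + u *: evec i) = (F (s + u) - F u) / s.
  move=> u1; rewrite -(I01_primitive cphi dF) ?s0 // /avg; congr I01; apply/funext => x.
  by rewrite /phi scalerDl -addrA (addrC (u *: _)).
have E0 := E 0; rewrite scale0r !addr0 normr0 in E0.
rewrite E // E0 //.
have mvt u : 0 <= u <= 1 -> `|F (u + t) - F u - t * phi u| <= e * s / 2 * `|t|.
  move=> /andP[u0 u1]; move: t1; rewrite ltr_norml => /andP[t1 t2].
  have est c : `|c - u| <= `|t| -> `|phi c - phi u| < e * s / 2.
    move=> cu; apply: hd.
      apply: (le_trans (ler_normD _ _)); apply: lerD => //.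
      by apply: (le_trans (evec_norm _ _)); rewrite ger0_norm.
    rewrite opprD addrACA subrr add0r -scalerBl; apply: (le_lt_trans (evec_norm _ _)).
    exact: le_lt_trans td.
  have cont x y : - 2 < x -> y < 2 -> {within `[x, y], continuous F}.
    move=> x2 y2; apply: derivable_within_continuous => c; rewrite in_itv /= => /andP[xc cy].
    by have [] := dF c (lt_le_trans x2 xc) (le_lt_trans cy y2).
  have [c [cu ->]] : exists c, `|c - u| <= `|t| /\ F (u + t) - F u = phi c * t.
    have [t0|t0] := leP 0 t.
      have [] := @MVT_segment R F phi u (u + t).
      - by rewrite lerDl.
      - by move=> x; rewrite in_itv /= => /andP[x1 x2]; apply: dF; lra.
      - by apply: cont; lra.
      move=> c; rewrite in_itv /= => /andP[c1 c2] ->; exists c; split.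
        by rewrite !ger0_norm //; lra.
      by congr (_ * _); ring.
    have [] := @MVT_segment R F phi (u + t) u.
    - lra.
    - by move=> x; rewrite in_itv /= => /andP[x1 x2]; apply: dF; lra.
    - by apply: cont; lra.
    move=> c; rewrite in_itv /= => /andP[c1 c2] h; exists c; split.
      by rewrite (ltr0_norm t0) ler0_norm; lra.
    by rewrite -[LHS]opprK opprB h; ring.
  have -> : phi c * t - t * phi u = t * (phi c - phi u) by ring.
  by rewrite normrM mulrC ler_wpM2r // ltW // est.
have m1 := mvt s; rewrite s1 (ltW s0) in m1.
have m0 := mvt 0; rewrite lexx ler01 add0r in m0.
have {}m1 := m1 isT; have {}m0 := m0 isT.
have -> : (F (s + t) - F t) / s - (F s - F 0) / s - t * (s^-1 * (f (z + s *: evec i) - f z)) =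
   ((F (s + t) - F s - t * phi s) - (F t - F 0 - t * phi 0)) / s.
  by rewrite /phi scale0r addr0; field; rewrite gt_eqF.
rewrite normrM normfV (gtr0_norm s0) ler_pdivrMr //.
by apply: (le_trans (ler_normB _ _)); lra.
Qed.

Definition avgs s L f := foldr (avg s) f L.

Lemma averaging_avgs s L : 0 <= s -> averaging ((size L)%:R * s) (avgs s L).
Proof.
move=> s0; elim: L => [|i L IH] /=; first by rewrite mul0r; exact: averaging_id.
rewrite -natr1 mulrDl mul1r addrC.
exact: (averaging_comp (averaging_avg i s0) IH).
Qed.

Lemma avgs_partial s L i f : 0 < s <= 1 -> continuous f -> i \in L ->
  exists2 f', continuous f' & partial i (avgs s L f) f'.
Proof.
move=> /andP[s0 s1] cf; elim: L => // j L IH; rewrite inE => /predU1P[<-|/IH[f' cf' pf]].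
  have cL := av_continuous (averaging_avgs L (ltW s0)) cf.
  eexists; last by apply: avg_partial => //; rewrite s0.
  apply: continuous_mul; first exact: continuous_const.
  by apply: continuous_sub => //; exact: continuous_shift.
exists (avg s j f').
  exact: (av_continuous (averaging_avg j (ltW s0))).
apply: (av_partial (ltW s0) (averaging_avg j (ltW s0))) => //.
exact: (av_continuous (averaging_avgs L (ltW s0))).
Qed.

(** The displacement is made one coordinate at a time. Each of the [n] moves costs
    [e / (2 * N) * |y|] twice: for the expansion itself, and for freezing the partial derivative at
    [z]. *)
Lemma partials_peano f (f' : 'I_n -> V -> R) z e : 0 < e ->
  (forall i, continuous (f' i)) -> (forall i, partial i f (f' i)) ->
  exists2 d, 0 < d & forall y, `|y| < d ->
    `|f (z + y) - f z - \sum_i f' i z * y ord0 i| <= e * `|y|.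
Proof.
move=> e0 cf' pf; pose N : R := n%:R + 1; have N0 : 0 < N by rewrite ltr_wpDl.
have eN : 0 < e / (2 * N) by rewrite divr_gt0 // mulr_gt0.
have [|d d0 hd] := @fin_delta R 'I_n (fun i (d : R) =>
    (forall (x : V) (t : R), `|x| <= `|z| + 1 -> `|t| < d ->
       `|f (x + t *: evec i) - f x - t * f' i x| <= e / (2 * N) * `|t|) /\
    (forall x : V, `|x - z| < d -> `|f' i x - f' i z| < e / (2 * N))).
  move=> i; have [d1 d10 h1] := pf i (`|z| + 1) _ eN.
  have [d2 d20 h2] := continuous_unif `|z| (cf' i) eN.
  exists (Num.min d1 d2); first by rewrite lt_min d10.
  move=> d'; rewrite le_min => /and3P[d'0 d'1 d'2]; split.
    by move=> x t xz td; apply: h1 => //; exact: lt_le_trans d'1.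
  by move=> x xz; apply: h2 => //; exact: lt_le_trans d'2.
exists (Num.min d 1 / N); first by rewrite divr_gt0 // lt_min d0 ltr01.
move=> y; rewrite ltr_pdivlMr // lt_min => /andP[yd y1].
have yN : `|y| <= `|y| * N by rewrite -[leLHS]mulr1 ler_wpM2l // /N lerDr.
suff H (s : seq 'I_n) : (size s <= n)%N ->
    `|\sum_(i <- s) y ord0 i *: evec i| <= (size s)%:R * `|y| /\
    `|f (z + \sum_(i <- s) y ord0 i *: evec i) - f z - \sum_(i <- s) f' i z * y ord0 i|
      <= (size s)%:R * (e / N * `|y|).
  have szn : size (index_enum 'I_n) = n by rewrite [index_enum _]unlock -enumT size_enum_ord.
  have [|_] := H (index_enum 'I_n); first by rewrite szn.
  rewrite -row_sum_delta szn => h; apply: (le_trans h).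
  rewrite mulrA ler_wpM2r // mulrCA ger_pMr // ler_pdivrMr // mul1r /N lerDl //.
elim: s => [_|i s IH /= si].
  by rewrite !big_nil normr0 !mul0r addr0 subrr subr0 normr0.
have [IH1 IH2] := IH (ltnW si); rewrite !big_cons.
set w := \sum_(j <- s) _ in IH1 IH2 *; set sm := \sum_(j <- s) _ in IH2 *.
have sn : (size s)%:R + 1 <= N :> R by rewrite /N lerD2r ler_nat ltnW.
have wN : `|w| <= `|y| * N.
  apply: (le_trans IH1); rewrite mulrC ler_wpM2l //; lra.
have yi := coord_le_norm y i.
split.
  apply: (le_trans (ler_normD _ _)); rewrite -natr1 mulrDl mul1r addrC lerD //.
  exact: le_trans (evec_norm _ _) yi.
have [h1 h2] := hd i.
have zw : `|z + w| <= `|z| + 1 by apply: (le_trans (ler_normD _ _)); rewrite lerD2l; lra.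
have := h1 (z + w) (y ord0 i) zw; have := h2 (z + w).
rewrite addrAC subrr add0r => /(_ (le_lt_trans wN yd)) /ltW k2.
move=> /(_ (le_lt_trans yi (le_lt_trans yN yd))) k1.
have E : f (z + (y ord0 i *: evec i + w)) - f z - (f' i z * y ord0 i + sm) =
    (f (z + w + y ord0 i *: evec i) - f (z + w) - y ord0 i * f' i (z + w))
    + (f (z + w) - f z - sm) + y ord0 i * (f' i (z + w) - f' i z).
  rewrite (addrC (y ord0 i *: _)) addrA; ring.
rewrite E; apply: (le_trans (ler_normD _ _)).
rewrite -natr1 mulrDl mul1r.
have k3 : `|y ord0 i * (f' i (z + w) - f' i z)| <= e / (2 * N) * `|y|.
  by rewrite normrM mulrC ler_pM.
have k4 : e / (2 * N) * `|y ord0 i| <= e / (2 * N) * `|y| by rewrite ler_wpM2l // ltW.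
have k5 : e / N * `|y| = e / (2 * N) * `|y| + e / (2 * N) * `|y|.
  by field; rewrite gt_eqF.
have k6 := ler_normD (f (z + w + y ord0 i *: evec i) - f (z + w) - y ord0 i * f' i (z + w)) (f (z + w) - f z - sm).
lra.
Qed.

End Averaging.

(** * Second-order expansions of averaged functions *)

Section Taylor.
Context {R : realType} {n : nat}.
Notation V := 'rV[R]_n.

Lemma is_derive_segment (f : V -> R) (f' : 'I_n -> V -> R) (z y : V) (t : R) :
  (forall i, continuous (f' i)) -> (forall i, partial i f (f' i)) ->
  is_derive t 1 (fun t : R => f (z + t *: y)) (\sum_i f' i (z + t *: y) * y ord0 i).
Proof.
move=> cf' pf; apply: is_derive_eps => e e0.
have y1 : 0 < `|y| + 1 by rewrite ltr_wpDl.
have [d d0 hd] := partials_peano (z + t *: y) (divr_gt0 e0 y1) cf' pf.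
exists (d / (`|y| + 1)); first exact: divr_gt0.
move=> h; rewrite ltr_pdivlMr // => hlt.
have hy : `|h *: y| <= `|h| * (`|y| + 1) by rewrite normrZ ler_wpM2l // lerDl.
have := hd _ (le_lt_trans hy hlt).
rewrite scalerDl addrA (_ : \sum_i _ = h * \sum_i f' i (z + t *: y) * y ord0 i); last first.
  by rewrite mulr_sumr; apply: eq_bigr => i _; rewrite mxE mulrCA.
move=> /le_trans; apply.
rewrite -mulrA ler_pM2l // mulrC ler_pdivrMr //.
Qed.

(** Mean value theorem along the segment for [f] minus the candidate quadratic polynomial: the
    derivative of this difference is the first-order remainder of the gradient. *)
Lemma partials_peano2 (f : V -> R) (f' : 'I_n -> V -> R) (f'' : 'I_n -> 'I_n -> V -> R) z (e : R) :
  0 < e -> (forall i, continuous (f' i)) -> (forall i j, continuous (f'' i j)) ->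
  (forall i, partial i f (f' i)) -> (forall i j, partial j (f' i) (f'' i j)) ->
  exists2 d, 0 < d & forall y, `|y| < d ->
    `|f (z + y) - f z - dot (\row_i f' i z) y - 2^-1 * qf (\matrix_(i, j) f'' i j z) y| <= e * sq y.
Proof.
move=> e0 cf' cf'' pf pf'; set p := \row_i _; set X := \matrix_(i, j) _.
have n1 : 0 < n%:R + 1 :> R by rewrite ltr_wpDl.
have en : 0 < e / (n%:R + 1) by exact: divr_gt0.
have [|d d0 hd] := @fin_delta R 'I_n (fun i (d : R) => forall y, `|y| < d ->
    `|f' i (z + y) - f' i z - \sum_j f'' i j z * y ord0 j| <= e / (n%:R + 1) * `|y|).
  move=> i; have [d d0 hd] := partials_peano z en (cf'' i) (pf' i).
  by exists d => // d' /andP[d'0 d'd] y yd; apply: hd; exact: lt_le_trans d'd.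
exists d => // y yd.
pose phi (t : R) := f (z + t *: y) - (t * dot p y + t ^+ 2 * (2^-1 * qf X y)).
pose dphi (t : R) := \sum_i f' i (z + t *: y) * y ord0 i - (dot p y + 2 * t * (2^-1 * qf X y)).
have dP (t : R) : is_derive t 1 phi (dphi t).
  have d1 := is_derive_segment z y t cf' pf.
  have d2 : is_derive t 1 (fun t : R => t * dot p y + t ^+ 2 * (2^-1 * qf X y))
      (dot p y + 2 * t * (2^-1 * qf X y)).
    set A := dot p y; set B := _ * qf X y.
    by apply: is_derive_eq; rewrite /GRing.scale /=; ring.
  exact: (is_deriveB d1 d2).
have cphi : {within `[0, 1], continuous phi}.
  by apply: derivable_within_continuous => x _; have [] := dP x.
have [c] := @MVT_segment R phi dphi 0 1 ler01 (fun x _ => dP x) cphi.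
rewrite in_itv /= => /andP[c0 c1].
rewrite /phi scale1r scale0r addr0 subr0 mulr1 !mul0r mul1r !expr1n expr0n /= mul0r addr0 subr0 mul1r => E.
rewrite (_ : f (z + y) - f z - dot p y - _ = dphi c); last by rewrite -E; ring.
have -> : dphi c = \sum_i y ord0 i * (f' i (z + c *: y) - f' i z - \sum_j f'' i j z * (c *: y) ord0 j).
  rewrite /dphi dot_sum qf_sum opprD addrA -sumrB (_ : 2 * c * _ = \sum_i y ord0 i * \sum_j f'' i j z * (c *: y) ord0 j).
    by rewrite -sumrB; apply: eq_bigr => i _; rewrite mxE; ring.
  have -> (u : R) : 2 * c * (2^-1 * u) = c * u by field.
  rewrite mulr_sumr; apply: eq_bigr => i _; rewrite !mulr_sumr; apply: eq_bigr => j _.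
  by rewrite !mxE; ring.
apply: (le_trans (ler_norm_sum _ _ _)).
have cy : `|c *: y| <= `|y| by rewrite normrZ ger0_norm // -[leRHS]mul1r ler_wpM2r.
apply: (@le_trans _ _ (\sum_(i < n) e / (n%:R + 1) * `|y| ^+ 2)).
  apply: ler_sum => i _; rewrite normrM expr2 mulrCA.
  apply: ler_pM => //; first exact: coord_le_norm.
  apply: (le_trans (hd i _ (le_lt_trans cy yd))); rewrite ler_pM2l //.
rewrite sumr_const card_ord -[X in X <= _]mulr_natl.
apply: (@le_trans _ _ (e * `|y| ^+ 2)); last by rewrite ler_pM2l // norm_sq_le.
have -> : n%:R * (e / (n%:R + 1) * `|y| ^+ 2) = n%:R / (n%:R + 1) * (e * `|y| ^+ 2) by ring.
rewrite ler_piMl ?mulr_ge0 ?sqr_ge0 ?(ltW e0) // ler_pdivrMr // mul1r lerDl //.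
Qed.

(** One sweep of averages over all coordinates creates continuous first partial derivatives, a
    second sweep second ones, because averaging commutes with [partial]. The step [s] keeps the
    total displacement of both sweeps below [a]. *)
Lemma smoothing (a : R) : 0 < a -> exists2 S, averaging a S &
  forall f : V -> R, continuous f -> exists p X, forall z e, 0 < e ->
    exists2 d, 0 < d & forall y, `|y| < d ->
      `|S f (z + y) - S f z - dot (p z) y - 2^-1 * qf (X z) y| <= e * sq y.
Proof.
move=> a0; have n1 : 0 < n%:R *+ 2 + 1 :> R by rewrite ltr_wpDl // mulrn_wge0.
pose s := Num.min 1 (a / (n%:R *+ 2 + 1)).
have s0 : 0 < s by rewrite lt_min ltr01 divr_gt0.
have s1 : s <= 1 by rewrite ge_min lexx.
have sa : n%:R * s + n%:R * s <= a.
  have : s <= a / (n%:R *+ 2 + 1) by rewrite ge_min lexx orbT.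
  by rewrite ler_pdivlMr // mulrDr mulr1 mulrnAr mulr2n (mulrC s); lra.
have hE := averaging_avgs (enum 'I_n) (ltW s0); rewrite size_enum_ord in hE.
have n0 : 0 <= n%:R * s :> R by rewrite mulr_ge0 // ltW.
exists (fun f => avgs s (enum 'I_n) (avgs s (enum 'I_n) f)).
  exact: averaging_le sa (averaging_comp hE hE).
have smooth1 g : continuous g -> forall i, exists g' : V -> R, continuous g' /\ partial i (avgs s (enum 'I_n) g) g'.
  move=> cg i; have [|g' cg' pg'] := @avgs_partial _ _ s (enum 'I_n) i g _ cg (mem_enum _ _).
    by rewrite s0.
  by exists g'.
move=> f cf; have [h' hh'] := choice (smooth1 f cf).
pose f' i := avgs s (enum 'I_n) (h' i).
have cf' i : continuous (f' i) by apply: (av_continuous hE); case: (hh' i).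
have pf i : partial i (avgs s (enum 'I_n) (avgs s (enum 'I_n) f)) (f' i).
  have [ch ph] := hh' i; apply: (av_partial n0 hE) => //; exact: (av_continuous hE).
have [f'' hf''] : exists f'' : 'I_n -> 'I_n -> V -> R,
    forall i j, continuous (f'' i j) /\ partial j (f' i) (f'' i j).
  have /choice[f'' hf''] i : exists g : 'I_n -> V -> R,
      forall j, continuous (g j) /\ partial j (f' i) (g j).
    by have [g hg] := choice (smooth1 (h' i) (hh' i).1); exists g => j; exact: (hg j).
  by exists f''.
exists (fun z => \row_i f' i z), (fun z => \matrix_(i, j) f'' i j z) => z e e0.
by apply: partials_peano2 => // i j; case: (hf'' i j).
Qed.

End Taylor.

(** * Comparison in logarithmic coordinates *)

Section Generator.
Context {R : realType} {n : nat}.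
Notation V := 'rV[R]_n.
Implicit Types (z p r : V) (X : 'M[R]_n).

Definition drift r : V := \row_i (- 2^-1 * r ord0 i ^+ 2).
Definition gen p X r : R := 2^-1 * qf X r + dot p (drift r).
Definition kap z : R := 1 + \sum_i expR (z ord0 i).

Lemma genE p X r : gen p X r = 2^-1 * qf X r + dot p (drift r).
Proof. by []. Qed.

Lemma genBZ p X q Y c r : gen (p - c *: q) (X - c *: Y) r = gen p X r - c * gen q Y r.
Proof. by rewrite /gen qfDl qfNl qfZl dotDl dotNl dotZl; ring. Qed.

Lemma drift_norm r M : `|r| <= M -> `|drift r| <= 2^-1 * M ^+ 2.
Proof.
move=> rM; have M0 : 0 <= M by exact: le_trans rM.
apply: norm_leP => [|i]; first by rewrite mulr_ge0 ?sqr_ge0.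
rewrite mxE mulNr normrN normrM (ger0_norm (_ : 0 <= 2^-1)) ?invr_ge0 //.
rewrite ler_pM2l ?invr_gt0 // normrX ler_pXn2r ?nnegrE //.
exact: le_trans (coord_le_norm _ _) rM.
Qed.

Lemma kapE z : kap z = 1 + \sum_i expR (z ord0 i).
Proof. by []. Qed.

Lemma kap_ge1 z : 1 <= kap z.
Proof. by rewrite /kap lerDl sumr_ge0 // => i _; exact: expR_ge0. Qed.

(** Both bounds come from [1 + x <= expR x]: directly at [x = t], and at [x = - t] in the form
    [expR t * (1 - t) <= 1]. *)
Lemma expR_taylor1 (t : R) : `|t| <= 2^-1 -> `|expR t - 1 - t| <= 2 * t ^+ 2.
Proof.
rewrite ler_norml => /andP[t1 t2].
have h1 := expR_ge1Dx t; have h2 := expR_ge1Dx (- t).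
rewrite ger0_norm; last lra.
have e0 := expR_gt0 t.
have : expR t * (1 - t) <= 1.
  by rewrite -[leRHS](expRxMexpNx_1 t) ler_pM2l.
have := sqr_ge0 t; nra.
Qed.

Lemma kap_step i z (t : R) :
  kap (z + t *: evec i) - kap z = expR ((z + t *: evec i) ord0 i) - expR (z ord0 i).
Proof.
rewrite /kap opprD addrACA subrr add0r (bigD1 i) //= [X in _ - X](bigD1 i) //=.
rewrite [in LHS](eq_bigr (fun j => expR (z ord0 j))) => [|j ji]; first ring.
by rewrite !mxE (negbTE ji) andbF mulr0 addr0.
Qed.

Lemma kap_partial i : partial i kap (fun z : V => expR (z ord0 i)).
Proof.
move=> r e e0; have er := expR_gt0 r.
exists (Num.min 2^-1 (e / (2 * expR r))).
  by rewrite lt_min invr_gt0 ltr0n divr_gt0 // mulr_gt0.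
move=> z t zr; rewrite lt_min => /andP[t1 t2].
have -> : kap (z + t *: evec i) - kap z = expR (z ord0 i) * (expR t - 1).
  by rewrite kap_step !mxE !eqxx mulr1 expRD; ring.
have -> (x : R) : x * (expR t - 1) - t * x = x * (expR t - 1 - t) by ring.
rewrite normrM (gtr0_norm (expR_gt0 _)).
have h := expR_taylor1 (ltW t1).
apply: (@le_trans _ _ (expR r * (2 * t ^+ 2))).
  apply: ler_pM => //.
  rewrite ler_expR; apply: le_trans (ler_norm _) (le_trans (coord_le_norm _ _) zr).
move: t2; rewrite ltr_pdivlMr ?mulr_gt0 // => t2.
have -> : t ^+ 2 = `|t| ^+ 2 by rewrite real_normK ?num_real.
have := normr_ge0 t; nra.
Qed.

Lemma kap_continuous : continuous kap.
Proof.
apply: continuous_add; first exact: continuous_const.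
apply: continuous_sum => i _ z.
apply: (continuous_comp (@continuous_coord R n i z)); exact: continuous_expR.
Qed.

Lemma kap_peano z e : 0 < e -> exists2 d, 0 < d & forall y, `|y| < d ->
  `|kap (z + y) - kap z - dot (map_mx expR z) y - 2^-1 * qf (diag_mx (map_mx expR z)) y| <= e * sq y.
Proof.
move=> e0.
have cexp i : continuous (fun z : V => expR (z ord0 i)).
  move=> x; apply: (continuous_comp (@continuous_coord R n i x)); exact: continuous_expR.
have [||d d0 hd] := @partials_peano2 R n kap (fun i z => expR (z ord0 i))
    (fun i j z => if i == j then expR (z ord0 i) else 0) z e e0 cexp _ (@kap_partial).
- move=> i j; case: eqP => _; [exact: cexp|exact: continuous_const].
- move=> i j; case: eqP => [<-|/eqP ij] r x x0; last first.
    exists 1 => // y t _ _; rewrite !mxE (negbTE ij) andbF /= mulr0n !mulr0 addr0 subrr subrr normr0.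
    by rewrite mulr_ge0 // ltW.
  have [d d0 hd] := kap_partial i r x0; exists d => // y t yr td.
  by have := hd y t yr td; rewrite kap_step.
exists d => // y yd; have := hd y yd.
have -> : (\row_i expR (z ord0 i)) = map_mx expR z by apply/rowP => i; rewrite !mxE.
suff -> : (\matrix_(i, j) if i == j then expR (z ord0 i) else 0) = diag_mx (map_mx expR z) by [].
by apply/matrixP => i j; rewrite !mxE; case: eqP => [->|].
Qed.

(* [kap] is the total mass of the unnormalized weights, which is a martingale. *)
Lemma gen_kap z r : gen (map_mx expR z) (diag_mx (map_mx expR z)) r = 0.
Proof.
rewrite /gen qf_diag dot_sum mulr_sumr -big_split /= big1 // => i _.
by rewrite !mxE; ring.
Qed.

End Generator.

#[global] Opaque kap gen drift.

Lemma continuous_bounded {R : realType} {n} (f : 'rV[R]_n -> R) (r : R) :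
  continuous f -> exists2 M, 0 <= M & forall z, `|z| <= r -> `|f z| <= M.
Proof.
move=> cf; have [r0|r0] := leP 0 r; last first.
  exists 0 => // z zr; have := le_lt_trans zr r0; by rewrite ltNge normr_ge0.
have ne : [set y : 'rV[R]_n | `|y| <= r] !=set0 by exists 0; rewrite /= normr0.
have cf' : continuous (fun z => `|f z|).
  by move=> z; apply: (continuous_comp (cf z)); exact: norm_continuous.
have [y] := EVT_max_rV ne (@ball_compact R n r) (continuous_subspaceT cf').
rewrite inE /= => yr h; exists `|f y| => // z zr; apply: h; by rewrite inE.
Qed.

(** The cost [a] has no upper bound, so [K'] can be replaced by [K] only up to the relative error
    [1 + del]. Adding [B] makes the cost nonnegative before the factors are compared. *)
Lemma cost_shift {R : realType} (K K' KM a a' B e del : R) :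
  1 <= K <= KM -> `|K' - K| < del -> 0 < del <= 1 -> 0 <= B -> 0 < e ->
  - B <= a' -> `|a' - a| <= e ->
  K' * a' <= (1 + del) * (K * a) + (KM + 1) * (2 * e + del * B).
Proof.
move=> /andP[K1 KM1]; rewrite ltr_norml => /andP[d1 d2] /andP[d0 d3] B0 e0 aB.
rewrite ler_norml => /andP[a1 a2].
have h1 : K' * (a' + B) <= (1 + del) * K * (a' + B).
  by rewrite ler_wpM2r //; [lra|nra].
have h2 : (1 + del) * K * (a' + B) <= (1 + del) * K * (a + e + B).
  by rewrite ler_wpM2l //; [apply: mulr_ge0; lra|lra].
have h3 : (K - del) * B <= K' * B by rewrite ler_wpM2r //; lra.
have h4 : (1 + del) * (K * e) <= 2 * (KM * e).
  by apply: ler_pM => //; [lra|apply: mulr_ge0; lra|lra|rewrite ler_pM2r].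
have h5 : del * (K * B) <= del * (KM * B) by rewrite ler_pM2l // ler_wpM2r.
have := mulr_ge0 (ltW d0) B0; lra.
Qed.

(** * Comparison for an abstract cost and constant-coefficient operators *)

Section Comparison.
Context {R : realType} {n : nat} {H : Type}.
Notation V := 'rV[R]_n.
(* [C z rho a]: the cost of the control [rho] at [z] is finite and equals [a]. *)
Variables (inc : H -> V) (C : V -> H -> R -> Prop) (beta M : R) (G W : V -> R).
Hypotheses (beta0 : 0 < beta) (incM : forall rho, `|inc rho| <= M) (M0 : 0 <= M).
Hypotheses (cG : continuous G) (cW : continuous W).
Hypothesis C_cont : forall z e, 0 < e -> exists2 d, 0 < d & forall z', `|z' - z| < d ->
  forall rho, (forall a, C z rho a -> exists2 a', C z' rho a' & `|a' - a| <= e) /\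
    (forall a, C z' rho a -> exists2 a', C z rho a' & `|a' - a| <= e).
Hypothesis subG : forall z p X, upper_jet G z p X -> forall rho a, C z rho a ->
  beta * G z <= kap z * a + gen p X (inc rho).
Hypothesis superW : forall z p X, lower_jet W z p X -> forall e, 0 < e ->
  exists rho a, C z rho a /\ kap z * a + gen p X (inc rho) <= beta * W z + e.
Implicit Types (z y p : V) (X : 'M[R]_n).

Lemma C_unif r e : 0 < e -> exists2 d, 0 < d & forall z z', `|z| <= r -> `|z' - z| < d ->
  forall rho a, C z rho a -> exists2 a', C z' rho a' & `|a' - a| <= e.
Proof.
move=> e0; have [|d d0 hd] := @compact_unif R V _ (fun d z => forall z', `|z' - z| < d ->
  forall rho a, C z rho a -> exists2 a', C z' rho a' & `|a' - a| <= e) (@ball_compact R n r).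
  move=> z _; have e2 : 0 < e / 2 by lra.
  have [d d0 hd] := C_cont z e2; exists (d / 2); first lra.
  move=> x z' /andP[x0 xd] z'd z'' z''d rho a Ca.
  have [|_ /(_ a Ca)[a1 Ca1 h1]] := hd z' _ rho; first lra.
  have [|/(_ a1 Ca1)[a2 Ca2 h2] _] := hd z'' _ rho.
    by apply: (le_lt_trans (ler_distD z' _ _)); lra.
  exists a2 => //; apply: (le_trans (ler_distD a1 _ _)); lra.
by exists d => // z z' zr; exact: hd.
Qed.

Lemma dist_norm_le z y (d : R) : `|y - z| < d -> `|y| < `|z| + d.
Proof.
by move=> h; rewrite -[y](subrK z) addrC; apply: (le_lt_trans (ler_normD _ _)); rewrite ltrD2l.
Qed.

(** This [k] turns the penalty bound [k * sq (z - m z) <= 2 * MG] into a squared distance below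
    [eta ^+ 2 / 4]; the [+ 1] makes it strict. *)
Lemma argmax_close r k MG eta g m z : is_sup_conv G r k g m ->
  (forall y, `|y| <= r -> `|G y| <= MG) -> `|z| <= r -> 0 < eta -> 0 <= MG ->
  k = (8 * MG + 1) / eta ^+ 2 -> `|m z - z| < eta / 2.
Proof.
move=> sc hM zr eta0 MG0 kE.
have e2 : 0 < eta ^+ 2 by rewrite exprn_gt0.
have := sc_argmax_dist sc hM zr; rewrite kE mulrAC ler_pdivrMr // => h.
have h1 := norm_sq_le (z - m z).
have h2 : `|z - m z| ^+ 2 < (eta / 2) ^+ 2.
  have := sq_ge0 (z - m z); set s := sq _ in h h1 * => s0.
  have : (8 * MG + 1) * s <= 2 * MG * eta ^+ 2 by [].
  rewrite exprMn; nra.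
rewrite distrC; rewrite ltr_pXn2r ?nnegrE // in h2; lra.
Qed.

(** A paraboloid touches [G] from above at a point [m z] close to [z]. There the subsolution
    inequality bounds the cost from below, since its other terms are bounded uniformly in [rho];
    continuity of the cost carries the bound back to [z]. *)
Lemma cost_lower_bound r : exists2 B, 0 <= B &
  forall z rho a, `|z| <= r -> C z rho a -> - B <= a.
Proof.
have [r0|r0] := leP 0 r; last first.
  by exists 0 => // z rho a zr; have := le_lt_trans zr r0; rewrite ltNge normr_ge0.
have [MG MG0 hMG] := continuous_bounded (r + 2) cG.
have [d d0 hd] := C_unif (r + 2) ltr01.
pose eta := Num.min d 1.
have eta0 : 0 < eta by rewrite lt_min d0 ltr01.
have eta1 : eta <= 1 by rewrite ge_min lexx orbT.
have etad : eta <= d by rewrite ge_min lexx.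
have [k kE] : exists k, k = (8 * MG + 1) / eta ^+ 2 by eexists.
have k0 : 0 < k by rewrite kE divr_gt0 ?exprn_gt0 // ltr_wpDl // mulr_ge0.
have r2 : 0 <= r + 2 by lra.
have [g [m sc]] := sup_conv_exists k cG r2.
(* The two parts of [gen] for the paraboloid: its Hessian is [2 * k] times the identity, its
   gradient [2 * k] times a vector of norm at most 1. *)
pose B1 := k * (n%:R * M ^+ 2) + 2 * k * (n%:R * (1 * (2^-1 * M ^+ 2))).
have B10 : 0 <= B1.
  by rewrite addr_ge0 // !mulr_ge0 ?(ltW k0) ?sqr_ge0.
exists (beta * MG + B1 + 1); first by rewrite addr_ge0 // addr_ge0 // mulr_ge0 // ltW.
move=> z rho a zr Ca.
have zr2 : `|z| <= r + 2 by lra.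
have close := argmax_close sc hMG zr2 eta0 MG0 kE.
have [|a' Ca' aa'] := hd z (m z) zr2 _ rho a Ca; first lra.
pose e := m z - z.
have jet : upper_jet G (m z) ((2 * k) *: e) ((2 * k)%:M).
  move=> eps eps0; exists 1 => // x x1.
  have mr := dist_norm_le close.
  have xr : `|m z + x| <= r + 2 by apply: (le_trans (ler_normD _ _)); lra.
  have h1 := sup_conv_ge sc z xr; rewrite (sup_convE sc) in h1.
  have E : sq (z - (m z + x)) = sq (z - m z) + 2 * dot e x + sq x.
    have -> : z - (m z + x) = - (e + x) by rewrite /e !opprD opprK; apply/rowP => i; rewrite !mxE; ring.
    have -> : z - m z = - e by rewrite /e opprB.
    by move: (e) => e'; rewrite !sqE !dotE (dotC x e'); ring.
  rewrite -scalemx1 qfZl qf1 dotZl; rewrite E in h1.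
  by have : 0 <= eps * sq x by [rewrite mulr_ge0 ?sq_ge0 // ltW]; lra.
have := subG jet Ca'; rewrite genE -scalemx1 qfZl qf1 dotZl => h.
have h1 := sq_le (incM rho).
have h2 : `|dot e (drift (inc rho))| <= n%:R * (1 * (2^-1 * M ^+ 2)).
  by apply: dot_le; [rewrite /e; lra|exact: drift_norm].
have {}h2 : 2 * k * dot e (drift (inc rho)) <= 2 * k * (n%:R * (1 * (2^-1 * M ^+ 2))).
  by rewrite ler_pM2l ?mulr_gt0 //; exact: le_trans (ler_norm _) h2.
have {}h1 : 2^-1 * (2 * k * sq (inc rho)) <= k * (n%:R * M ^+ 2).
  by rewrite !mulrA mulVf ?mul1r -?mulrA ?ler_pM2l ?pnatr_eq0.
have h3 : - (beta * MG) <= beta * G (m z).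
  rewrite -mulrN ler_pM2l //; have := hMG _ (argmax_le sc z).
  by rewrite ler_norml => /andP[].
have K1 := kap_ge1 (m z); move: aa'; rewrite ler_norml => /andP[aa1 aa2].
have h4 : - (beta * MG + B1) <= kap (m z) * a' by rewrite /B1; lra.
have [a'0|a'0] := leP 0 a'; first by have : 0 <= beta * MG by [rewrite mulr_ge0 // ltW]; lra.
have : kap (m z) * a' <= a' by nra.
lra.
Qed.

(** Contrapositive use of [sup_conv_second_diff]: were the second difference too negative, the jet
    found there would violate the subsolution inequality. The terms in [h] and [h / tau] pay for
    evaluating [beta * g] and the slope along [v] at [x] rather than on the segment, the term in
    [tau] for the penalty. *)
Lemma finite_diff_ineq r k g m x rho (h tau s L A : R) :
  let rh := inc rho in let v := drift rh in
  0 <= r -> 0 < k -> is_sup_conv G r k g m -> 0 < h -> 0 < tau ->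
  L = k * (n%:R * (2 * s + 2 * r)) -> 0 <= L ->
  `|x| + h * M + `|tau *: v| <= s ->
  (forall t, `|t| <= h -> `|m (x + t *: rh)| < r /\
     exists2 a, C (m (x + t *: rh)) rho a & kap (m (x + t *: rh)) * a <= A) ->
  0 <= g (x + h *: rh) + g (x - h *: rh) - 2 * g x + 2 * h ^+ 2 *
    (A + beta * L * M * h + 2 * L * M * h / tau + k * sq v * tau - beta * g x
      + (g (x + tau *: v) - g x) / tau).
Proof.
move=> rh v r0 k0 sc h0 tau0 LE L0 xs hm.
have lip y y' : `|y| <= s -> `|y'| <= s -> `|g y - g y'| <= L * `|y - y'|.
  by move=> ys y's; rewrite LE; exact: (sup_conv_lipschitz k0 sc).
have hM0 : 0 <= h * M by rewrite mulr_ge0 // ltW.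
have trh t : `|t| <= h -> `|t *: rh| <= h * M.
  by move=> th; rewrite normrZ; apply: ler_pM => //; exact: incM.
have tv0 : 0 <= `|tau *: v| by exact: normr_ge0.
have xx : `|x| <= s by lra.
have xt t : `|t| <= h -> `|x + t *: rh| <= s.
  by move=> /trh th; apply: (le_trans (ler_normD _ _)); lra.
have xtv t : `|t| <= h -> `|x + t *: rh + tau *: v| <= s.
  move=> /trh th; apply: (le_trans (ler_normD _ _)).
  by have := ler_normD x (t *: rh); lra.
pose th := (g (x + tau *: v) - g x) / tau + 2 * L * M * h / tau + k * sq v * tau.
have thE : th * tau = g (x + tau *: v) - g x + 2 * L * M * h + k * sq v * tau ^+ 2.
  by rewrite /th; field; rewrite gt_eqF.
pose B := A + beta * L * M * h - beta * g x.
have -> : A + beta * L * M * h + 2 * L * M * h / tau + k * sq v * tau - beta * g x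
      + (g (x + tau *: v) - g x) / tau = B + th by rewrite /B /th; ring.
rewrite leNgt; apply/negP => neg.
have h2 : 0 < 2 * h ^+ 2 by rewrite mulr_gt0 // exprn_gt0.
pose D := g (x + h *: rh) + g (x - h *: rh) - 2 * g x.
(* A value strictly between [B + th] and [- D / (2 * h ^+ 2)]: the lower bound will contradict the
   subsolution inequality, the upper one is the required gap in the second difference. *)
pose Th := (B + th - D / (2 * h ^+ 2)) / 2.
have ThE : 2 * h ^+ 2 * Th = (2 * h ^+ 2 * (B + th) - D) / 2.
  by rewrite /Th; field; rewrite gt_eqF.
have Thlt : B + th < Th.
  by rewrite -(ltr_pM2l h2) ThE; move: neg; rewrite -/D; lra.
have [|||t [p [X [th1 jet est]]]] := @sup_conv_second_diff _ _ G r k g m r0 k0 sc x rh v h tau Th th h0 tau0 _ _ _.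
- move=> t tht; rewrite thE.
  have xh : `|x + t *: rh + tau *: v - (x + tau *: v)| <= h * M.
    rewrite (_ : _ - _ = t *: rh) ?trh //; by apply/rowP => i; rewrite !mxE; ring.
  have xh' : `|x - (x + t *: rh)| <= h * M.
    by rewrite opprD addrA subrr add0r normrN trh.
  have x0v : `|x + tau *: v| <= s by apply: (le_trans (ler_normD _ _)); lra.
  have := le_trans (lip _ _ (xtv t tht) x0v) (ler_wpM2l L0 xh).
  have := le_trans (lip _ _ xx (xt t tht)) (ler_wpM2l L0 xh').
  by rewrite !ler_norml => /andP[_ ?] /andP[_ ?]; lra.
- by move=> t /hm[].
- by rewrite -/D ThE; move: neg; rewrite -/D; lra.
have [_ [a Ca aA]] := hm t th1.
have := subG jet Ca; rewrite genE -/rh -/v => sub.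
have gm : g (x + t *: rh) <= G (m (x + t *: rh)).
  by rewrite (sup_convE sc) lerBlDr lerDl mulr_ge0 ?sq_ge0 // ltW.
have gx : g x - g (x + t *: rh) <= L * (h * M).
  apply: le_trans (ler_norm _) (le_trans (lip _ _ xx (xt t th1)) _).
  by rewrite ler_wpM2l // opprD addrA subrr add0r normrN trh.
have : beta * (g x - L * (h * M)) <= beta * G (m (x + t *: rh)) by rewrite ler_pM2l //; lra.
by rewrite /B in Thlt; lra.
Qed.

(** The order of the limits matters: [tau] is fixed before [h], because of the error
    [L2 * h / tau]. *)
Lemma finite_diff_limit (U : V -> R) z p X (rh v : V) (A L1 L2 K d : R) : 0 < d ->
  (forall e', 0 < e' -> exists2 d, 0 < d & forall y, `|y| < d ->
    `|U (z + y) - U z - dot p y - 2^-1 * qf X y| <= e' * sq y) ->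
  (forall h tau : R, 0 < h < d -> 0 < tau < d -> 0 <= U (z + h *: rh) + U (z - h *: rh) - 2 * U z
     + 2 * h ^+ 2 * (A + L1 * h + L2 * h / tau + K * tau - beta * U z
       + (U (z + tau *: v) - U z) / tau)) ->
  beta * U z <= A + (2^-1 * qf X rh + dot p v).
Proof.
move=> d0 peano fd; apply/ler_addgt0Pr => gam gam0.
have small (b c : R) : 0 < b -> exists2 t, 0 < t & forall t', 0 < t' < t -> c * t' <= b.
  move=> b0; have c1 : 0 < `|c| + 1 by rewrite ltr_wpDl.
  exists (b / (`|c| + 1)); first exact: divr_gt0.
  move=> t' /andP[t'0]; rewrite ltr_pdivlMr // => h.
  have := ler_norm c => hc; have : c * t' <= `|c| * t' by rewrite ler_wpM2r // ltW.
  lra.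
have g4 : 0 < gam / 4 by lra.
have [e1 e10 he1] := small _ (sq rh) g4.
have [e2 [e20 e2e]] : exists e2, 0 < e2 /\ e2 < e1 by exists (e1 / 2); lra.
have er : sq rh * e2 <= gam / 4 by apply: he1; rewrite e20.
have [dP dP0 hP] := peano e2 e20.
have [t1 t10 ht1] := small _ (K + 2^-1 * qf X v + e2 * sq v) g4.
have [t2 t20 ht2] := small dP (`|v| + 1) dP0.
have [tau [tau0 taud taut1 taut2]] : exists tau, [/\ 0 < tau, tau < d, tau < t1 & tau < t2].
  exists (Num.min d (Num.min t1 t2) / 2).
  have t0 : 0 < Num.min d (Num.min t1 t2) by rewrite !lt_min d0 t10.
  have tt : Num.min d (Num.min t1 t2) / 2 < Num.min d (Num.min t1 t2) by lra.
  by split; first (by lra); apply: (lt_le_trans tt); rewrite !ge_min lexx ?orbT.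
have [h1 h10 hh1] := small _ (L1 + L2 / tau) g4.
have [h2 h20 hh2] := small dP (`|rh| + 1) dP0.
have [h [h0 hd hh1' hh2']] : exists h, [/\ 0 < h, h < d, h < h1 & h < h2].
  exists (Num.min d (Num.min h1 h2) / 2).
  have t0 : 0 < Num.min d (Num.min h1 h2) by rewrite !lt_min d0 h10.
  have tt : Num.min d (Num.min h1 h2) / 2 < Num.min d (Num.min h1 h2) by lra.
  by split; first (by lra); apply: (lt_le_trans tt); rewrite !ge_min lexx ?orbT.
have {}hh1 : (L1 + L2 / tau) * h <= gam / 4 by apply: hh1; rewrite h0.
have hrh : `|h *: rh| < dP.
  have := hh2 h; rewrite h0 hh2' normrZ gtr0_norm // => /(_ isT); lra.
have {}ht1 : (K + 2^-1 * qf X v + e2 * sq v) * tau <= gam / 4 by apply: ht1; rewrite tau0.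
have tv : `|tau *: v| < dP.
  have := ht2 tau; rewrite tau0 taut2 normrZ gtr0_norm // mulrC => /(_ isT); lra.
have P1 := hP _ hrh; have P2 := hP (- (h *: rh)); rewrite normrN in P2.
have {}P2 := P2 hrh; have P3 := hP _ tv; have := fd h tau.
rewrite h0 hd tau0 taud => /(_ isT isT).
rewrite -scaleNr in P2.
have sqZ (c : R) x : sq (c *: x) = c ^+ 2 * sq x by rewrite !sqE !dotE; ring.
rewrite !(qfZr, dotZr, sqZ, sqrrN) scaleNr in P1 P2 P3.
have h2p : 0 < 2 * h ^+ 2 by rewrite mulr_gt0 // exprn_gt0.
set Q := (U (z + tau *: v) - U z) / tau.
have QE : Q <= dot p v + 2^-1 * tau * qf X v + e2 * tau * sq v.
  rewrite /Q ler_pdivrMr //; move: P3; rewrite ler_norml => /andP[_].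
  by move: tau0 => _; lra.
move: P1 P2; rewrite !ler_norml => /andP[_ P1] /andP[_ P2] fd'.
have : 0 <= 2 * h ^+ 2 * (2^-1 * qf X rh + e2 * sq rh + A + L1 * h + L2 * h / tau + K * tau - beta * U z + Q).
  by move: P1 P2 fd'; rewrite -/Q; lra.
rewrite pmulr_rge0 // => fin.
have E : L2 * h / tau = L2 / tau * h by ring.
by move: QE fin hh1 ht1 er; rewrite E; lra.
Qed.

(* A sup-convolution averaged over small translations. *)
Lemma smooth_almost_subsolution r e1 del KM B : 0 <= r -> 0 < e1 -> 0 < del <= 1 ->
  (forall z, `|z| <= r -> `|kap z| <= KM) ->
  (forall z rho a, `|z| <= r + 4 -> C z rho a -> - B <= a) -> 0 <= B ->
  exists (U : V -> R) (p : V -> V) (X : V -> 'M[R]_n),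
  [/\ continuous U,
  forall z, `|z| <= r -> `|U z - G z| <= e1,
  forall z e', 0 < e' -> exists2 d, 0 < d & forall y, `|y| < d ->
    `|U (z + y) - U z - dot (p z) y - 2^-1 * qf (X z) y| <= e' * sq y &
  forall z rho a, `|z| <= r -> C z rho a ->
    beta * U z <= (1 + del) * (kap z * a) + (KM + 1) * (2 * e1 + del * B) +
      gen (p z) (X z) (inc rho)].
Proof.
(* The margin 4 leaves room for the averaging and for the segments, so that the maximizers stay
   strictly inside the ball of competitors. *)
move=> r0 e10 /andP[del0 del1] hKM hB B0; have [r4 r4E] : exists r4, r4 = r + 4 by eexists.
rewrite -r4E in hB; have r40 : 0 <= r4 by rewrite r4E addr_ge0.
have [MG MG0 hMG] := continuous_bounded r4 cG.
have [d1 d10 hd1] := continuous_unif r cG e10.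
have [d2 d20 hd2] := @continuous_unif R n kap r del (@kap_continuous R n) del0.
have [d3 d30 hd3] := C_unif r e10.
(* [eta] is a scale on which [G], [kap] and the cost are nearly constant; all displacements below
   stay within it. *)
have [eta [eta0 eta1 etad1 etad2 etad3]] :
    exists eta, [/\ 0 < eta, eta <= 1, eta <= d1, eta <= d2 & eta <= d3].
  exists (Num.min (Num.min d1 d2) (Num.min d3 1)).
  by split; rewrite ?lt_min ?d10 ?d20 ?d30 ?ltr01 // !ge_min lexx ?orbT.
have [k kE] : exists k, k = (8 * MG + 1) / eta ^+ 2 by eexists.
have k0 : 0 < k by rewrite kE divr_gt0 ?exprn_gt0 // ltr_wpDl // mulr_ge0.
have [g [m sc]] := sup_conv_exists k cG r40.
have cg : continuous g by exact: (sup_conv_continuous r40 k0 sc).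
(* Sharing of [eta]: a quarter for the averaging, a quarter for the segment of length [h * M], a
   half for the distance to the maximizer. *)
have eta4 : 0 < eta / 4 by lra.
have [S hS smS] := @smoothing R n _ eta4.
have [p [X hpX]] := smS g cg.
have mclose z z' : `|z| <= r -> `|z' - z| <= eta / 2 -> `|m z' - z| < eta.
  move=> zr zz'; have z'4 : `|z'| <= r4.
    have := @dist_norm_le z z' 1; rewrite r4E => h; apply/ltW; apply: lt_le_trans (h _) _; lra.
  have := argmax_close sc hMG z'4 eta0 MG0 kE => h.
  by apply: (le_lt_trans (ler_distD z' _ _)); lra.
have gclose z z' : `|z| <= r -> `|z' - z| <= eta / 4 -> `|g z' - G z| < e1.
  move=> zr zz'; have mz : `|m z' - z| < eta by apply: mclose => //; lra.
  have h1 := hd1 z (m z') zr (lt_le_trans mz etad1).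
  have h2 : `|G z' - G z| < e1 by apply: hd1 => //; lra.
  have z'4 : `|z'| <= r4.
    have := @dist_norm_le z z' 1; rewrite r4E => h; apply/ltW; apply: lt_le_trans (h _) _; lra.
  have := sup_conv_ge sc z' z'4; rewrite subrr sq0 mulr0 subr0 => h3.
  have h4 : g z' <= G (m z').
    by rewrite (sup_convE sc) lerBlDr lerDl mulr_ge0 ?sq_ge0 // ltW.
  move: h1 h2; rewrite !ltr_norml; lra.
have Sclose z : `|z| <= r -> `|S g z - G z| <= e1.
  move=> zr; have k1 (c : R) : continuous (fun _ : V => c) by exact: continuous_const.
  have c1 c : continuous (fun x : V => c * g x) by apply: continuous_mul.
  have h1 : 0 <= S (fun x : V => (e1 - G z) + 1 * g x) z.
    apply: (av_ge0 hS) => [|x /(gclose z x zr)]; first exact: continuous_add.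
    rewrite ltr_norml; lra.
  have h2 : 0 <= S (fun x : V => (e1 + G z) + (-1) * g x) z.
    apply: (av_ge0 hS) => [|x /(gclose z x zr)]; first exact: continuous_add.
    rewrite ltr_norml; lra.
  rewrite (av_add hS) // (av_const hS) (av_scale hS) // in h1.
  rewrite (av_add hS) // (av_const hS) (av_scale hS) // in h2.
  rewrite ler_norml; lra.
have main z rho a : `|z| <= r -> C z rho a ->
    beta * S g z <= (1 + del) * (kap z * a) + (KM + 1) * (2 * e1 + del * B)
      + gen (p z) (X z) (inc rho).
  move=> zr Ca; set rh := inc rho; pose v := drift rh.
  set A := _ * _ + _ * (_ + _).
  pose L := k * (n%:R * (2 * (r + 3) + 2 * r4)).
  have L0 : 0 <= L by rewrite /L mulr_ge0 ?(ltW k0) // mulr_ge0 // addr_ge0 // mulr_ge0 // addr_ge0.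
  have M1 : 0 < 4 * (M + 1) by rewrite mulr_gt0 // ltr_wpDl.
  have v1 : 0 < `|v| + 1 by rewrite ltr_wpDl.
  pose d := Num.min (eta / (4 * (M + 1))) (1 / (`|v| + 1)).
  have d0 : 0 < d by rewrite lt_min !divr_gt0.
  rewrite genE -/v; apply: (finite_diff_limit (L1 := beta * L * M) (L2 := 2 * L * M) (K := k * sq v) d0 (hpX z)).
  move=> h tau /andP[h0 hd] /andP[tau0 taud].
  have hM : h * M <= eta / 4.
    have : h <= eta / (4 * (M + 1)) by apply: ltW; apply: lt_le_trans hd _; rewrite ge_min lexx.
    by rewrite ler_pdivlMr //; move: h0 M0; lra.
  have tv : `|tau *: v| <= 1.
    have : tau <= 1 / (`|v| + 1) by apply: ltW; apply: lt_le_trans taud _; rewrite ge_min lexx orbT.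
    by rewrite ler_pdivlMr // normrZ gtr0_norm //; move: tau0; lra.
  set K0 := beta * L * M * h + 2 * L * M * h / tau + k * sq v * tau.
  (* The right-hand side of [finite_diff_ineq] as a constant plus multiples of translates of [g],
     the form on which the rules of [averaging] act. *)
  pose F (x : V) := 2 * h ^+ 2 * (A + K0) + (1 * g (x + h *: rh) + (1 * g (x + - (h *: rh))
    + ((- 2 - 2 * h ^+ 2 * beta - 2 * h ^+ 2 / tau) * g x + (2 * h ^+ 2 / tau) * g (x + tau *: v)))).
  have k1 (c : R) : continuous (fun _ : V => c) by exact: continuous_const.
  have cs (c : R) (w : V) : continuous (fun x : V => c * g (x + w)).
    by apply: continuous_mul => //; exact: (@continuous_shift _ _ g w cg).
  have c1 (c : R) : continuous (fun x : V => c * g x) by exact: continuous_mul.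
  have F0 : 0 <= S F z.
    apply: (av_ge0 hS).
      by do ![apply: continuous_add => //].
    move=> x xz; have xr : `|x| <= r + 1.
      by apply: ltW; apply: lt_le_trans (@dist_norm_le z x 1 _) _; move: xz eta1 zr; lra.
    have := @finite_diff_ineq r4 k g m x rho h tau (r + 3) L A r40 k0 sc h0 tau0 erefl L0.
    move=> /(_ _ _)/le_trans; apply.
    - by rewrite -/rh -/v; move: xr hM tv eta1; lra.
    - move=> t th; rewrite -/rh.
      have xt : `|x + t *: rh - z| <= eta / 2.
        rewrite addrAC; apply: (le_trans (ler_normD _ _)).
        have : `|t *: rh| <= h * M by rewrite normrZ; apply: ler_pM => //; exact: incM.
        by move: xz hM; lra.
      have mz := mclose _ _ zr xt.
      have mr : `|m (x + t *: rh)| < r4.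
        by apply: lt_le_trans (dist_norm_le mz) _; rewrite r4E; move: eta1 zr; lra.
      split => //.
      have [a' Ca' aa'] := hd3 z _ zr (lt_le_trans mz etad3) rho a Ca.
      exists a' => //; apply: cost_shift aa' => //.
      + by rewrite kap_ge1 /=; apply: le_trans (ler_norm _) (hKM z zr).
      + exact: hd2 (lt_le_trans mz etad2).
      + by rewrite del0.
      + exact: hB (ltW mr) Ca'.
    - rewrite -/rh -/v /F /K0; rewrite le_eqVlt; apply/orP; left; apply/eqP; ring.
  rewrite /F (av_add hS) // ?(av_const hS) in F0; last by do ![apply: continuous_add => //].
  rewrite (av_add hS) // in F0; last by do ![apply: continuous_add => //].
  rewrite (av_add hS) // in F0; last by do ![apply: continuous_add => //].
  rewrite (av_add hS) // in F0.
  rewrite !(av_scale hS) // in F0; try exact: (@continuous_shift _ _ g _ cg).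
  rewrite !(av_shift hS) in F0.
  apply: (le_trans F0); rewrite le_eqVlt; apply/orP; left; apply/eqP; rewrite /K0; ring.
exists (S g), p, X; split => //; exact: (av_continuous hS).
Qed.

(** Apart from the cost and the error, the inequality is homogeneous in [U], [p] and [X], so
    dividing these by [1 + del] removes the factor in front of the cost. The price is of order
    [del * |U|], which is small on the ball. *)
Lemma smooth_subsolution r e : 0 <= r -> 0 < e -> exists (U : V -> R) (p : V -> V) (X : V -> 'M[R]_n),
  [/\ continuous U,
  forall z, `|z| <= r -> `|U z - G z| <= e,
  forall z e', 0 < e' -> exists2 d, 0 < d & forall y, `|y| < d ->
    `|U (z + y) - U z - dot (p z) y - 2^-1 * qf (X z) y| <= e' * sq y &
  forall z rho a, `|z| <= r -> C z rho a ->
    beta * U z <= kap z * a + gen (p z) (X z) (inc rho) + e].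
Proof.
move=> r0 e0; have r40 : 0 <= r + 4 by rewrite addr_ge0.
have [MG MG0 hMG] := continuous_bounded (r + 4) cG.
have [KM KM0 hKM] := continuous_bounded r (@kap_continuous R n).
have [B B0 hB] := cost_lower_bound (r + 4).
have [e1 [e10 e1E]] : exists e1, 0 < e1 /\ e1 * (8 * (KM + 1)) = e.
  exists (e / (8 * (KM + 1))); have K0 : 0 < 8 * (KM + 1) by rewrite mulr_gt0 // ltr_wpDl.
  by rewrite divr_gt0 // divfK // gt_eqF.
(* Collects what [del] has to be small against: the lower bound on the cost, and the size of [G] for
   the rescaling. *)
pose D := (KM + 1) * B + MG + 1.
have D0 : 1 <= D by rewrite lerDr addr_ge0 // mulr_ge0 // addr_ge0.
have [del [del0 del1 delE]] : exists del, [/\ 0 < del, del <= 1 & del * (8 * D) <= e].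
  exists (Num.min 1 (e / (8 * D))); split; first by rewrite lt_min ltr01 divr_gt0 //; lra.
    by rewrite ge_min lexx.
  by rewrite -ler_pdivlMr ?ge_min ?lexx ?orbT //; lra.
have e18 : 8 * e1 <= e by have := mulr_ge0 KM0 (ltW e10); lra.
have [delMG delB] : del * (8 * MG) <= e /\ del * (8 * ((KM + 1) * B)) <= e.
  have KB : 0 <= (KM + 1) * B by rewrite mulr_ge0 // addr_ge0.
  have := mulr_ge0 (ltW del0) KB; have := mulr_ge0 (ltW del0) MG0.
  by move: delE; rewrite /D; lra.
have del01 : 0 < del <= 1 by rewrite del0.
have [U [p [X [cU Sclose hpX main]]]] := smooth_almost_subsolution r0 e10 del01 hKM hB B0.
have [c cE] : exists c, c * (1 + del) = 1.
  by exists (1 + del)^-1; rewrite mulVf // gt_eqF // addr_gt0.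
have c0 : 0 < c by rewrite -(pmulr_lgt0 _ (addr_gt0 ltr01 del0)) cE.
have c1 : c <= 1 by nra.
exists (fun z => c * U z), (fun z => c *: p z), (fun z => c *: X z); split.
- apply: continuous_mul; [exact: continuous_const|exact: cU].
- move=> z zr; have := Sclose z zr; have zr4 : `|z| <= r + 4 by lra.
  have := hMG z zr4; rewrite !ler_norml => /andP[g1 g2] /andP[s1 s2].
  have q1 : (1 - c) <= del by nra.
  have q2 : e1 + del * (MG + e1) <= e by nra.
  have q3 : (1 - c) * `|U z| <= del * (MG + e1).
    by apply: ler_pM => //; [lra|rewrite ler_norml; lra].
  have q4 : `|(1 - c) * U z| <= del * (MG + e1) by rewrite normrM ger0_norm //; lra.
  have -> : c * U z = U z - (1 - c) * U z by ring.
  by move: q4; rewrite ler_norml; lra.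
- move=> z e' e'0; have [d d0 hd] := hpX z e' e'0; exists d => // y /hd h.
  rewrite dotZl qfZl.
  have -> : c * U (z + y) - c * U z - c * dot (p z) y - 2^-1 * (c * qf (X z) y) =
    c * (U (z + y) - U z - dot (p z) y - 2^-1 * qf (X z) y) by ring.
  rewrite normrM (gtr0_norm c0); apply: le_trans h; rewrite -[leRHS]mul1r ler_wpM2r //.
- move=> z rho a zr Ca; have h := main z rho a zr Ca.
  have -> : gen (c *: p z) (c *: X z) (inc rho) = c * gen (p z) (X z) (inc rho).
    by rewrite !genE qfZl dotZl; ring.
  have E : (KM + 1) * (2 * e1 + del * B) <= e by nra.
  have {}h : c * (beta * U z) <= c * ((1 + del) * (kap z * a) + gen (p z) (X z) (inc rho) + e).
    by rewrite ler_pM2l //; lra.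
  have -> : beta * (c * U z) = c * (beta * U z) by ring.
  apply: (le_trans h); rewrite !mulrDr mulrA cE mul1r lerD2l.
  by rewrite -[leRHS]mul1r ler_wpM2r // ltW.
Qed.

Theorem comparison :
  (forall th, 0 < th -> exists r, forall z, th * kap z <= G z - W z -> `|z| < r) ->
  forall z, G z <= W z.
Proof.
move=> bdd z1; rewrite leNgt; apply/negP => neg.
have K1 (z : V) : 0 < kap z by apply: lt_le_trans (kap_ge1 z).
pose th := (G z1 - W z1) / kap z1.
have th0 : 0 < th by rewrite divr_gt0 // subr_gt0.
have th2 : 0 < th / 2 by lra.
have [r hr] := bdd _ th2.
have z1r : `|z1| < r.
  apply: hr; rewrite /th mulrAC divfK ?gt_eqF // -subr_ge0; lra.
have r0 : 0 <= r by apply: le_trans (ltW z1r).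
(* The first bound keeps the maximum of [(U - W) / kap] in the region controlled by the growth
   hypothesis; the second makes the final inequality [beta * (7 / 8 * th) <= 2 * e] impossible. *)
have [e [e0 e1 e2]] : exists e, [/\ 0 < e, e <= th / 8 & e <= beta * th / 8].
  exists (Num.min (th / 8) (beta * th / 8)); split; rewrite ?ge_min ?lexx ?orbT //.
  by rewrite lt_min; have := mulr_gt0 beta0 th0 => bt; apply/andP; split; lra.
have [U [p [X [cU Uclose peano sub]]]] := smooth_subsolution r0 e0.
pose F z := (U z - W z) / kap z.
have cF : continuous F.
  apply: continuous_mul; first exact: continuous_sub.
  apply: continuous_inv => [z|]; [by rewrite gt_eqF|exact: kap_continuous].
have ne : [set y : V | `|y| <= r] !=set0 by exists 0; rewrite /= normr0.
have [z0] := EVT_max_rV ne (@ball_compact R n r) (continuous_subspaceT cF).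
rewrite inE /= => z0r z0max'.
have z0max z : `|z| <= r -> F z <= F z0 by move=> zr; apply: z0max'; rewrite inE.
have GU z : `|z| <= r -> `|(U z - W z) / kap z - (G z - W z) / kap z| <= e.
  move=> zr; rewrite -mulrBl opprB addrA subrK normrM normfV (gtr0_norm (K1 z)) ler_pdivrMr //.
  apply: (le_trans (Uclose z zr)); rewrite -[leLHS]mulr1 ler_pM2l //; exact: kap_ge1.
have Fz0 : th - e <= F z0.
  apply: le_trans (z0max _ (ltW z1r)); have := GU z1 (ltW z1r).
  by rewrite -/th -/(F z1) ler_norml; lra.
have z0r' : `|z0| < r.
  apply: hr; rewrite -ler_pdivlMr //; have := GU z0 z0r; rewrite -/(F z0) ler_norml; lra.
set lam := F z0 in Fz0; have lamE : U z0 - W z0 = lam * kap z0 by rewrite /lam /F divfK // gt_eqF.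
have lam0 : 0 < lam by lra.
(* [U - lam * kap] lies below [W] on the ball and touches it at [z0], so its expansion is a lower
   jet. *)
have jet : lower_jet W z0 (p z0 - lam *: map_mx expR z0) (X z0 - lam *: diag_mx (map_mx expR z0)).
  move=> eps eps0; have lam1 : 0 < 2 * (lam + 1) by lra.
  have [d1 d10 hd1] := peano z0 _ (divr_gt0 eps0 (ltr0n R 2)).
  have [d2 d20 hd2] := kap_peano z0 (divr_gt0 eps0 lam1).
  exists (Num.min (Num.min d1 d2) (r - `|z0|)); first by rewrite !lt_min d10 d20 subr_gt0.
  move=> y; rewrite !lt_min => /andP[/andP[y1 y2] y3].
  have := hd1 _ y1; have := hd2 _ y2; rewrite !ler_norml => /andP[_ k1] /andP[u1 _].
  have yr : `|z0 + y| <= r by apply: (le_trans (ler_normD _ _)); lra.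
  have := z0max _ yr; rewrite -/lam /F ler_pdivrMr // => h.
  rewrite -scaleNr -[in qf (_ - _) _]scaleNr dotDl dotZl qfDl qfZl.
  have {}k1 := ler_wpM2l (ltW lam0) k1.
  have E : lam * (eps / (2 * (lam + 1)) * sq y) <= eps / 2 * sq y.
    rewrite mulrA ler_wpM2r ?sq_ge0 // mulrA ler_pdivrMr //; nra.
  move: h k1 u1 E lamE; lra.
have [rho [a [Ca le]]] := superW jet e0.
have := sub z0 rho a z0r Ca.
(* The generator does not see the multiple of [kap]: the two inequalities now share cost and
   generator, and only [beta * (U - W)] remains. *)
move: le; rewrite genBZ gen_kap mulr0 subr0 => le1 le2.
have : beta * (lam * kap z0) <= 2 * e by rewrite -lamE; lra.
have : beta * (7 / 8 * th) <= beta * (lam * kap z0).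
  rewrite ler_pM2l //; have := kap_ge1 z0; nra.
by nra.
Qed.

End Comparison.

(** * Finitely supported measures *)

Lemma measurable_continuous {R : realType} {d : nat} (f : 'rV[R]_d -> R) :
  continuous f -> measurable_fun [set: Rd R d] (f : Rd R d -> R).
Proof.
move=> cf; apply: (measurability _ (RGenOpens.measurableE R)) => /=.
move=> _ [_ [a [b ->]] <-]; rewrite setTI.
apply: sub_sigma_algebra; move/continuousP : cf => /(_ `]a, b[%classic); apply.
exact: interval_open.
Qed.

Lemma measurable_open {R : realType} {d : nat} (A : set 'rV[R]_d) :
  open A -> measurable (A : set (Rd R d)).
Proof. by move=> oA; exact: sub_sigma_algebra. Qed.

Lemma measurable_closed {R : realType} {d : nat} (A : set 'rV[R]_d) :
  closed A -> measurable (A : set (Rd R d)).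
Proof.
move=> cA; rewrite -(setCK A); apply: measurableC; apply: measurable_open.
exact: closed_openC.
Qed.

Lemma measurable_point {R : realType} {d : nat} (x : 'rV[R]_d) :
  measurable ([set x] : set (Rd R d)).
Proof. by apply: measurable_closed; apply: accessible_closed_set1; apply: hausdorff_accessible; exact: norm_hausdorff. Qed.

Section DiracCombination.
Context {disp : measure_display} {T : measurableType disp} {R : realType}.
Implicit Types (s : seq (R * T)).

(** The coefficients pass through [nng], which truncates at 0; hence the sign conditions below. *)
Definition dcomb s : {measure set T -> \bar R} :=
  foldr (fun p (m : {measure set T -> \bar R}) =>
    [the {measure set T -> \bar R} of measure_add (mscale (nng p.1) (dirac p.2)) m])
    [the {measure set T -> \bar R} of mzero] s.

Lemma dcombE s (A : set T) : all (fun p => 0 <= p.1) s ->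
  dcomb s A = (\sum_(p <- s) p.1 * (p.2 \in A)%:R)%:E.
Proof.
elim: s => [_|[c x] s IH /= /andP[c0 s0]]; first by rewrite big_nil.
rewrite /measure_add /msum /= big_ord_recl big_ord1 /= /mscale /= IH //.
by rewrite diracE big_cons EFinD EFinM; congr (_%:E * _ + _)%E; apply/max_idPl.
Qed.

Lemma ge0_integral_dcomb s (f : T -> R) : all (fun p => 0 <= p.1) s ->
  measurable_fun setT f -> (forall x, 0 <= f x) ->
  (\int[dcomb s]_x (f x)%:E = (\sum_(p <- s) p.1 * f p.2)%:E)%E.
Proof.
move=> + mf f0; have mf' : measurable_fun setT (EFin \o f) by exact/measurable_EFinP.
elim: s => [_|[c x] s IH /= /andP[c0 s0]].
  by rewrite big_nil; exact: integral_measure_zero.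
rewrite ge0_integral_measure_add //; [|by move=> y _; rewrite lee_fin].
rewrite ge0_integral_mscale //; [|by move=> y _; rewrite lee_fin].
rewrite integral_dirac // diracT mul1e IH // big_cons EFinD EFinM /=.
by congr (_%:E * _ + _)%E; apply/max_idPl.
Qed.

Lemma integral_dcomb s (f : T -> R) : all (fun p => 0 <= p.1) s ->
  measurable_fun setT f ->
  (\int[dcomb s]_x (f x)%:E = (\sum_(p <- s) p.1 * f p.2)%:E)%E.
Proof.
move=> s0 mf; rewrite integralE.
have -> : (fun x => (f x)%:E)^\+%E = (fun x => (Num.max (f x) 0)%:E).
  by apply/funext => x; rewrite funeposE EFin_max.
have -> : (fun x => (f x)%:E)^\-%E = (fun x => (Num.max (- f x) 0)%:E).
  by apply/funext => x; rewrite funenegE EFin_max.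
rewrite !ge0_integral_dcomb //; try by move=> x; rewrite le_max lexx orbT.
- rewrite -EFinB -sumrB; congr (_%:E); apply: eq_bigr => p _; rewrite -mulrBr; congr (_ * _).
  have [h|h] := leP 0 (f p.2).
    by rewrite max_r ?oppr_le0 // subr0.
  by rewrite max_l ?oppr_ge0 ?(ltW h) // sub0r opprK.
- by apply: measurable_maxr => //; exact: measurable_funN.
- by apply: measurable_maxr.
Qed.

End DiracCombination.

Section PushforwardMeasure.
Context {d1 d2 : measure_display} {T1 : measurableType d1} {T2 : measurableType d2} {R : realType}.

Lemma pushforward_exists (m : {measure set T1 -> \bar R}) (f : T1 -> T2) :
  measurable_fun setT f -> exists m' : {measure set T2 -> \bar R},
    (forall A, m' A = m (f @^-1` A)) /\
    (forall g : T2 -> \bar R, measurable_fun setT g -> (forall y, 0 <= g y)%E ->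
      (\int[m']_y g y = \int[m]_x g (f x))%E).
Proof.
move=> mf.
exists (measure_function_pushforward__canonical__measure_function_Measure m mf); split => // g mg g0.
by rewrite (ge0_integral_pushforward mf).
Qed.

End PushforwardMeasure.

(** * Measurability of the Euclidean norm *)

Section Enorm.
Context {R : realType} {d : nat}.
Implicit Types x y : 'rV[R]_d.

Lemma enorm_continuous : continuous (@enorm R d).
Proof.
have -> : @enorm R d = (fun x => Num.sqrt (sq x)).
  by apply/funext => x; rewrite /enorm sqE dot_sum; congr Num.sqrt; apply: eq_bigr => i _; rewrite expr2.
by move=> x; apply: (continuous_comp (@sq_continuous R d x)); exact: sqrt_continuous.
Qed.

Lemma enorm_ge0 x : 0 <= enorm x.
Proof. exact: sqrtr_ge0. Qed.

Lemma norm_le_enorm x : `|x| <= enorm x.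
Proof.
apply: norm_leP => [|i]; first exact: enorm_ge0.
rewrite -sqrtr_sqr ler_sqrt; last by apply: sumr_ge0 => j _; exact: sqr_ge0.
by rewrite (bigD1 i) //= lerDl; apply: sumr_ge0 => j _; exact: sqr_ge0.
Qed.

Lemma enorm0 : enorm (0 : 'rV[R]_d) = 0.
Proof. by rewrite /enorm big1 ?sqrtr0 // => i _; rewrite mxE expr0n. Qed.

Lemma measurable_enorm_powR (q : R) :
  measurable_fun [set: Rd R d] (fun x : Rd R d => (enorm x) `^ q).
Proof.
apply: (measurableT_comp (measurable_powR q)).
exact: (measurable_continuous enorm_continuous).
Qed.

Lemma measurable_enorm_sub : measurable_fun [set: Rd R d * Rd R d]
  (fun z : Rd R d * Rd R d => enorm (z.1 - z.2 : 'rV[R]_d)).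
Proof.
pose S (z : Rd R d * Rd R d) : R := \sum_i (((z.1 : 'rV[R]_d) ord0 i) - ((z.2 : 'rV[R]_d) ord0 i)) ^+ 2.
rewrite (_ : (fun z => _) = (fun z => Num.sqrt (S z))); last first.
  by apply/funext => z; rewrite /enorm /S; congr Num.sqrt; apply: eq_bigr => i _; rewrite !mxE.
apply: (measurableT_comp (continuous_measurable_fun (@sqrt_continuous R))).
apply: measurable_sum => i; apply: measurable_funX; have mc := measurable_continuous (@continuous_coord R d i).
exact: (measurable_funB (measurableT_comp mc measurable_fst) (measurableT_comp mc measurable_snd)).
Qed.

Lemma measurable_enorm_sub_powR (q : R) : measurable_fun [set: Rd R d * Rd R d]
  (fun z : Rd R d * Rd R d => enorm (z.1 - z.2 : 'rV[R]_d) `^ q).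
Proof. exact: (measurableT_comp (measurable_powR q) measurable_enorm_sub). Qed.

End Enorm.

(** * Neighbourhoods in the weak and Wasserstein topologies *)

Section Neighbourhoods.
Context {R : realType} {d : nat}.
Implicit Types (mu nu : @meas R d) (q : R).

(** A measure is a function on all sets, so agreement on measurable sets is weaker than equality;
    the notions in use have to be shown to respect it. *)
Definition eqm mu nu := forall A : set (Rd R d), measurable A -> mu A = nu A.

Lemma eqm_integral mu nu (f : Rd R d -> \bar R) : eqm mu nu ->
  (\int[mu]_x f x = \int[nu]_x f x)%E.
Proof. by move=> h; apply: eq_measure_integral => A mA _; exact: h. Qed.

Lemma eqm_Pq q mu nu : eqm mu nu -> Pq q mu -> Pq q nu.
Proof.
move=> h [h1 h2]; split; first by rewrite /isprob -h.
by rewrite -(eqm_integral _ h).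
Qed.

Lemma bounded_integral_fin q mu (f : Rd R d -> R) (M : R) : Pq q mu ->
  measurable_fun setT f -> (forall x, `|f x| <= M) ->
  mu.-integrable setT (EFin \o f).
Proof.
move=> [mu1 _] mf fM; apply: measurable_bounded_integrable => //.
  by rewrite mu1 ltry.
by exists M; split; [exact: num_real|move=> x Mx y _ /=; exact: le_trans (fM y) (ltW Mx)].
Qed.

(** In the Wasserstein case the coupling is the image of [mu] under the diagonal map, whose cost is
    0. *)
Lemma Pnbhs_eqm q mu nu (A : set (@meas R d)) : Pq q mu -> eqm mu nu -> Pnbhs q mu A -> A nu.
Proof.
move=> pmu h; have pnu := eqm_Pq h pmu; rewrite /Pnbhs; case: eqP => [q0|/eqP q0].
  move=> [n [f [eps [eps0 [hf]]]]]; apply => // i; rewrite (eqm_integral _ h).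
  have [cf [M fM]] := hf i.
  have := integrable_fin_num measurableT (bounded_integral_fin pnu (measurable_continuous cf) fM).
  by move=> /fineK <-; rewrite subee // abse0 lte_fin.
move=> [eps [eps0]]; apply => //.
have mdiag : measurable_fun [set: Rd R d] (fun x : Rd R d => (x, x)).
  by apply: measurable_fun_pair.
have [pi [piE piint]] := pushforward_exists mu mdiag.
exists pi; split.
  split => B mB; rewrite piE; first by congr (mu _); apply/seteqP; split=> x //= -[].
  by rewrite -h //; congr (mu _); apply/seteqP; split=> x //= -[].
rewrite piint; last first.
- by move=> y; rewrite lee_fin powR_ge0.
- by apply/measurable_EFinP; exact: measurable_enorm_sub_powR.
rewrite (eq_integral (cst 0%E)) => [|x _].
  by rewrite integral0 lte_fin powR_gt0.
by rewrite /= subrr enorm0 powR0.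
Qed.

Lemma Pnbhs_mono q mu (A B : set (@meas R d)) :
  (forall nu, Pq q nu -> A nu -> B nu) -> Pnbhs q mu A -> Pnbhs q mu B.
Proof.
move=> AB; rewrite /Pnbhs; case: eqP => _.
  move=> [n [f [e [e0 [hf hA]]]]]; exists n, f, e; split => //; split => // nu pnu h.
  exact/AB/hA.
by move=> [e [e0 hA]]; exists e; split => // nu pnu h; exact/AB/hA.
Qed.

Lemma PnbhsT q mu : Pnbhs q mu setT.
Proof.
rewrite /Pnbhs; case: eqP => _; last by exists 1.
by exists 0%N, (fun _ _ => 0), 1; split => //; split => // -[].
Qed.

Lemma PnbhsI q mu (A B : set (@meas R d)) : q = 0 \/ 1 <= q ->
  Pnbhs q mu A -> Pnbhs q mu B -> Pnbhs q mu (A `&` B).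
Proof.
move=> hq; rewrite /Pnbhs; case: eqP => [_|/eqP q0].
  move=> [n1 [f1 [e1 [e10 [hf1 hA]]]]] [n2 [f2 [e2 [e20 [hf2 hB]]]]].
  exists (n1 + n2)%N, (fun i : 'I_(n1 + n2) => match fintype.split i with inl j => f1 j | inr j => f2 j end), (Num.min e1 e2).
  split; first by rewrite lt_min e10.
  split; first by move=> i; case: (fintype.split i).
  move=> nu pnu h; split.
    apply: hA => // i; have := h (lshift n2 i).
    rewrite (unsplitK (inl i)) => /lt_le_trans; apply; by rewrite lee_fin ge_min lexx.
  apply: hB => // i; have := h (rshift n1 i).
  rewrite (unsplitK (inr i)) => /lt_le_trans; apply; by rewrite lee_fin ge_min lexx orbT.
have q1 : 0 <= q by case: hq => [->//|]; exact: le_trans.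
move=> [e1 [e10 hA]] [e2 [e20 hB]]; exists (Num.min e1 e2); split; first by rewrite lt_min e10.
have m0 : 0 <= Num.min e1 e2 by rewrite le_min !ltW.
move=> nu pnu [pi [cpi h]]; split.
  apply: hA => //; exists pi; split => //; apply: (lt_le_trans h).
  by rewrite lee_fin ge0_ler_powR // ?nnegrE ?(ltW e10) // ge_min lexx.
apply: hB => //; exists pi; split => //; apply: (lt_le_trans h).
by rewrite lee_fin ge0_ler_powR // ?nnegrE ?(ltW e20) // ge_min lexx orbT.
Qed.

End Neighbourhoods.

Section LipschitzTest.
Context {R : realType} {d : nat}.

Lemma coupling_fst (mu nu : @meas R d) pi (g : Rd R d -> \bar R) : coupling mu nu pi ->
  measurable_fun setT g -> (forall x, 0 <= g x)%E -> (\int[mu]_x g x = \int[pi]_z g z.1)%E.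
Proof.
move=> [h1 _] mg g0.
have [m' [m'E <-//]] := pushforward_exists pi (@measurable_fst _ _ (Rd R d) (Rd R d)).
apply: eqm_integral => A mA; rewrite m'E -h1 //; congr (pi _).
by apply/seteqP; split => [[x y] /= []|[x y] /=].
Qed.

Lemma coupling_snd (mu nu : @meas R d) pi (g : Rd R d -> \bar R) : coupling mu nu pi ->
  measurable_fun setT g -> (forall x, 0 <= g x)%E -> (\int[nu]_x g x = \int[pi]_z g z.2)%E.
Proof.
move=> [_ h2] mg g0.
have [m' [m'E <-//]] := pushforward_exists pi (@measurable_snd _ _ (Rd R d) (Rd R d)).
apply: eqm_integral => A mA; rewrite m'E -h2 //; congr (pi _).
by apply/seteqP; split => [[x y] /= []|[x y] /=].
Qed.

(** Controls first moments by [q]-th moments: up to [del] the constant suffices, and beyond it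
    [t / del >= 1] does not decrease when raised to the power [q]. *)
Lemma le_powR_split (t del q : R) : 0 <= t -> 0 < del -> 1 <= q ->
  t <= del + del / del `^ q * t `^ q.
Proof.
move=> t0 del0 q1; have dq : 0 < del `^ q by exact: powR_gt0.
have [td|td] := leP t del.
  by rewrite ler_wpDr // mulr_ge0 ?powR_ge0 // divr_ge0 // ltW.
have s1 : 1 <= t / del by rewrite ler_pdivlMr // mul1r ltW.
have h : t / del <= (t / del) `^ q by rewrite -[leLHS]powRr1 ?ler_powR // divr_ge0 // ltW.
have -> : t `^ q = (t / del) `^ q * del `^ q.
  by rewrite -powRM ?(ltW del0) ?divr_ge0 ?(ltW del0) // divfK // gt_eqF.
have -> : del / del `^ q * ((t / del) `^ q * del `^ q) = del * (t / del) `^ q by field; rewrite gt_eqF.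
have : del * (t / del) <= del * (t / del) `^ q by rewrite ler_pM2l.
by rewrite mulrC divfK ?gt_eqF //; lra.
Qed.

(** Bounded Lipschitz functions are tests common to both topologies. Under a coupling of cost below
    [del ^ q], [le_powR_split] bounds the difference of the integrals by [2 * L * del], which the
    choice of [del] makes at most [e / 2]. *)
Lemma Pnbhs_test q (mu : @meas R d) (g : 'rV[R]_d -> R) (L e : R) : q = 0 \/ 1 <= q ->
  Pq q mu -> 0 <= L -> (forall x, 0 <= g x <= 1) ->
  (forall x y, `|g x - g y| <= L * enorm (x - y)) -> 0 < e -> continuous g ->
  Pnbhs q mu [set nu : @meas R d | (`|\int[nu]_x (g x)%:E - \int[mu]_x (g x)%:E| < e%:E)%E].
Proof.
move=> hq pmu L0 g01 lip e0 cg; rewrite /Pnbhs; case: eqP => [q0|/eqP q0].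
  exists 1%N, (fun _ => g), e; split => //; split; last by move=> nu _ /(_ ord0).
  by move=> _; split => //; exists 1 => x; have /andP[g0 g1] := g01 x; rewrite ger0_norm.
have q1 : 1 <= q by case: hq => // q0'; rewrite q0' eqxx in q0.
pose del := e / (4 * (L + 1)).
have L1 : 0 < 4 * (L + 1) by rewrite mulr_gt0 // ltr_wpDl.
have del0 : 0 < del by exact: divr_gt0.
have delE : del * (4 * (L + 1)) = e by rewrite /del divfK // gt_eqF.
exists del; split => // nu pnu [pi [cpi cost]].
have mg : measurable_fun [set: Rd R d] (EFin \o (g : Rd R d -> R)).
  by apply/measurable_EFinP; exact: measurable_continuous.
have g0 x : (0 <= (g x)%:E)%E by rewrite lee_fin; case/andP: (g01 x).
have pi1 : pi setT = 1%E.
  by rewrite -setXTT cpi.1 //; case: pmu.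
pose Nq (z : Rd R d * Rd R d) : R := enorm (z.1 - z.2 : 'rV[R]_d) `^ q.
pose T z := L * del + L * (del / del `^ q) * Nq z.
have c0 : 0 <= L * (del / del `^ q) by rewrite mulr_ge0 // divr_ge0 ?powR_ge0 // ltW.
have T0 z : 0 <= T z by rewrite addr_ge0 // mulr_ge0 ?powR_ge0 // ltW.
have mc : measurable_fun [set: Rd R d * Rd R d] (EFin \o Nq).
  by apply/measurable_EFinP; exact: measurable_enorm_sub_powR.
have mT : measurable_fun setT (EFin \o T).
  apply/measurable_EFinP; apply: measurable_funD => //.
  by apply: measurable_funM => //; exact: measurable_enorm_sub_powR.
have gT x y : g x <= g y + T (x, y) /\ g y <= g x + T (x, y).
  have h : L * enorm (x - y) <= T (x, y).
    by rewrite /T /= -mulrA -mulrDr ler_wpM2l // le_powR_split // enorm_ge0.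
  by have := lip x y; rewrite ler_norml => /andP[]; lra.
have intT : (\int[pi]_z (T z)%:E <= (e / 2)%:E)%E.
  rewrite (eq_integral (fun z => (L * del)%:E + (L * (del / del `^ q))%:E *
      (Nq z)%:E)%E); last by move=> z _; rewrite -EFinM -EFinD.
  rewrite ge0_integralD //; first last.
  - exact: measurable_funeM.
  - by move=> z _; rewrite -EFinM lee_fin mulr_ge0 // powR_ge0.
  - by move=> z _; rewrite lee_fin mulr_ge0 // ltW.
  rewrite integral_cst // pi1 mule1 ge0_integralZl //; last by move=> z _; rewrite lee_fin powR_ge0.
  apply: (@le_trans _ _ ((L * del)%:E + (L * (del / del `^ q))%:E * (del `^ q)%:E)%E).
    by rewrite leeD2l // lee_wpmul2l ?lee_fin // ltW.
  rewrite -EFinM -EFinD lee_fin -mulrA divfK ?gt_eqF ?powR_gt0 //; lra.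
have mg1 : measurable_fun [set: Rd R d * Rd R d] (fun z : Rd R d * Rd R d => (g z.1)%:E).
  exact: (measurableT_comp mg measurable_fst).
have mg2 : measurable_fun [set: Rd R d * Rd R d] (fun z : Rd R d * Rd R d => (g z.2)%:E).
  exact: (measurableT_comp mg measurable_snd).
have I1 := coupling_fst cpi mg g0; have I2 := coupling_snd cpi mg g0; rewrite /= in I1 I2.
have b1 : (\int[nu]_x (g x)%:E <= \int[mu]_x (g x)%:E + (e / 2)%:E)%E.
  rewrite I1 I2; apply: (@le_trans _ _ (\int[pi]_z ((g z.1)%:E + (T z)%:E))%E).
    apply: ge0_le_integral => //.
    - exact: emeasurable_funD.
    - by move=> [x y] _ /=; rewrite -EFinD lee_fin; case: (gT x y).
  by rewrite ge0_integralD //; [rewrite leeD2l|move=> z _; rewrite lee_fin].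
have b2 : (\int[mu]_x (g x)%:E <= \int[nu]_x (g x)%:E + (e / 2)%:E)%E.
  rewrite I1 I2; apply: (@le_trans _ _ (\int[pi]_z ((g z.2)%:E + (T z)%:E))%E).
    apply: ge0_le_integral => //.
    - exact: emeasurable_funD.
    - by move=> [x y] _ /=; rewrite -EFinD lee_fin; case: (gT x y).
  by rewrite ge0_integralD //; [rewrite leeD2l|move=> z _; rewrite lee_fin].
have gb x : `|g x| <= 1 by have /andP[? ?] := g01 x; rewrite ger0_norm.
have f1 := integrable_fin_num measurableT (bounded_integral_fin pmu (measurable_continuous cg) gb).
have f2 := integrable_fin_num measurableT (bounded_integral_fin pnu (measurable_continuous cg) gb).
move: b1 b2; rewrite /= in f1 f2 *; rewrite -(fineK f1) -(fineK f2).
rewrite -!EFinD !lee_fin abse_EFin lte_fin ltr_norml; lra.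
Qed.

End LipschitzTest.

Lemma bigsetU_ordP {T : Type} {N : nat} (F : 'I_N -> set T) (x : T) :
  (\big[setU/set0]_(i < N) F i) x <-> exists i, F i x.
Proof.
rewrite -bigcup_seq; split => [[i _ Fi]|[i Fi]]; first by exists i.
by exists i => //=; exact: mem_index_enum.
Qed.

(** * Measures carried by given points, parametrized by their weights *)

Section FiniteSupport.
Context {R : realType} {d N : nat} (xs : 'I_N -> 'rV[R]_d).
Implicit Types (a b : 'rV[R]_N).

Definition weights b := (forall i, 0 <= b ord0 i) /\ \sum_i b ord0 i = 1.

Definition atm b : @meas R d := dcomb [seq (b ord0 i, xs i : Rd R d) | i <- enum 'I_N].

Lemma weights_all b : weights b -> all (fun p => 0 <= p.1) [seq (b ord0 i, xs i : Rd R d) | i <- enum 'I_N].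
Proof. by move=> [b0 _]; apply/allP => _ /mapP[i _ ->]; exact: b0. Qed.

Lemma integral_atm b (f : Rd R d -> R) : weights b -> measurable_fun setT f ->
  (\int[atm b]_x (f x)%:E = (\sum_i b ord0 i * f (xs i))%:E)%E.
Proof.
by move=> wb mf; rewrite integral_dcomb ?big_map ?big_enum //; exact: weights_all.
Qed.

Lemma atmE b A : weights b -> atm b A = (\sum_i b ord0 i * (xs i \in A)%:R)%:E.
Proof. by move=> wb; rewrite dcombE ?big_map ?big_enum //; exact: weights_all. Qed.

Lemma atm_prob b : weights b -> isprob (atm b).
Proof.
move=> wb; rewrite /isprob atmE //; congr (_%:E); rewrite -[RHS](proj2 wb).
by apply: eq_bigr => i _; rewrite in_setT mulr1.
Qed.

Lemma atm_supported b : weights b -> supported_in xs (atm b).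
Proof.
move=> wb; split; first exact: atm_prob.
rewrite atmE // big1 // => i _; rewrite memNset ?mulr0 //.
by move=> /=; apply; exists i.
Qed.

Lemma atm_Pq q b : weights b -> Pq q (atm b).
Proof.
move=> wb; split; first exact: atm_prob.
by rewrite integral_atm ?ltry //; exact: measurable_enorm_powR.
Qed.

(** The weights are the masses of the points; injectivity makes these points disjoint pieces of the
    range. *)
Lemma supported_atm (nu : @meas R d) : injective xs -> supported_in xs nu ->
  exists b, weights b /\ eqm nu (atm b).
Proof.
move=> ix [nu1 nu0].
have mrange : measurable (range xs : set (Rd R d)).
  have -> : (range xs : set (Rd R d)) = \big[setU/set0]_(i < N) [set xs i].
    apply/seteqP; split => [_ [i _ <-]|y /bigsetU_ordP[i ->]]; last by exists i.
    by apply/bigsetU_ordP; exists i.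
  by apply: bigsetU_measurable => i _; exact: measurable_point.
have fin A : measurable A -> nu A \is a fin_num.
  move=> mA; rewrite ge0_fin_numE //; apply: (@le_lt_trans _ _ (nu setT)).
    by apply: le_measure; rewrite ?inE.
  by rewrite nu1 ltry.
pose b : 'rV[R]_N := \row_i fine (nu [set xs i]).
have bE i : (b ord0 i)%:E = nu [set xs i] by rewrite mxE fineK // fin //; exact: measurable_point.
have nuE A : measurable A -> nu A = (\sum_i b ord0 i * (xs i \in A)%:R)%:E.
  move=> mA.
  have -> : nu A = nu (A `&` range xs).
    rewrite (measureDI nu mA mrange) [X in (X + _)%E](_ : _ = 0%E) ?add0e //.
    apply/eqP; rewrite eq_le measure_ge0 andbT -nu0.
    apply: le_measure; rewrite ?inE //; first exact: measurableD.
      exact: measurableC.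
  have -> : A `&` range xs = \big[setU/set0]_(i < N) (A `&` [set xs i]).
    apply/seteqP; split => [x [Ax [i _ xi]]|x /bigsetU_ordP[i [Ax /= xi]]].
      by apply/bigsetU_ordP; exists i; split => //; rewrite /= xi.
    by split => //; exists i.
  have mF i : measurable (A `&` [set xs i] : set (Rd R d)).
    by apply: measurableI => //; exact: measurable_point.
  rewrite measure_semi_additive_ord //; last 2 first.
  - by apply/trivIsetP => i j _ _ ij; apply/seteqP; split => // x [[_ ->] [_ /= /ix ij']]; rewrite ij' eqxx in ij.
  - by apply: bigsetU_measurable => i _; exact: mF.
  rewrite -sumEFin; apply: eq_bigr => i _; rewrite EFinM bE.
  have [xA|xA] := boolP (xs i \in A).
    rewrite mule1; congr (nu _); apply/seteqP; split => [x []|x /= ->] //.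
    by split => //; exact: set_mem.
  rewrite mule0 (_ : _ `&` _ = set0) ?measure0 //.
  by apply/seteqP; split => // x [Ax /= xi]; rewrite xi in Ax; rewrite (mem_set Ax) in xA.
have wb : weights b.
  split => [i|]; first by rewrite -lee_fin bE measure_ge0.
  apply/eqP; rewrite -eqe -nu1 nuE //; apply/eqP; congr (_%:E).
  by apply: eq_bigr => i _; rewrite in_setT mulr1.
by exists b; split => // A mA; rewrite nuE // atmE.
Qed.

(** Continuity of the parametrization by weights. In the Wasserstein case only the mass by which [a]
    and [b] differ is moved, so the cost is at most linear in [|b - a|]. *)
Lemma Pnbhs_atm p a (A : set (@meas R d)) : p = 0 \/ 1 <= p -> weights a ->
  Pnbhs p (atm a) A -> exists2 del, 0 < del &
    forall b, weights b -> `|b - a| < del -> A (atm b).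
Proof.
move=> hp wa; rewrite /Pnbhs; case: eqP => [p0|/eqP p0].
  move=> [n [f [eps [eps0 [hf hA]]]]].
  have [|del del0 hdel] := @fin_delta R 'I_n (fun k del => forall b, weights b -> `|b - a| < del ->
      (`|\int[atm b]_x (f k x)%:E - \int[atm a]_x (f k x)%:E| < eps%:E)%E).
    move=> k; have [cf _] := hf k; pose S := \sum_i `|f k (xs i)| + 1.
    have S0 : 0 < S by rewrite ltr_wpDl // sumr_ge0.
    exists (eps / S); first exact: divr_gt0.
    move=> d' /andP[d'0 d'S] b wb bd.
    have mf := measurable_continuous cf.
    rewrite !integral_atm // -EFinB abse_EFin lte_fin -sumrB.
    apply: (le_lt_trans (ler_norm_sum _ _ _)).
    apply: (@le_lt_trans _ _ (\sum_i `|b - a| * `|f k (xs i)|)).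
      apply: ler_sum => i _; rewrite -mulrBl normrM ler_wpM2r //.
      by have := coord_le_norm (b - a) i; rewrite !mxE.
    rewrite -mulr_sumr; apply: (@le_lt_trans _ _ (`|b - a| * S)).
      by rewrite ler_wpM2l // /S lerDl.
    by rewrite -ltr_pdivlMr //; exact: lt_le_trans bd d'S.
  by exists del => // b wb bd; apply: hA => [|k]; [exact: atm_Pq|exact: hdel].
have p1 : 1 <= p by case: hp => // p0'; rewrite p0' eqxx in p0.
move=> [eps [eps0 hA]].
pose D := \sum_i \sum_j enorm (xs i - xs j) `^ p + 1.
have D0 : 0 < D.
  by rewrite ltr_wpDl // sumr_ge0 // => i _; rewrite sumr_ge0 // => j _; exact: powR_ge0.
have N0 : 0 < N%:R + 1 :> R by rewrite ltr_wpDl.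
exists (eps `^ p / (D * (N%:R + 1))); first by rewrite divr_gt0 ?powR_gt0 // mulr_gt0.
move=> b wb bd; apply: hA; first exact: atm_Pq.
(* the common part stays in place, the excess of [a] is spread over the excess of [b] *)
pose ps (t : R) := Num.max t 0.
pose th := \sum_i ps (a ord0 i - b ord0 i).
have ps0 t : 0 <= ps t by rewrite /ps le_max lexx orbT.
have psE t : ps t - ps (- t) = t.
  rewrite /ps; have [t0|t0] := leP 0 t.
    by rewrite max_r ?oppr_le0 // subr0.
  by rewrite max_l ?oppr_ge0 ?(ltW t0) // sub0r opprK.
have minE (s t : R) : Num.min s t = s - ps (s - t).
  rewrite /ps; have [st|st] := leP s t.
    by rewrite max_r ?subr_le0 // subr0.
  by rewrite max_l ?subr_ge0 ?(ltW st) // opprB addrC subrK.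
have thE : th = \sum_i ps (b ord0 i - a ord0 i).
  apply/eqP; rewrite -subr_eq0 -sumrB.
  under eq_bigr do rewrite -[b _ _ - _]opprB psE.
  by rewrite sumrB (proj2 wa) (proj2 wb) subrr.
have th0 : 0 <= th by apply: sumr_ge0.
pose c i j : R := (if i == j then Num.min (a ord0 i) (b ord0 i) else 0) +
  ps (a ord0 i - b ord0 i) * ps (b ord0 j - a ord0 j) / th.
have c0 i j : 0 <= c i j.
  apply: addr_ge0; last by rewrite divr_ge0 // mulr_ge0.
  by case: eqP => // _; rewrite le_min (proj1 wa) (proj1 wb).
(* If [th = 0], every excess vanishes, which is consistent with division by 0 giving 0. *)
have ps_th i : ps (a ord0 i - b ord0 i) * (th / th) = ps (a ord0 i - b ord0 i).
  have [t0|t0] := eqVneq th 0; last by rewrite divff // mulr1.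
  have /eqP := t0; rewrite psumr_eq0 // => /allP/(_ i (mem_index_enum _)) /eqP ->.
  by rewrite mul0r.
have ps_th' i : ps (b ord0 i - a ord0 i) * (th / th) = ps (b ord0 i - a ord0 i).
  have [t0|t0] := eqVneq th 0; last by rewrite divff // mulr1.
  have /eqP := t0; rewrite thE psumr_eq0 // => /allP/(_ i (mem_index_enum _)) /eqP ->.
  by rewrite mul0r.
have row i : \sum_j c i j = a ord0 i.
  rewrite big_split /= -big_mkcond /= (big_pred1 i) => [|j]; last by rewrite eq_sym.
  rewrite -mulr_suml -mulr_sumr -thE -mulrA ps_th minE; lra.
have col j : \sum_i c i j = b ord0 j.
  rewrite big_split /= -big_mkcond /= (big_pred1 j) => [|i //].
  rewrite -mulr_suml -mulr_suml -/th (mulrC th) -mulrA ps_th' minE.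
  by have := psE (a ord0 j - b ord0 j); rewrite opprB; lra.
pose pi : {measure set (Rd R d * Rd R d) -> \bar R} :=
  dcomb [seq (c i j, (xs i : Rd R d, xs j : Rd R d)) | i <- enum 'I_N, j <- enum 'I_N].
have call : all (fun p => 0 <= p.1) [seq (c i j, (xs i : Rd R d, xs j : Rd R d)) | i <- enum 'I_N, j <- enum 'I_N].
  by apply/allP => _ /allpairsP[[i j] [_ _ ->]]; exact: c0.
exists pi; split.
  split => B mB; rewrite dcombE // big_allpairs_dep /= big_enum /= atmE //; congr (_%:E).
    apply: eq_bigr => i _; rewrite big_enum /= -row mulr_suml; apply: eq_bigr => j _.
    by congr (_ * (nat_of_bool _)%:R); apply/idP/idP; rewrite !inE /=; tauto.
  under eq_bigr do rewrite big_enum /=.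
  rewrite exchange_big /=; apply: eq_bigr => j _; rewrite -col mulr_suml; apply: eq_bigr => i _.
  by congr (_ * (nat_of_bool _)%:R); apply/idP/idP; rewrite !inE /=; tauto.
rewrite (integral_dcomb call (measurable_enorm_sub_powR p)) big_allpairs_dep /= big_enum /= lte_fin.
under eq_bigr do rewrite big_enum /=.
have p0' : 0 < p by exact: lt_le_trans p1.
have ter i j : c i j * enorm (xs i - xs j) `^ p <= th * (enorm (xs i - xs j) `^ p).
  have [->|ij] := eqVneq i j; first by rewrite subrr enorm0 powR0 ?gt_eqF // !mulr0.
  rewrite ler_wpM2r ?powR_ge0 // /c (negbTE ij) add0r -mulrA.
  have h1 : ps (a ord0 i - b ord0 i) <= th by rewrite /th (bigD1 i) //= lerDl sumr_ge0.
  have h2 : ps (b ord0 j - a ord0 j) <= th by rewrite thE (bigD1 j) //= lerDl sumr_ge0.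
  have [t0|t0] := eqVneq th 0; first by rewrite t0 invr0 !mulr0.
  rewrite -[leRHS]mulr1; apply: ler_pM => //; first by rewrite divr_ge0.
  by rewrite ler_pdivrMr ?mul1r // lt_neqAle eq_sym t0.
apply: (@le_lt_trans _ _ (th * D)).
  apply: (@le_trans _ _ (th * \sum_i \sum_j enorm (xs i - xs j) `^ p)).
    rewrite mulr_sumr; apply: ler_sum => i _; rewrite mulr_sumr; apply: ler_sum => j _; exact: ter.
  by rewrite ler_wpM2l // /D lerDl.
have thN : th <= (N%:R + 1) * `|b - a|.
  apply: (@le_trans _ _ (\sum_(i < N) `|b - a|)).
    apply: ler_sum => i _; have := coord_le_norm (b - a) i; rewrite !mxE ler_norml => /andP[h1 h2].
    by rewrite /ps ge_max normr_ge0 andbT; lra.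
  by rewrite sumr_const card_ord -[leLHS]mulr_natl ler_wpM2r // lerDl.
move: bd; rewrite ltr_pdivlMr ?mulr_gt0 // => bd; apply: le_lt_trans bd.
rewrite mulrCA mulrC ler_pM2l //; lra.
Qed.

End FiniteSupport.

(** * Test functions on measures *)

Section Bump.
Context {R : realType} {d N : nat} (xs : 'I_N -> 'rV[R]_d).

Lemma separation : injective xs -> exists2 r : R, 0 < r & forall i j, i != j -> r <= `|xs j - xs i|.
Proof.
move=> ix; have [|r r0 hr] := @fin_delta R ('I_N * 'I_N)%type
    (fun ij r => ij.1 != ij.2 -> r <= `|xs ij.2 - xs ij.1|).
  move=> [i j] /=; have [->|ij] := eqVneq i j; first by exists 1.
  exists (`|xs j - xs i|) => [|d' /andP[_ ?]] //.
  by rewrite normr_gt0 subr_eq0; apply: contraNneq ij => /ix ->.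
by exists r => // i j; exact: (hr (i, j)).
Qed.

(** Lipschitz tents are regular enough: [isC2] asks for smoothness in the measure, and for mere
    continuity in the space variables. *)
Definition bump (r : R) i (x : 'rV[R]_d) : R := Num.max 0 (1 - `|x - xs i| / r).

Lemma bump01 r i x : 0 < r -> 0 <= bump r i x <= 1.
Proof.
move=> r0; rewrite /bump le_max lexx /= ge_max ler01 /= lerBlDr lerDl.
by rewrite divr_ge0 // ltW.
Qed.

Lemma bump_lipschitz_norm r i x y : 0 < r -> `|bump r i x - bump r i y| <= r^-1 * `|x - y|.
Proof.
move=> r0; have h z w : bump r i z <= bump r i w + r^-1 * `|z - w|.
  have ri : 0 <= r^-1 by rewrite invr_ge0 ltW.
  have zw0 : 0 <= r^-1 * `|z - w| by exact: mulr_ge0.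
  rewrite /bump ge_max; apply/andP; split; first by rewrite addr_ge0 // le_max lexx.
  have : 1 - `|w - xs i| / r <= Num.max 0 (1 - `|w - xs i| / r) by rewrite le_max lexx orbT.
  have : r^-1 * `|w - xs i| <= r^-1 * (`|z - w| + `|z - xs i|).
    by rewrite ler_wpM2l // (distrC z w) ler_distD.
  lra.
by rewrite ler_norml; have := h x y; have := h y x; rewrite (distrC y x); lra.
Qed.

Lemma bump_lipschitz r i x y : 0 < r -> `|bump r i x - bump r i y| <= r^-1 * enorm (x - y).
Proof.
move=> r0; apply: (le_trans (bump_lipschitz_norm _ _ _ r0)).
by rewrite ler_wpM2l ?norm_le_enorm // invr_ge0 ltW.
Qed.

Lemma bump_continuous r i : 0 < r -> continuous (bump r i).
Proof.
move=> r0; apply: (@continuous_lipschitz R 'rV[R]_d R (bump r i) id r^-1).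
  by move=> x y; exact: bump_lipschitz_norm.
by move=> x; exact: cvg_id.
Qed.

Lemma bump_point r i j : 0 < r -> (forall i j, i != j -> r <= `|xs j - xs i|) ->
  bump r i (xs j) = (i == j)%:R.
Proof.
move=> r0 hr; rewrite /bump; have [->|ij] := eqVneq i j.
  by rewrite subrr normr0 mul0r subr0 max_r.
by rewrite max_l // subr_le0 ler_pdivlMr // mul1r hr.
Qed.

End Bump.

Lemma FTC_from0 {R : realType} (F f : R -> R) (t : R) : 0 <= t ->
  (forall s : R, is_derive s 1 F (f s)) -> continuous f ->
  (\int[lebesgue_measure]_(s in `[0%R, t]) (f s)%:E = (F t - F 0)%:E)%E.
Proof.
move=> t0 dF cf; have cF : continuous F.
  by move=> s; apply: differentiable_continuous; apply/derivable1_diffP; have [] := dF s.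
move: t0; rewrite le_eqVlt => /predU1P[<-|t0].
  by rewrite set_itv1 integral_set1 subrr.
rewrite (@continuous_FTC2 R f F 0 t) //.
- exact: continuous_subspaceT.
- split.
  + by move=> x _; have [] := dF x.
  + by apply: cvg_at_right_filter; exact: cF.
  + by apply: cvg_at_left_filter; exact: cF.
- by move=> x _; rewrite derive1E; have [] := dF x.
Qed.

Lemma continuous_fst {R : realType} {V W : normedModType R} (f : V -> R) :
  continuous f -> continuous (fun z : V * W => f z.1).
Proof.
move=> cf; apply: (@continuous_lipschitz R (V * W)%type V (fun z => z.1) f 1) cf => x y.
by rewrite mul1r [leRHS]/Num.norm /= le_max lexx.
Qed.

Lemma continuous_snd {R : realType} {V W : normedModType R} (f : W -> R) :
  continuous f -> continuous (fun z : V * W => f z.2).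
Proof.
move=> cf; apply: (@continuous_lipschitz R (V * W)%type W (fun z => z.2) f 1) cf => x y.
by rewrite mul1r [leRHS]/Num.norm /= le_max lexx orbT.
Qed.

Section TestFunctions.
Context {R : realType} {d N : nat} (g : 'I_N -> 'rV[R]_d -> R) (L : R).
Hypotheses (g01 : forall i x, 0 <= g i x <= 1) (cg : forall i, continuous (g i)).
Hypotheses (L0 : 0 <= L) (lipg : forall i x y, `|g i x - g i y| <= L * enorm (x - y)).

Definition moments (nu : @meas R d) : 'rV[R]_N := \row_i fine (\int[nu]_x (g i x)%:E)%E.

Lemma g_norm i x : `|g i x| <= 1.
Proof. by have /andP[h0 h1] := g01 i x; rewrite ger0_norm. Qed.

Lemma g_integrable q (nu : @meas R d) i : Pq q nu -> nu.-integrable setT (EFin \o (g i : Rd R d -> R)).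
Proof. by move=> pnu; exact: (bounded_integral_fin pnu (measurable_continuous (@cg i)) (g_norm i)). Qed.

Lemma momentsE q nu i : Pq q nu -> ((moments nu) ord0 i)%:E = (\int[nu]_x (g i x)%:E)%E.
Proof.
by move=> pnu; rewrite mxE fineK //; exact: integrable_fin_num (g_integrable i pnu).
Qed.

Lemma moments_le1 q nu : Pq q nu -> `|moments nu| <= 1.
Proof.
move=> pnu; apply: norm_leP => // i; rewrite ger0_norm -lee_fin (momentsE i pnu).
  rewrite -(pnu.1) -[leRHS]mul1e -integral_cst //; apply: ge0_le_integral => //.
  - by move=> x _; rewrite lee_fin; case/andP: (g01 i x).
  - by apply/measurable_EFinP; exact: measurable_continuous.
  - by move=> x _; rewrite lee_fin; case/andP: (g01 i x).
by apply: integral_ge0 => x _; rewrite lee_fin; case/andP: (g01 i x).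
Qed.

Lemma integral_gsum q nu (c : 'I_N -> R) : Pq q nu ->
  (\int[nu]_x (\sum_i c i * g i x)%:E = (\sum_i c i * (moments nu) ord0 i)%:E)%E.
Proof.
move=> pnu; under eq_integral do rewrite -sumEFin.
have ic i : nu.-integrable setT (fun x => (c i * g i x)%:E).
  have := integrableZl measurableT (c i) (g_integrable i pnu).
  by apply: eq_integrable => // x _ /=; rewrite EFinM.
rewrite (@integral_sum _ _ _ nu setT measurableT 'I_N (fun i x => (c i * g i x)%:E)) //.
rewrite -sumEFin; apply: eq_bigr => i _; rewrite EFinM (momentsE i pnu).
under eq_integral do rewrite EFinM.
exact: (integralZl measurableT (g_integrable i pnu)).
Qed.

Lemma moments_mix q mu nu (t : R) : Pq q mu -> Pq q nu -> 0 <= t <= 1 ->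
  moments (mix t nu mu) = moments mu + t *: (moments nu - moments mu).
Proof.
move=> pmu pnu /andP[t0 t1]; apply/rowP => i; rewrite !mxE.
have mg : measurable_fun setT (EFin \o (g i : Rd R d -> R)).
  by apply/measurable_EFinP; exact: measurable_continuous.
have g0 (x : Rd R d) : [set: Rd R d] x -> (0 <= (EFin \o (g i : Rd R d -> R)) x)%E.
  by move=> _; rewrite lee_fin; case/andP: (g01 i x).
rewrite /mix (ge0_integral_measure_add _ _ measurableT g0 mg) !ge0_integral_mscale //.
have -> : (\int[nu]_x (EFin \o g i) x)%E = ((moments nu) ord0 i)%:E by rewrite (momentsE i pnu).
have -> : (\int[mu]_x (EFin \o g i) x)%E = ((moments mu) ord0 i)%:E by rewrite (momentsE i pmu).
rewrite -!EFinM -EFinD /= !mxE /= !max_l ?subr_ge0 //; ring.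
Qed.

Lemma moments_near q mu (e : R) : q = 0 \/ 1 <= q -> Pq q mu -> 0 < e ->
  Pnbhs q mu [set nu | `|moments nu - moments mu| < e].
Proof.
move=> hq pmu e0; have e2 : 0 < e / 2 by lra.
have h i : Pnbhs q mu [set nu : @meas R d | (`|\int[nu]_x (g i x)%:E - \int[mu]_x (g i x)%:E| < (e / 2)%:E)%E].
  by apply: (Pnbhs_test hq pmu L0 (g01 i) (lipg i) e2); exact: cg.
have : Pnbhs q mu [set nu : @meas R d | forall i, i \in enum 'I_N ->
    (`|\int[nu]_x (g i x)%:E - \int[mu]_x (g i x)%:E| < (e / 2)%:E)%E].
  elim: (enum 'I_N) => [|i s IH]; first by apply: Pnbhs_mono (PnbhsT q mu).
  apply: Pnbhs_mono (PnbhsI hq (h i) IH) => nu pnu [h1 h2] j.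
  by rewrite inE => /predU1P[->|/h2].
apply: Pnbhs_mono => nu pnu hnu /=; apply: (@le_lt_trans _ _ (e / 2)); last lra.
apply: norm_leP => [|i]; first exact: ltW.
have := hnu i (mem_enum _ _); rewrite -(momentsE i pnu) -(momentsE i pmu) -EFinB abse_EFin lte_fin.
by rewrite !mxE => /ltW.
Qed.

Variables (Psi : 'rV[R]_N -> R) (D1 : 'I_N -> 'rV[R]_N -> R) (D2 : 'I_N -> 'I_N -> 'rV[R]_N -> R).
Hypotheses (cD1 : forall i, continuous (D1 i)) (cD2 : forall i j, continuous (D2 i j)).
Hypothesis D2sym : forall i j w, D2 i j w = D2 j i w.
Hypothesis dPsi : forall (w v : 'rV[R]_N) (t : R),
  is_derive t 1 (fun t => Psi (w + t *: v)) (\sum_i D1 i (w + t *: v) * v ord0 i).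
Hypothesis dD1 : forall (w v : 'rV[R]_N) (t : R),
  is_derive t 1 (fun t => \sum_i D1 i (w + t *: v) * v ord0 i)
    (\sum_i \sum_j D2 i j (w + t *: v) * (v ord0 i * v ord0 j)).

(** Mixtures of measures become segments of moments, so both integral identities are the fundamental
    theorem of calculus for [Psi] along a line. The growth constants exist because moments stay in
    the unit ball, on which [D1] and [D2] are bounded. *)
Lemma cylinder_isC2 q : q = 0 \/ 1 <= q ->
  isC2 q (fun nu => Psi (moments nu))
    (fun x nu => \sum_i D1 i (moments nu) * g i x)
    (fun x y nu => \sum_i \sum_j D2 i j (moments nu) * (g i x * g j y)).
Proof.
move=> hq.
have dist1 (x y : 'rV[R]_d) (del : R) : enorm (y - x) < del -> `|y - x| < del.
  by apply: le_lt_trans; exact: norm_le_enorm.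
split; [|split; [|split; [|split; [|split]]]].
- move=> x mu pmu e e0.
  pose F (z : 'rV[R]_N * 'rV[R]_d) := \sum_i D1 i z.1 * g i z.2.
  have cF : continuous F.
    apply: continuous_sum => i _; apply: continuous_mul.
      exact: (continuous_fst (@cD1 i)).
    exact: (continuous_snd (@cg i)).
  have /continuous_eps/(_ (moments mu, x) e e0)[del del0 hdel] := cF.
  exists del; split => //; apply: Pnbhs_mono (moments_near hq pmu del0) => nu pnu /= hnu y /dist1 yx.
  by apply: (hdel (moments nu, y)); rewrite /Num.norm /= gt_max hnu.
- move=> x y mu pmu e e0.
  pose F (z : 'rV[R]_N * ('rV[R]_d * 'rV[R]_d)) := \sum_i \sum_j D2 i j z.1 * (g i z.2.1 * g j z.2.2).
  have cF : continuous F.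
    apply: continuous_sum => i _; apply: continuous_sum => j _; apply: continuous_mul.
      exact: (continuous_fst (@cD2 i j)).
    apply: continuous_mul.
      exact: (continuous_snd (continuous_fst (@cg i))).
    exact: (continuous_snd (continuous_snd (@cg j))).
  have /continuous_eps/(_ (moments mu, (x, y)) e e0)[del del0 hdel] := cF.
  exists del; split => //; apply: Pnbhs_mono (moments_near hq pmu del0) => nu pnu /= hnu x' y' /dist1 xx' /dist1 yy'.
  by apply: (hdel (moments nu, (x', y'))); rewrite /Num.norm /= gt_max hnu /= gt_max xx'.
- move=> x y mu _; rewrite exchange_big /=; apply: eq_bigr => i _; apply: eq_bigr => j _.
  by rewrite D2sym (mulrC (g j x)).
- move=> K [KP _].
  have /choice[M1 hM1] i : exists M, 0 <= M /\ forall w, `|w| <= 1 -> `|D1 i w| <= M.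
    by have [M M0 hM] := continuous_bounded 1 (@cD1 i); exists M.
  have /choice[M2 hM2] (ij : 'I_N * 'I_N) : exists M, 0 <= M /\ forall w, `|w| <= 1 -> `|D2 ij.1 ij.2 w| <= M.
    by have [M M0 hM] := continuous_bounded 1 (@cD2 ij.1 ij.2); exists M.
  have S1 : 0 <= \sum_i M1 i by apply: sumr_ge0 => i _; case: (hM1 i).
  have S2 : 0 <= \sum_i \sum_j M2 (i, j).
    by apply: sumr_ge0 => i _; apply: sumr_ge0 => j _; case: (hM2 (i, j)).
  exists (\sum_i M1 i + \sum_i \sum_j M2 (i, j)) => mu Kmu x y.
  have mu1 := moments_le1 (KP _ Kmu).
  have ex : 0 <= enorm x `^ q by exact: powR_ge0.
  have ey : 0 <= enorm y `^ q by exact: powR_ge0.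
  have b1 : `|\sum_i D1 i (moments mu) * g i x| <= \sum_i M1 i.
    apply: (le_trans (ler_norm_sum _ _ _)); apply: ler_sum => i _; rewrite normrM -[leRHS]mulr1.
    by apply: ler_pM => //; [case: (hM1 i) => _; apply|exact: g_norm].
  have b2 : `|\sum_i \sum_j D2 i j (moments mu) * (g i x * g j y)| <= \sum_i \sum_j M2 (i, j).
    apply: (le_trans (ler_norm_sum _ _ _)); apply: ler_sum => i _.
    apply: (le_trans (ler_norm_sum _ _ _)); apply: ler_sum => j _; rewrite normrM -[leRHS]mulr1.
    apply: ler_pM => //; first by case: (hM2 (i, j)) => _; apply.
    by rewrite normrM -[leRHS]mulr1 ler_pM ?g_norm.
  have SS : 0 <= \sum_i M1 i + \sum_i \sum_j M2 (i, j) by exact: addr_ge0.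
  split.
    apply: (le_trans b1); apply: (@le_trans _ _ (\sum_i M1 i + \sum_i \sum_j M2 (i, j))).
      by rewrite lerDl.
    by rewrite ler_peMr // lerDl.
  apply: (le_trans b2); apply: (@le_trans _ _ (\sum_i M1 i + \sum_i \sum_j M2 (i, j))).
    by rewrite lerDr.
  by rewrite ler_peMr // -addrA lerDl addr_ge0.
- move=> mu nu pmu pnu; set w := moments mu; set v := moments nu - moments mu.
  pose phi1 (t : R) := \sum_i D1 i (w + t *: v) * v ord0 i.
  transitivity (\int[lebesgue_measure]_(t in `[0%R, 1%R]) (phi1 t)%:E)%E.
    rewrite (FTC_from0 ler01 (dPsi w v)) ?scale1r ?scale0r ?addr0.
      by rewrite (_ : w + v = moments nu) // /v addrC subrK.
    apply: continuous_sum => i _; apply: continuous_mul; last exact: continuous_const.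
    exact: continuous_segment.
  apply: eq_integral.
  move=> t; rewrite inE /= in_itv /= => t01; rewrite /sint (moments_mix pmu pnu t01).
  rewrite (integral_gsum _ pmu) (integral_gsum _ pnu) -EFinB -sumrB; congr (_%:E).
  by apply: eq_bigr => i _; rewrite -mulrBr !mxE.
- move=> mu nu pmu pnu; set w := moments mu; set v := moments nu - moments mu.
  pose phi1 (t : R) := \sum_i D1 i (w + t *: v) * v ord0 i.
  have c1 : continuous phi1.
    apply: continuous_sum => i _; apply: continuous_mul; last exact: continuous_const.
    exact: continuous_segment.
  transitivity (\int[lebesgue_measure]_(t in `[0%R, 1%R]) (phi1 t - phi1 0)%:E)%E; last first.
    apply: eq_integral => t; rewrite inE /= in_itv /= => /andP[t0 t1].
    rewrite -(FTC_from0 t0 (dD1 w v)); last first.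
      apply: continuous_sum => i _; apply: continuous_sum => j _.
      by apply: continuous_mul; [exact: continuous_segment|exact: continuous_const].
    apply: eq_integral => s; rewrite inE /= in_itv /= => /andP[s0 st].
    have s01 : 0 <= s <= 1 by rewrite s0 (le_trans st).
    rewrite /sint2 (moments_mix pmu pnu s01) -/w -/v.
    have E x : sint nu mu (fun y => \sum_i \sum_j D2 i j (w + s *: v) * (g i x * g j y)) =
        (\sum_i (\sum_j D2 i j (w + s *: v) * v ord0 j) * g i x)%:E.
      rewrite /sint.
      have F y : \sum_i \sum_j D2 i j (w + s *: v) * (g i x * g j y) =
          \sum_j (\sum_i D2 i j (w + s *: v) * g i x) * g j y.
        rewrite exchange_big /=; apply: eq_bigr => j _; rewrite mulr_suml.
        by apply: eq_bigr => i _; rewrite mulrA.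
      under eq_integral do rewrite F.
      under [X in (_ - X)%E]eq_integral do rewrite F.
      rewrite (integral_gsum _ pmu) (integral_gsum _ pnu) -EFinB -sumrB; congr (_%:E).
      under [RHS]eq_bigr do rewrite mulr_suml.
      rewrite exchange_big /=; apply: eq_bigr => j _.
      by rewrite -mulrBr mulr_suml; apply: eq_bigr => i _; rewrite !mxE; ring.
    under eq_integral do rewrite E.
    under [X in (_ - X)%E]eq_integral do rewrite E.
    rewrite (integral_gsum _ pmu) (integral_gsum _ pnu) -EFinB -sumrB; congr (_%:E).
    apply: eq_bigr => i _; rewrite -mulrBr mulr_suml; apply: eq_bigr => j _.
    by rewrite !mxE; ring.
  pose F (t : R) := Psi (w + t *: v) - t * phi1 0.
  have dF (s : R) : is_derive s 1 F (phi1 s - phi1 0).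
    have d2 (k : R) : is_derive s 1 (fun t : R => t * k) k.
      by apply: is_derive_eq; rewrite /GRing.scale /= mulr0 mulr1 add0r.
    exact: (is_deriveB (dPsi w v s) (d2 (phi1 0))).
  rewrite (FTC_from0 ler01 dF); last by apply: continuous_sub => //; exact: continuous_const.
  rewrite /F /phi1 scale1r scale0r mul1r mul0r !addr0 subr0.
  rewrite /sint (integral_gsum _ pmu) (integral_gsum _ pnu) -!EFinB -sumrB; congr (_%:E).
  rewrite -/w (_ : w + v = moments nu); last by rewrite /v addrC subrK.
  have -> : \sum_i (D1 i w * moments nu ord0 i - D1 i w * w ord0 i) = \sum_i D1 i w * (moments nu - w) ord0 i.
    by apply: eq_bigr => i _; rewrite -mulrBr !mxE.
  ring.
Qed.

End TestFunctions.

(** * Polynomials of degree four in the moments *)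

Section QuarticTest.
Context {R : realType} {N : nat}.
Variables (f0 : R) (a p : 'rV[R]_N) (Y : 'M[R]_N) (K : R).
Hypothesis Ysym : forall i j, Y i j = Y j i.
Implicit Types w v : 'rV[R]_N.

(** The term in [K] provides domination away from [a] without changing the second-order expansion at
    [a]. *)
Definition quartic w := f0 + dot p (w - a) + 2^-1 * qf Y (w - a) + K * sq (w - a) ^+ 2.

Definition quartic1 i w := p ord0 i + \sum_j Y i j * (w - a) ord0 j + 4 * K * sq (w - a) * (w - a) ord0 i.

Definition quartic2 i j w := Y i j + K * (4 * sq (w - a) * (i == j)%:R + 8 * ((w - a) ord0 i * (w - a) ord0 j)).

Definition bil (x y : 'rV[R]_N) := \sum_i \sum_j Y i j * (x ord0 i * y ord0 j).

Lemma qf_bil w v (t : R) : qf Y (w + t *: v) = qf Y w + 2 * t * bil w v + t ^+ 2 * qf Y v.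
Proof.
have bC : bil v w = bil w v.
  by rewrite /bil exchange_big /=; apply: eq_bigr => i _; apply: eq_bigr => j _; rewrite Ysym (mulrC (v _ _)).
have -> : 2 * t * bil w v = t * bil w v + t * bil v w by rewrite bC; ring.
rewrite !qf_sum /bil !mulr_sumr -!big_split; apply: eq_bigr => i _.
rewrite !mulr_sumr -!big_split; apply: eq_bigr => j _.
by rewrite /= !mxE; ring.
Qed.

Lemma sq_line w v (t : R) : sq (w + t *: v) = sq w + 2 * t * dot w v + t ^+ 2 * sq v.
Proof. by rewrite !sqE !dotE (dotC v w); ring. Qed.

Lemma quartic1_sum w v (t : R) : \sum_i quartic1 i (w + t *: v) * v ord0 i =
  dot p v + bil (w - a) v + t * qf Y v +
    4 * K * (sq (w - a) + 2 * t * dot (w - a) v + t ^+ 2 * sq v) * (dot (w - a) v + t * sq v).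
Proof.
have E : w + t *: v - a = (w - a) + t *: v by rewrite addrAC.
rewrite /quartic1 E; move: (w - a) => x.
have -> : dot x v + t * sq v = dot (x + t *: v) v by rewrite sqE dotDl dotZl.
rewrite -sq_line.
have -> : bil x v = \sum_i (\sum_j Y i j * x ord0 j) * v ord0 i.
  rewrite /bil exchange_big /=; apply: eq_bigr => i _; rewrite mulr_suml; apply: eq_bigr => j _.
  by rewrite Ysym; ring.
have -> : t * qf Y v = \sum_i (\sum_j Y i j * (t * v ord0 j)) * v ord0 i.
  rewrite qf_sum mulr_sumr; apply: eq_bigr => i _; rewrite mulr_sumr mulr_suml; apply: eq_bigr => j _; ring.
rewrite !dot_sum mulr_sumr -!big_split /=; apply: eq_bigr => i _.
have -> : \sum_j Y i j * (x + t *: v) ord0 j = \sum_j Y i j * x ord0 j + \sum_j Y i j * (t * v ord0 j).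
  by rewrite -big_split; apply: eq_bigr => j _; rewrite !mxE mulrDr.
by ring.
Qed.

Lemma quartic_derive w v (t : R) :
  is_derive t 1 (fun t : R => quartic (w + t *: v)) (\sum_i quartic1 i (w + t *: v) * v ord0 i).
Proof.
rewrite quartic1_sum.
have -> : (fun t : R => quartic (w + t *: v)) = (fun t : R => f0 + (dot p (w - a) + t * dot p v) +
    2^-1 * (qf Y (w - a) + 2 * t * bil (w - a) v + t ^+ 2 * qf Y v) +
    K * (sq (w - a) + 2 * t * dot (w - a) v + t ^+ 2 * sq v) ^+ 2).
  apply/funext => s; rewrite /quartic (_ : w + s *: v - a = (w - a) + s *: v); last by rewrite addrAC.
  by rewrite qf_bil sq_line dotDr dotZr.
move: (dot p (w - a)) (dot p v) (qf Y (w - a)) (bil (w - a) v) (qf Y v) (sq (w - a)) (dot (w - a) v) (sq v).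
move=> c0 c1 c2 c3 c4 c5 c6 c7.
by apply: is_derive_eq; rewrite /GRing.scale /=; field.
Qed.

Lemma quartic1_derive w v (t : R) :
  is_derive t 1 (fun t : R => \sum_i quartic1 i (w + t *: v) * v ord0 i)
    (\sum_i \sum_j quartic2 i j (w + t *: v) * (v ord0 i * v ord0 j)).
Proof.
have -> : (fun t : R => \sum_i quartic1 i (w + t *: v) * v ord0 i) = (fun t : R =>
  dot p v + bil (w - a) v + t * qf Y v +
    4 * K * (sq (w - a) + 2 * t * dot (w - a) v + t ^+ 2 * sq v) * (dot (w - a) v + t * sq v)).
  by apply/funext => s; exact: quartic1_sum.
have -> : \sum_i \sum_j quartic2 i j (w + t *: v) * (v ord0 i * v ord0 j) =
    qf Y v + 4 * K * (sq (w - a) + 2 * t * dot (w - a) v + t ^+ 2 * sq v) * sq v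
      + 8 * K * (dot (w - a) v + t * sq v) ^+ 2.
  rewrite /quartic2 (_ : w + t *: v - a = (w - a) + t *: v); last by rewrite addrAC.
  rewrite -sq_line; move: (w - a) => x.
  have -> : dot x v + t * sq v = dot (x + t *: v) v by rewrite sqE dotDl dotZl.
  move: (x + t *: v) => y; rewrite -qf_rank1 -(qf1 v) !qf_sum; move: (sq y) => S.
  rewrite !mulr_sumr -!big_split; apply: eq_bigr => i _.
  rewrite !mulr_sumr -!big_split; apply: eq_bigr => j _ /=.
  by rewrite !mxE big_ord1 !mxE; case: (i == j) => /=; rewrite ?mulr1n ?mulr0n; ring.
move: (dot p v) (bil (w - a) v) (qf Y v) (sq (w - a)) (dot (w - a) v) (sq v).
move=> c1 c3 c4 c5 c6 c7.
by apply: is_derive_eq; rewrite /GRing.scale /=; ring.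
Qed.

Lemma continuous_sq_sub : continuous (fun w : 'rV[R]_N => sq (w - a)).
Proof.
apply: (@continuous_lipschitz R 'rV[R]_N 'rV[R]_N (fun w => w - a) (@sq R N) 1); last exact: sq_continuous.
by move=> x y; rewrite opprD opprK addrACA addNr addr0 mul1r.
Qed.

Lemma continuous_coord_sub i : continuous (fun w : 'rV[R]_N => (w - a) ord0 i).
Proof.
apply: (@continuous_lipschitz R 'rV[R]_N 'rV[R]_N (fun w => w - a) (fun w => w ord0 i) 1); last exact: continuous_coord.
by move=> x y; rewrite opprD opprK addrACA addNr addr0 mul1r.
Qed.

Lemma quartic_continuous : continuous quartic.
Proof.
have c (k : R) : continuous (fun _ : 'rV[R]_N => k) by exact: continuous_const.
have cd : continuous (fun w : 'rV[R]_N => dot p (w - a)).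
  under eq_fun do rewrite dot_sum.
  by apply: continuous_sum => i _; apply: continuous_mul => //; exact: continuous_coord_sub.
have cq : continuous (fun w : 'rV[R]_N => qf Y (w - a)).
  under eq_fun do rewrite qf_sum.
  apply: continuous_sum => i _; apply: continuous_sum => j _; apply: continuous_mul => //.
  by apply: continuous_mul; exact: continuous_coord_sub.
have cs := continuous_sq_sub.
apply: continuous_add; first apply: continuous_add; first apply: continuous_add => //.
  exact: continuous_mul.
by apply: continuous_mul => //; under eq_fun do rewrite expr2; exact: continuous_mul.
Qed.

Lemma quartic1_continuous i : continuous (quartic1 i).
Proof.
have c (k : R) : continuous (fun _ : 'rV[R]_N => k) by exact: continuous_const.
have cs := continuous_sq_sub; have cc := continuous_coord_sub.
apply: continuous_add; last by apply: continuous_mul => //; exact: continuous_mul.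
by apply: continuous_add => //; apply: continuous_sum => j _; exact: continuous_mul.
Qed.

Lemma quartic2_continuous i j : continuous (quartic2 i j).
Proof.
have c (k : R) : continuous (fun _ : 'rV[R]_N => k) by exact: continuous_const.
have cs := continuous_sq_sub; have cc := continuous_coord_sub.
apply: continuous_add => //; apply: continuous_mul => //; apply: continuous_add.
  by apply: continuous_mul => //; exact: continuous_mul.
by apply: continuous_mul => //; exact: continuous_mul.
Qed.

Lemma quartic2_sym i j w : quartic2 i j w = quartic2 j i w.
Proof. by rewrite /quartic2 Ysym eq_sym (mulrC ((w - a) ord0 i)). Qed.

Lemma quartic_center : quartic a = f0.
Proof.
rewrite /quartic subrr sq0 dotC dot0l expr0n /= mulr0 !addr0.
by rewrite -[in qf _ _](scale0r (0 : 'rV[R]_N)) qfZr expr0n /= mul0r mulr0 addr0.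
Qed.

Lemma quartic2_center i j : quartic2 i j a = Y i j.
Proof. by rewrite /quartic2 subrr sq0 !mxE !(mulr0, mul0r, addr0). Qed.

End QuarticTest.

(** * Supports, and limits restricted to smaller supports *)

Section Support.
Context {R : realType} {d : nat}.

Lemma rat_vector_dense (x : 'rV[R]_d) (e : R) : 0 < e ->
  exists c : 'rV[rat]_d, `|map_mx (@ratr R) c - x| < e.
Proof.
move=> e0.
have /choice[f hf] i : exists r : rat, `|ratr r - x ord0 i| <= e / 2.
  have [|r] := @rat_in_itvoo R (x ord0 i) (x ord0 i + e / 2); first lra.
  by rewrite in_itv /= => /andP[h1 h2]; exists r; rewrite ler_norml; lra.
exists (\row_i f i); apply: (@le_lt_trans _ _ (e / 2)); last lra.
by apply: norm_leP => [|i]; [lra|rewrite !mxE].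
Qed.

(** [A] is covered by the null balls with rational centre and radius, of which there are countably
    many. *)
Lemma supp_null (nu : @meas R d) (A : set 'rV[R]_d) : measurable (A : set (Rd R d)) ->
  supp nu `<=` ~` A -> nu A = 0%E.
Proof.
move=> mA hA; apply: measure_negligible => //.
pose B (n : nat) : set (Rd R d) := if unpickle n is Some (c, r) then
    let U := [set y : 'rV[R]_d | `|y - map_mx (@ratr R) (c : 'rV[rat]_d)| < ratr (r : rat)] in
    if `[< nu U = 0%E >] then U else set0 else set0.
have mB n : measurable (B n) /\ nu (B n) = 0%E.
  rewrite /B; case: (unpickle n) => [[c r]|]; last by split => //; rewrite measure0.
  case: asboolP => [h|_]; last by split => //; rewrite measure0.
  split => //; apply: measurable_open.
  rewrite (_ : [set y | _] = (fun y => `|y - map_mx ratr c|) @^-1` [set t | t < ratr r]) //.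
  apply: open_comp; last exact: open_lt.
  move=> y _; apply: (@continuous_lipschitz R 'rV[R]_d R (fun y => `|y - map_mx ratr c|) id 1); last by move=> ?; exact: cvg_id.
  move=> y1 y2; rewrite mul1r; apply: le_trans (ler_dist_dist _ _) _.
  by rewrite opprB addrA subrK.
apply: (@negligibleS _ _ _ _ (\bigcup_n B n)); last first.
  by apply: negligible_bigcup => n; have [m0 n0] := mB n; exists (B n); split.
move=> x Ax.
have [U [oU Ux nuU]] : exists U : set 'rV[R]_d, [/\ open U, U x & nu U = 0%E].
  apply: contrapT => h; apply: (hA x) => // U oU Ux; rewrite lt_neqAle measure_ge0 andbT.
  by apply/eqP => /esym nuU; apply: h; exists U.
have : \forall y \near x, U y by exact: open_nbhs_nbhs.
move=> /near_dist[e e0 he].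
have e4 : 0 < e / 4 by lra.
have [c hc] := rat_vector_dense x e4.
(* The radius exceeds the distance from [x] to the centre, yet the ball stays inside [U]. *)
have [|r] := @rat_in_itvoo R (e / 4) (e / 2); first lra.
rewrite in_itv /= => /andP[r1 r2].
exists (pickle (c, r)) => //; rewrite /B pickleK /=.
have oV : open [set y : 'rV[R]_d | `|y - map_mx ratr c| < ratr r].
  rewrite (_ : [set y | _] = (fun y => `|y - map_mx ratr c|) @^-1` [set t | t < ratr r]) //.
  apply: open_comp; last exact: open_lt.
  move=> y _; apply: (@continuous_lipschitz R 'rV[R]_d R (fun y => `|y - map_mx ratr c|) id 1); last by move=> ?; exact: cvg_id.
  move=> y1 y2; rewrite mul1r; apply: le_trans (ler_dist_dist _ _) _.
  by rewrite opprB addrA subrK.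
case: asboolP => [_|]; first by rewrite /= distrC; exact: lt_trans hc r1.
case; apply/eqP; rewrite eq_le measure_ge0 andbT -nuU.
apply: le_measure; rewrite ?inE; [exact: measurable_open|exact: measurable_open|].
move=> y /= yc; apply: he; apply: (le_lt_trans (ler_distD (map_mx ratr c) _ _)); lra.
Qed.

(** The complement of the atoms is open and null for the atomic measure, hence it misses the support
    of [nu]. *)
Lemma preceq_supported {N : nat} (xs : 'I_N -> 'rV[R]_d) p a (nu : @meas R d) :
  weights a -> Pq p nu -> preceq nu (atm xs a) -> supported_in xs nu.
Proof.
move=> wa pnu h; split; first by case: pnu.
have cl : closed (range xs).
  have -> : range xs = \big[setU/set0]_(i < N) [set xs i].
    apply/seteqP; split => [_ [i _ <-]|y /bigsetU_ordP[i ->]]; last by exists i.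
    by apply/bigsetU_ordP; exists i.
  apply: closed_bigsetU => i _; apply: accessible_closed_set1.
  by apply: hausdorff_accessible; exact: norm_hausdorff.
have op : open (~` range xs) by exact: closed_openC.
apply: supp_null; first exact: measurable_open.
move=> x /h hx nx; have := hx _ op nx.
by rewrite (atm_supported xs wa).2 ltxx.
Qed.

End Support.

Section LimitsInP.
Context {R : realType} {d : nat} (p : R).
Hypothesis hp : p = 0 \/ 1 <= p.
Implicit Types (mu nu : @meas R d).

Lemma eqm_cont (u : @meas R d -> R) mu nu : contP p u -> Pq p mu -> eqm mu nu -> u nu = u mu.
Proof.
move=> cu pmu h; apply/eqP; rewrite -subr_eq0 -normr_eq0 eq_le normr_ge0 andbT.
apply/ler_addgt0Pr => e e0; rewrite add0r; apply: ltW.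
exact: (Pnbhs_eqm pmu h (cu mu pmu e e0)).
Qed.

Lemma nbhsD_self mu A : Pq p mu -> nbhsD p mu A -> A mu.
Proof. by move=> pmu [B [hB hA]]; apply: hA => //; exact: (Pnbhs_eqm pmu _ hB). Qed.

Lemma limsupF_cont (u : @meas R d -> R) mu : contP p u -> Pq p mu ->
  limsupF (nbhsD p mu) (fun nu => (u nu)%:E) = (u mu)%:E.
Proof.
move=> cu pmu; apply/eqP; rewrite eq_le; apply/andP; split; last first.
  apply: le_ereal_inf_tmp => _ [A hA <-]; apply: ereal_sup_ubound; exists mu => //.
  exact: nbhsD_self hA.
apply/lee_addgt0Pr => e e0; pose A := [set nu | `|u nu - u mu| < e].
apply: (@le_trans _ _ (ereal_sup [set (u nu)%:E | nu in A])).
  by apply: ereal_inf_lbound; exists A => //; exists A; split => //; exact: cu.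
apply: ge_ereal_sup => _ [nu /= hnu <-]; rewrite -EFinD lee_fin.
by move: hnu; rewrite /A /= ltr_norml; lra.
Qed.

Lemma liminfF_cont (u : @meas R d -> R) mu : contP p u -> Pq p mu ->
  liminfF (nbhsD p mu) (fun nu => (u nu)%:E) = (u mu)%:E.
Proof.
move=> cu pmu; apply/eqP; rewrite eq_le; apply/andP; split.
  apply: ge_ereal_sup => _ [A hA <-]; apply: ereal_inf_lbound; exists mu => //.
  exact: nbhsD_self hA.
apply/lee_subgt0Pr => e e0; pose A := [set nu | `|u nu - u mu| < e].
apply: (@le_trans _ _ (ereal_inf [set (u nu)%:E | nu in A])).
  apply: le_ereal_inf_tmp => _ [nu /= hnu <-]; rewrite -EFinB lee_fin.
  by move: hnu; rewrite /A /= ltr_norml; lra.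
by apply: ereal_sup_ubound; exists A => //; exists A; split => //; exact: cu.
Qed.

Lemma liminfF_le0 (F : set_system (@meas R d)) h (A : set (@meas R d)) (e : R) :
  (liminfF F h <= 0)%E -> F A -> 0 < e -> exists2 nu, A nu & (h nu < e%:E)%E.
Proof.
move=> l0 FA e0; have : (ereal_inf (h @` A) < e%:E)%E.
  apply: (@le_lt_trans _ _ 0%E); last by rewrite lte_fin.
  by apply: le_trans l0; apply: ereal_sup_ubound; exists A.
by move=> /ereal_inf_lt[_ [nu Anu <-] ?]; exists nu.
Qed.

Lemma limsupF_ge0 (F : set_system (@meas R d)) h (A : set (@meas R d)) (e : R) :
  (0 <= limsupF F h)%E -> F A -> 0 < e -> exists2 nu, A nu & ((- e)%:E < h nu)%E.
Proof.
move=> l0 FA e0; have : ((- e)%:E < ereal_sup (h @` A))%E.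
  apply: (@lt_le_trans _ _ 0%E); first by rewrite lte_fin oppr_lt0.
  by apply: (le_trans l0); apply: ereal_inf_lbound; exists A.
by move=> /ereal_sup_gt[_ [nu Anu <-] ?]; exists nu.
Qed.

End LimitsInP.

(** * The operator [L] on functions of the moments *)

Section CylinderGenerator.
Context {R : realType} {d N : nat} (xs : 'I_N -> 'rV[R]_d) (g : 'I_N -> 'rV[R]_d -> R).
Hypotheses (cg : forall i, continuous (g i)) (gx : forall i j, g i (xs j) = (i == j)%:R).

Definition bary (b r : 'rV[R]_N) : R := \sum_i b ord0 i * r ord0 i.

(* The weights of the signed measure [sigma] in the definition of [Lop]. *)
Definition sig (b r : 'rV[R]_N) : 'rV[R]_N := \row_i ((r ord0 i - bary b r) * b ord0 i).

Lemma moments_atm b : weights b -> moments g (atm xs b) = b.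
Proof.
move=> wb; apply/rowP => i; rewrite mxE integral_atm //; last exact: (measurable_continuous (@cg i)).
rewrite /= (bigD1 i) //= gx eqxx mulr1 big1 ?addr0 // => j ji.
by rewrite gx eq_sym (negbTE ji) mulr0.
Qed.

(** Integrals against measures on the atoms are finite sums, so both integrability conditions of
    [Lop] hold, and the bumps select the entries [D2 k l b]. *)
Lemma Lop_atm (D2 : 'I_N -> 'I_N -> 'rV[R]_N -> R) (b : 'rV[R]_N) (nu : @meas R d) (rho : 'rV[R]_d -> R) :
  weights b -> eqm nu (atm xs b) -> measurable_fun setT (rho : Rd R d -> R) ->
  Lop (fun x y nu => \sum_i \sum_j D2 i j (moments g nu) * (g i x * g j y)) nu rho =
  (2^-1 * qf (\matrix_(i, j) D2 i j b) (sig b (\row_i rho (xs i))))%:E.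
Proof.
move=> wb nub mrho.
have int f : measurable_fun setT (f : Rd R d -> R) ->
    (\int[nu]_x (f x)%:E = (\sum_i b ord0 i * f (xs i))%:E)%E.
  by move=> mf; rewrite (eqm_integral _ nub) integral_atm.
have mnu : moments g nu = b.
  rewrite -[RHS](moments_atm wb); apply/rowP => i; rewrite !mxE.
  by rewrite (eqm_integral _ nub).
rewrite /Lop mnu int //=.
have -> : \sum_i b ord0 i * rho (xs i) = bary b (\row_i rho (xs i)).
  by apply: eq_bigr => i _; rewrite mxE.
set m := bary _ _.
have mg i : measurable_fun [set: Rd R d] (g i : Rd R d -> R) by exact: (measurable_continuous (@cg i)).
pose F (x y : 'rV[R]_d) := \sum_i \sum_j D2 i j b * (g i x * g j y).
have mF x : measurable_fun [set: Rd R d] (F x : Rd R d -> R).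
  by apply: measurable_sum => i; apply: measurable_sum => j; do 2 apply: measurable_funM => //.
have mF' y : measurable_fun [set: Rd R d] (F^~ y : Rd R d -> R).
  by apply: measurable_sum => i; apply: measurable_sum => j; do 2 apply: measurable_funM => //.
have mr : measurable_fun [set: Rd R d] ((fun x => rho x - m) : Rd R d -> R) by exact: measurable_funB.
have mabs f : measurable_fun [set: Rd R d] (f : Rd R d -> R) -> measurable_fun [set: Rd R d] (fun x => `|f x|).
  by move=> mf; exact: (measurableT_comp (@normr_measurable R setT) mf).
rewrite asboolT; last first.
  split; first by rewrite int ?ltry //; exact: mabs.
  have E x : (\int[nu]_y (`|F x y| * `|rho x - m| * `|rho y - m|)%:E)%E =
      (\sum_k b ord0 k * (`|F x (xs k)| * `|rho x - m| * `|rho (xs k) - m|))%:E.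
    by rewrite int //; apply: measurable_funM; [apply: measurable_funM => //|]; exact: mabs.
  under eq_integral do rewrite E.
  rewrite int ?ltry //; apply: measurable_sum => k; apply: measurable_funM => //.
  by apply: measurable_funM => //; apply: measurable_funM; apply: mabs.
have E x : (\int[nu]_y (F x y * (rho x - m) * (rho y - m))%:E)%E =
    (\sum_k b ord0 k * (F x (xs k) * (rho x - m) * (rho (xs k) - m)))%:E.
  by rewrite int //; apply: measurable_funM => //; apply: measurable_funM.
under eq_integral do rewrite E.
rewrite int; last first.
  apply: measurable_sum => k; apply: measurable_funM => //.
  by apply: measurable_funM => //; apply: measurable_funM.
rewrite -EFinM; congr (_ * _)%:E; rewrite qf_sum; apply: eq_bigr => k _.
rewrite mulr_sumr; apply: eq_bigr => l _.
have -> : F (xs k) (xs l) = D2 k l b.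
  rewrite /F (bigD1 k) //= [X in X + _](bigD1 l) //= !gx !eqxx !mulr1 big1 ?addr0 => [|j jl].
    rewrite big1 ?addr0 // => i ik; rewrite big1 // => j _.
    by rewrite gx (negbTE ik) mul0r mulr0.
  by rewrite gx (negbTE jl) !mulr0.
by rewrite !mxE -/m; ring.
Qed.

End CylinderGenerator.

(** * Viscosity inequalities on the simplex *)

Section Simplex.
Context {R : realType} {N : nat}.
Implicit Types a b : 'rV[R]_N.

Lemma weights_norm b : weights b -> `|b| <= 1.
Proof.
move=> [b0 b1]; apply: norm_leP => // i; rewrite ger0_norm // -b1 (bigD1 i) //= lerDl.
by apply: sumr_ge0.
Qed.

Lemma simplex_compact : compact [set b : 'rV[R]_N | weights b].
Proof.
apply: bounded_closed_compact.
  by exists 1; split; [exact: num_real|move=> x x1 b /weights_norm /le_trans; apply; exact: ltW].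
have -> : [set b : 'rV[R]_N | weights b] =
    (\bigcap_(i in [set: 'I_N]) [set b : 'rV[R]_N | 0 <= b ord0 i]) `&` [set b : 'rV[R]_N | \sum_i b ord0 i = 1].
  by apply/seteqP; split => b; [move=> [b0 b1]; split => // i _ /=; exact: b0|move=> [b0 b1]; split => // i; exact: (b0 i I)].
apply: closedI.
  apply: closed_bigI => i _; apply: (@closed_comp _ _ (fun b : 'rV[R]_N => b ord0 i) [set x | 0 <= x]); last exact: closed_ge.
  by move=> b _; exact: continuous_coord.
apply: (@closed_comp _ _ (fun b : 'rV[R]_N => \sum_i b ord0 i) [set x | x = 1]); last exact: closed_eq.
by move=> b _; apply: continuous_sum => i _; exact: continuous_coord.
Qed.

Definition simplex_cont (u : 'rV[R]_N -> R) := forall a e, weights a -> 0 < e ->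
  exists2 del, 0 < del & forall b, weights b -> `|b - a| < del -> `|u b - u a| < e.

Lemma continuous_simplex_cont u : continuous u -> simplex_cont u.
Proof.
by move=> cu a e wa e0; have [del del0 h] := proj1 (continuous_eps u) cu a e e0; exists del => // b _; exact: h.
Qed.

Lemma simplex_bounded u : simplex_cont u -> exists2 M, 0 <= M & forall b, weights b -> `|u b| <= M.
Proof.
move=> cu; have [|e e0 he] := @compact_unif R 'rV[R]_N _ (fun e b => weights b -> `|u b| <= e^-1) simplex_compact.
  move=> z wz; have [del del0 hdel] := cu z 1 wz ltr01.
  have u1 : 0 < `|u z| + 1 by rewrite ltr_wpDl.
  exists (Num.min del (`|u z| + 1)^-1); first by rewrite lt_min del0 invr_gt0.
  move=> e b; rewrite !lt_min => /andP[e0 /andP[_ e1]] /andP[bd _] wb.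
  apply: (@le_trans _ _ (`|u z| + 1)); last first.
    by rewrite -[leLHS]invrK lef_pV2 ?posrE ?invr_gt0 // ltW.
  rewrite -[u b](subrK (u z)) addrC; apply: (le_trans (ler_normD _ _)).
  by rewrite lerD2l; apply: ltW; exact: hdel.
exists e^-1; first by rewrite invr_ge0 ltW.
by move=> b wb; apply: he.
Qed.

Definition simplex_upper_jet (u : 'rV[R]_N -> R) a P Y := forall e, 0 < e ->
  exists2 del, 0 < del & forall b, weights b -> `|b - a| < del ->
    u b <= u a + dot P (b - a) + 2^-1 * qf Y (b - a) + e * sq (b - a).

(** Within [del] of [a] the jet with [e] added to its quadratic part dominates. Farther away the
    quartic term is at least [2 * M + M1], with [M] bounding [u] and [M1] the quadratic
    polynomial. *)
Lemma quartic_dominates (u : 'rV[R]_N -> R) a P Y e : weights a -> simplex_cont u ->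
  simplex_upper_jet u a P Y -> 0 < e ->
  exists K, forall b, weights b -> u b <= quartic (u a) a P (Y + (2 * e)%:M) K b.
Proof.
move=> wa cu jet e0; have [M M0 hM] := simplex_bounded cu.
have [del del0 hdel] := jet e e0.
have [|M1 M10 hM1] := @simplex_bounded (quartic 0 a P (Y + (2 * e)%:M) 0).
  by apply: continuous_simplex_cont; exact: quartic_continuous.
exists ((2 * M + M1) / del ^+ 4) => b wb.
have d4 : 0 < del ^+ 4 by exact: exprn_gt0.
have K0 : 0 <= (2 * M + M1) / del ^+ 4 by rewrite divr_ge0 ?(ltW d4) // addr_ge0 // mulr_ge0.
rewrite /quartic; have [bd|bd] := ltP `|b - a| del.
  apply: (le_trans (hdel b wb bd)); rewrite qfDl -scalemx1 qfZl qf1.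
  by have : 0 <= (2 * M + M1) / del ^+ 4 * sq (b - a) ^+ 2 by [rewrite mulr_ge0 // sqr_ge0]; lra.
have := hM1 b wb; rewrite /quartic add0r mul0r addr0 ler_norml => /andP[h1 _].
have h2 : del ^+ 4 <= sq (b - a) ^+ 2.
  rewrite -[4%N]/(2 * 2)%N exprM ler_pXn2r ?nnegrE ?sq_ge0 ?sqr_ge0 //.
  apply: le_trans (norm_sq_le (b - a)); rewrite ler_pXn2r ?nnegrE // ltW //.
have h3 : 2 * M + M1 <= (2 * M + M1) / del ^+ 4 * sq (b - a) ^+ 2.
  by rewrite -[leLHS](divfK (lt0r_neq0 d4)) ler_wpM2l.
have := hM b wb; have := hM a wa; rewrite !ler_norml; lra.
Qed.

End Simplex.

Section SimplexGenerator.
Context {R : realType} {N : nat}.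
Local Notation V := 'rV[R]_N.

(** Only differences of values of [rho] matter, which is why bounds on [rho x - rho 0] are the
    natural assumption. *)
Lemma sig_shift (b r : V) (k : R) : weights b -> sig b (\row_i (r ord0 i - k)) = sig b r.
Proof.
move=> [_ b1]; apply/rowP => i; rewrite !mxE; congr (_ * _).
have -> : bary b (\row_i (r ord0 i - k)) = bary b r - k.
  rewrite /bary; under eq_bigr do rewrite mxE mulrBr.
  by rewrite sumrB -mulr_suml b1 mul1r.
by ring.
Qed.

Lemma sig_continuous i : continuous (fun z : V * V => sig z.1 z.2 ord0 i).
Proof.
have -> : (fun z : V * V => sig z.1 z.2 ord0 i) =
   (fun z : V * V => (z.2 ord0 i - \sum_j z.1 ord0 j * z.2 ord0 j) * z.1 ord0 i).
  by apply/funext => z; rewrite mxE.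
have c1 j : continuous (fun z : V * V => z.1 ord0 j).
  by apply: (@continuous_fst R V V (fun z => z ord0 j)); exact: continuous_coord.
have c2 j : continuous (fun z : V * V => z.2 ord0 j).
  by apply: (@continuous_snd R V V (fun z => z ord0 j)); exact: continuous_coord.
apply: continuous_mul; last exact: c1.
apply: continuous_sub; first exact: c2.
by apply: continuous_sum => j _; apply: continuous_mul; [exact: c1|exact: c2].
Qed.

Lemma qf_sig_continuous (D : 'I_N -> 'I_N -> V -> R) : (forall i j, continuous (D i j)) ->
  continuous (fun z : V * V => qf (\matrix_(i, j) D i j z.1) (sig z.1 z.2)).
Proof.
move=> cD; have -> : (fun z : V * V => qf (\matrix_(i, j) D i j z.1) (sig z.1 z.2)) =
   (fun z : V * V => \sum_i \sum_j D i j z.1 * (sig z.1 z.2 ord0 i * sig z.1 z.2 ord0 j)).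
  apply/funext => z; rewrite qf_sum; apply: eq_bigr => i _; apply: eq_bigr => j _.
  by rewrite mxE mulrA.
apply: continuous_sum => i _; apply: continuous_sum => j _; apply: continuous_mul.
  exact: (@continuous_fst R V V (D i j)).
by apply: continuous_mul; exact: sig_continuous.
Qed.

Lemma continuous_unif_param (F : V * V -> R) (a : V) (M e : R) : continuous F -> 0 < e ->
  exists2 del, 0 < del & forall b r, `|r| <= M -> `|b - a| < del -> `|F (b, r) - F (a, r)| < e.
Proof.
move=> cF e0; have [M0|M0] := ltP M 0.
  by exists 1 => // b r rM _; have := le_lt_trans (le_trans (normr_ge0 _) rM) M0; rewrite ltxx.
have e2 : 0 < e / 2 by rewrite divr_gt0.
have [|del del0 hdel] := @compact_unif R V [set r | `|r| <= M]
   (fun del r => forall b, `|b - a| < del -> `|F (b, r) - F (a, r)| < e) (@ball_compact R N M).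
  move=> r _; have [d d0 hd] := proj1 (continuous_eps F) cF (a, r) _ e2.
  have near (b r' : V) : `|b - a| < d -> `|r' - r| < d -> `|F (b, r') - F (a, r)| < e / 2.
    by move=> h1 h2; apply: hd; rewrite prod_normE gt_max h1.
  exists d => // t r' /andP[_ td] rd b bt.
  have h1 := near b r' (lt_trans bt td) rd.
  have h2 : `|F (a, r') - F (a, r)| < e / 2 by apply: near; rewrite ?subrr ?normr0.
  by move: h1 h2; rewrite !ltr_norml => /andP[? ?] /andP[? ?]; apply/andP; split; lra.
by exists del => // b r rM; exact: hdel.
Qed.

End SimplexGenerator.

(** * From viscosity inequalities on measures to inequalities for jets in the weights *)

Section SimplexJets.
Context {R : realType} {d N : nat} {H : Type}.
Local Notation V := 'rV[R]_N.
Variables (p q beta : R) (ev : H -> 'rV[R]_d -> R) (c : @meas R d -> H -> \bar R).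
Variable xs : 'I_N -> 'rV[R]_d.
Hypotheses (xs_inj : injective xs) (hp : p = 0 \/ 1 <= p) (hq : q = 0 \/ 1 <= q).
Hypothesis mev : forall rho, measurable_fun setT (ev rho : Rd R d -> R).
Hypothesis cN : forall mu rho, Pq p mu -> c mu rho != -oo%E.
Hypothesis cC : forall mu : @meas R d, supported_in xs mu -> forall e : R, 0 < e ->
  Pnbhs p mu [set nu | supported_in xs nu -> forall rho,
    (c nu rho <= c mu rho + e%:E)%E /\ (c mu rho <= c nu rho + e%:E)%E].

Definition offsets (rho : H) : V := \row_i (ev rho (xs i) - ev rho 0).

Lemma atm_simplex_cont (u : @meas R d -> R) : contP p u -> simplex_cont (fun b : V => u (atm xs b)).
Proof.
move=> cu a e wa e0.
by have [del del0 h] := Pnbhs_atm hp wa (cu _ (atm_Pq xs p wa) e e0); exists del.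
Qed.

(* The test functions are polynomials of degree four in the integrals of bumps at
   the atoms: on measures supported there, [L] only sees the weights and the
   offsets of [rho]. *)
Lemma quartic_test (f0 M e : R) (a P : V) (Y : 'M[R]_N) (K : R) :
  (forall i j, Y i j = Y j i) -> weights a -> 0 < e ->
  exists f Df D2f (l : @meas R d -> H -> R), [/\ isC2 q f Df D2f,
    f (atm xs a) = f0,
    forall b nu, weights b -> eqm nu (atm xs b) -> f nu = quartic f0 a P Y K b /\
      forall rho, Lop D2f nu (ev rho) = (l nu rho)%:E &
    nbhsD p (atm xs a) [set nu | [/\ Pq p nu,
      forall rho, (c nu rho <= c (atm xs a) rho + e%:E)%E /\ (c (atm xs a) rho <= c nu rho + e%:E)%E,
      exists b, weights b /\ eqm nu (atm xs b) &
      forall rho, `|offsets rho| <= M ->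
        `|beta * f nu - l nu rho - (beta * f0 - 2^-1 * qf Y (sig a (offsets rho)))| < e]]].
Proof.
move=> Ysym wa e0; have [r r0 sep] := separation xs_inj.
pose g i := bump xs r i.
have g01 i x : 0 <= g i x <= 1 by exact: bump01.
have cg i : continuous (g i) by exact: bump_continuous.
have L0 : 0 <= r^-1 by rewrite invr_ge0 ltW.
have gx i j : g i (xs j) = (i == j)%:R by exact: bump_point.
have lipg i x y : `|g i x - g i y| <= r^-1 * enorm (x - y) by exact: bump_lipschitz.
have mom b nu : weights b -> eqm nu (atm xs b) -> moments g nu = b.
  move=> wb enu; rewrite -[RHS](moments_atm cg gx wb); apply/rowP => i; rewrite !mxE.
  by rewrite (eqm_integral _ enu).
have eqm_refl : eqm (atm xs a) (atm xs a) by [].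
pose G b := \matrix_(i, j) quartic2 a Y K i j b.
pose F (z : V * V) := beta * quartic f0 a P Y K z.1 - 2^-1 * qf (G z.1) (sig z.1 z.2).
have cF : continuous F.
  apply: continuous_sub; apply: continuous_mul; try exact: continuous_const.
    by apply: (@continuous_fst R V V); exact: quartic_continuous.
  by apply: qf_sig_continuous => i j; exact: quartic2_continuous.
have Fa rr : F (a, rr) = beta * f0 - 2^-1 * qf Y (sig a rr).
  rewrite /F /= quartic_center; have -> // : G a = Y.
  by apply/matrixP => i j; rewrite mxE quartic2_center.
have [del del0 hdel] := continuous_unif_param a M cF e0.
exists (fun nu => quartic f0 a P Y K (moments g nu)).
exists (fun x nu => \sum_i quartic1 a P Y K i (moments g nu) * g i x).
exists (fun x y nu => \sum_i \sum_j quartic2 a Y K i j (moments g nu) * (g i x * g j y)).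
exists (fun nu rho => 2^-1 * qf (G (moments g nu)) (sig (moments g nu) (offsets rho))).
split.
- apply: (@cylinder_isC2 R d N g (r^-1)) => //.
  + by move=> i; exact: quartic1_continuous.
  + by move=> i j; exact: quartic2_continuous.
  + by move=> i j w; exact: quartic2_sym.
  + by move=> w v t; exact: quartic_derive.
  + by move=> w v t; exact: quartic1_derive.
- by rewrite (mom a (atm xs a)) // quartic_center.
- move=> b nu wb enu; rewrite (mom b nu) //; split=> // rho.
  rewrite (@Lop_atm R d N xs g cg gx (quartic2 a Y K) b nu (ev rho) wb enu (mev rho)).
  congr ((_ * qf _ _)%:E); rewrite -(sig_shift _ (ev rho 0) wb); congr sig.
  by apply/rowP => i; rewrite !mxE.
have near := moments_near g01 cg L0 lipg hp (atm_Pq xs p wa) del0.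
exists (fun nu => Pq p nu /\ ([set nu | `|moments g nu - moments g (atm xs a)| < del] `&`
  [set nu | supported_in xs nu -> forall rho, (c nu rho <= c (atm xs a) rho + e%:E)%E /\
    (c (atm xs a) rho <= c nu rho + e%:E)%E]) nu); split.
  by apply: Pnbhs_mono (PnbhsI hp near (cC (atm_supported xs wa) e0)).
move=> nu [pnu [mnu cost]] le; have sup := preceq_supported wa pnu le.
split=> //; [exact: cost|exact: supported_atm|move=> rho rM].
rewrite -Fa; apply: hdel => //.
by move: mnu; rewrite /= (mom a (atm xs a)).
Qed.

(** The lower limit provides a measure [nu] near [atm xs a] at which the Hamiltonian is below
    [eps / 4]. Returning to [atm xs a] costs one quarter of [eps] for the cost and one for the test
    function, and the last quarter pays for the enlargement of [Y]. *)
Lemma simplex_sub_jet (u : @meas R d -> R) (a P : V) (Y : 'M[R]_N) : contP p u ->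
  subsolution p q beta c ev (fun mu => (u mu)%:E) -> (forall i j, Y i j = Y j i) -> weights a ->
  simplex_upper_jet (fun b : V => u (atm xs b)) a P Y ->
  forall rho r, c (atm xs a) rho = r%:E ->
    beta * u (atm xs a) <= r + 2^-1 * qf Y (sig a (offsets rho)).
Proof.
move=> cu usub Ysym wa jet rho r cr; apply/ler_addgt0Pr => eps eps0.
have Pa := atm_Pq xs p wa.
have e40 : 0 < eps / 4 by rewrite divr_gt0.
set rr := offsets rho.
have s0 : 0 < 1 + sq (sig a rr) by rewrite ltr_pwDl // sq_ge0.
have [e e0 he] : exists2 e, 0 < e & e * sq (sig a rr) <= eps / 4.
  exists (eps / 4 / (1 + sq (sig a rr))); first by rewrite divr_gt0.
  by rewrite mulrAC ler_pdivrMr // ler_wpM2l ?(ltW e40) // lerDr.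
pose Y' := Y + (2 * e)%:M.
have Y'sym i j : Y' i j = Y' j i by rewrite !mxE Ysym eq_sym.
have [K dom] := quartic_dominates wa (atm_simplex_cont cu) jet e0.
have [f [Df [D2f [l [fC2 fa fE hA]]]]] := quartic_test (u (atm xs a)) `|rr| P K Y'sym wa e40.
have le0 : (liminfF (nbhsD p (atm xs a)) (Ham beta c ev f D2f) <= 0)%E.
  apply: (usub _ Pa f Df D2f fC2); first by rewrite fa limsupF_cont.
  move=> nu pnu le; have [b [wb enu]] := supported_atm xs_inj (preceq_supported wa pnu le).
  have eun : eqm (atm xs b) nu by move=> A mA; rewrite enu.
  rewrite lee_fin (proj1 (fE b nu wb enu)) (eqm_cont cu (atm_Pq xs p wb) eun).
  exact: dom.
have [nu [pnu cost [b [wb enu]] near] hH] := liminfF_le0 le0 hA e40.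
have [fb Lb] := fE b nu wb enu.
have [c1 _] := cost rho.
have [r' cr' r'r] : exists2 r', c nu rho = r'%:E & r' <= r + eps / 4.
  move: c1 (cN rho pnu); rewrite cr; case: (c nu rho) => [r'||] //.
  by rewrite -EFinD lee_fin => ? _; exists r'.
have hle : beta * f nu - r' - l nu rho < eps / 4.
  rewrite -lte_fin; apply: le_lt_trans hH.
  rewrite -addrA EFinD leeD2l //; apply: ereal_sup_ubound; exists rho => //.
  by rewrite cr' Lb.
have := near rho (lexx _); rewrite -/rr ltr_norml => /andP[hF _].
have Yq : 2^-1 * qf Y' (sig a rr) = 2^-1 * qf Y (sig a rr) + e * sq (sig a rr).
  by rewrite /Y' qfDl -scalemx1 qfZl qf1; field.
move: hF; rewrite Yq.
move: (beta * f nu) (beta * u _) (e * _) (2^-1 * _) (l nu rho) he hle r'r {Yq} => x1 x2 x3 x4 x5.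
by lra.
Qed.

Definition simplex_lower_jet (w : V -> R) a P Y := forall e, 0 < e ->
  exists2 del, 0 < del & forall b, weights b -> `|b - a| < del ->
    w a + dot P (b - a) + 2^-1 * qf Y (b - a) - e * sq (b - a) <= w b.

Lemma quartic_below (w : V -> R) (a P : V) (Y : 'M[R]_N) (e : R) : weights a -> simplex_cont w ->
  simplex_lower_jet w a P Y -> 0 < e ->
  exists K, forall b, weights b -> quartic (w a) a P (Y - (2 * e)%:M) K b <= w b.
Proof.
move=> wa cw jet e0.
have [||K hK] := @quartic_dominates R N (fun b => - w b) a (- P) (- Y) e wa _ _ e0.
- move=> b t wb t0; have [del del0 h] := cw b t wb t0; exists del => // b' wb' bb'.
  by rewrite -opprD normrN; exact: h.
- move=> t t0; have [del del0 h] := jet t t0; exists del => // b wb ba.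
  by have := h b wb ba; rewrite dotNl qfNl; lra.
exists (- K) => b wb; move: (hK b wb); rewrite /quartic !qfDl !qfNl dotNl.
by move: (qf (2 * e)%:M _) (qf Y _) (dot _ _) (sq _ ^+ 2) => x1 x2 x3 x4; lra.
Qed.

Hypothesis ev_bounded : forall x : 'rV[R]_d, exists M : R, forall rho, `|ev rho x - ev rho 0| <= M.

Lemma offsets_bounded : exists2 M, 0 <= M & forall rho, `|offsets rho| <= M.
Proof.
have [B hB] := choice (fun i => ev_bounded (xs i)).
have B0 i (rho : H) : 0 <= B i by apply: le_trans (hB i rho).
exists (\sum_i `|B i|); first by apply: sumr_ge0.
move=> rho; apply: norm_leP => [|i]; first by apply: sumr_ge0.
rewrite mxE; apply: le_trans (hB i rho) _; rewrite (bigD1 i) //=.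
by rewrite (le_trans (ler_norm _)) // lerDl sumr_ge0.
Qed.

Lemma simplex_super_jet (w : @meas R d -> R) (a P : V) (Y : 'M[R]_N) : contP p w ->
  supersolution p q beta c ev (fun mu => (w mu)%:E) -> (forall i j, Y i j = Y j i) -> weights a ->
  simplex_lower_jet (fun b : V => w (atm xs b)) a P Y ->
  forall eps, 0 < eps -> exists rho r, c (atm xs a) rho = r%:E /\
    r + 2^-1 * qf Y (sig a (offsets rho)) <= beta * w (atm xs a) + eps.
Proof.
move=> cw wsup Ysym wa jet eps eps0.
have Pa := atm_Pq xs p wa.
have e40 : 0 < eps / 4 by rewrite divr_gt0.
(* The nearly optimal control will be found at a nearby measure and is not known in advance, so all
   estimates have to be uniform in [rho]. *)
have [M M0 rrM] := offsets_bounded.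
have [S S0 hS] : exists2 S, 0 < S & forall rho, sq (sig a (offsets rho)) <= S.
  have cs : continuous (fun r : V => sq (sig a r)).
    have -> : (fun r : V => sq (sig a r)) = (fun r : V => \sum_i sig a r ord0 i * sig a r ord0 i).
      by apply/funext => r; rewrite sqE dot_sum.
    have ci i : continuous (fun r : V => sig a r ord0 i).
      apply: (@continuous_lipschitz R V (V * V)%type (fun r => (a, r)) (fun z => sig z.1 z.2 ord0 i) 1).
        by move=> x y; rewrite prod_normE /= subrr normr0 mul1r ge_max lexx normr_ge0.
      exact: sig_continuous.
    by apply: continuous_sum => i _; exact: continuous_mul.
  have [B B0 hB] := continuous_bounded M cs; exists (1 + B); first by rewrite ltr_pwDl.
  by move=> rho; rewrite (le_trans (ler_norm _)) // (le_trans (hB _ (rrM rho))) // lerDr.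
have [e e0 he] : exists2 e, 0 < e & forall rho, e * sq (sig a (offsets rho)) <= eps / 4.
  exists (eps / 4 / S) => [|rho]; first by rewrite divr_gt0.
  by rewrite mulrAC ler_pdivrMr // ler_wpM2l ?(ltW e40).
pose Y' := Y - (2 * e)%:M.
have Y'sym i j : Y' i j = Y' j i by rewrite !mxE Ysym eq_sym.
have [K dom] := quartic_below wa (atm_simplex_cont cw) jet e0.
have [f [Df [D2f [l [fC2 fa fE hA]]]]] := quartic_test (w (atm xs a)) M P K Y'sym wa e40.
have ge0 : (0 <= limsupF (nbhsD p (atm xs a)) (Ham beta c ev f D2f))%E.
  apply: (wsup _ Pa f Df D2f fC2); first by rewrite fa liminfF_cont.
  move=> nu pnu le; have [b [wb enu]] := supported_atm xs_inj (preceq_supported wa pnu le).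
  rewrite lee_fin (proj1 (fE b nu wb enu)).
  have eun : eqm (atm xs b) nu by move=> A mA; rewrite enu.
  by rewrite (eqm_cont cw (atm_Pq xs p wb) eun); exact: dom.
have [nu [pnu cost [b [wb enu]] near] hH] := limsupF_ge0 ge0 hA e40.
have [fb Lb] := fE b nu wb enu.
(* A control whose value in the supremum exceeds a real number has finite cost. *)
have [rho [r' cr' hr']] : exists rho, exists2 r', c nu rho = r'%:E &
    - (eps / 4) < beta * f nu - r' - l nu rho.
  move: hH; rewrite /Ham addeC -lteBlDr // => /ereal_sup_gt[_ [rho _ <-]].
  rewrite Lb; have := cN rho pnu.
  case cr' : (c nu rho) => [r'||] // _ h; exists rho, r' => //.
  by move: h; rewrite -?EFinN -?EFinD lte_fin; lra.
have [_ c2] := cost rho.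
have [r cr rr'] : exists2 r, c (atm xs a) rho = r%:E & r <= r' + eps / 4.
  move: c2 (cN rho Pa); rewrite cr'; case: (c (atm xs a) rho) => [r||] //.
  by rewrite -EFinD lee_fin => ? _; exists r.
exists rho, r; split => //.
have := near rho (rrM rho); rewrite ltr_norml => /andP[_ hF].
have Yq : 2^-1 * qf Y' (sig a (offsets rho)) = 2^-1 * qf Y (sig a (offsets rho)) - e * sq (sig a (offsets rho)).
  by rewrite /Y' qfDl qfNl -scalemx1 qfZl qf1; field.
move: hF; rewrite Yq.
move: (beta * f nu) (beta * w _) (e * _) (2^-1 * _) (l nu rho) (he rho) hr' rr' {Yq} => x1 x2 x3 x4 x5.
by lra.
Qed.

End SimplexJets.

(** * Logarithmic coordinates on the simplex *)

(** The remainder has derivative [t ^+ 2 / (1 + t)], at most [2 * t ^+ 2] because [1 + t >= 1 / 2];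
    the mean value theorem concludes. *)
Lemma ln_taylor2 {R : realType} (x : R) : `|x| <= 2^-1 ->
  `|ln (1 + x) - x + 2^-1 * x ^+ 2| <= 2 * `|x| ^+ 3.
Proof.
rewrite ler_norml => /andP[x1 x2].
pose f (t : R) := ln (1 + t) - t + 2^-1 * t ^+ 2.
pose df (t : R) := (1 + t)^-1 - 1 + t.
have fd (t : R) : - 2^-1 <= t -> is_derive t 1 f (df t).
  move=> t1; have t0 : 0 < 1 + t by lra.
  have dln : is_derive t 1 (fun t : R => ln (1 + t)) (1 + t)^-1.
    have h1 : is_derive (1 + t) 1 (@ln R) (1 + t)^-1 by exact: is_derive1_ln.
    have h2 : is_derive t 1 (fun t : R => 1 + t) 1.
      by apply: is_derive_eq; rewrite add0r mulr1.
    by have := @is_derive1_comp R (@ln R) (fun t : R => 1 + t) t _ _ h1 h2; rewrite mulr1.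
  by apply: is_derive_eq; rewrite /df /GRing.scale /=; field; rewrite gt_eqF.
have f0 : f 0 = 0 by rewrite /f addr0 ln1; ring.
have dfb (t : R) : - 2^-1 <= t -> `|df t| <= 2 * t ^+ 2.
  move=> t1; have t0 : 0 < 1 + t by lra.
  have -> : df t = t ^+ 2 / (1 + t) by rewrite /df; field; rewrite gt_eqF.
  rewrite ger0_norm ?divr_ge0 ?sqr_ge0 ?(ltW t0) //.
  by rewrite ler_pdivrMr // -mulrA mulrC -mulrA ler_peMr ?sqr_ge0 //; lra.
have fc (a b : R) : - 2^-1 <= a -> {within `[a, b], continuous f}.
  move=> a1; apply: derivable_within_continuous => t; rewrite in_itv /= => /andP[at_ _].
  by have [] := fd t (le_trans a1 at_).
have fx : ln (1 + x) - x + 2^-1 * x ^+ 2 = f x by [].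
have h0 : - 2^-1 <= 0 :> R by lra.
rewrite fx; have [x0|/ltW x0] := leP 0 x.
  have [|c] := @MVT_segment R f df 0 x x0 _ (fc 0 x h0); last first.
    rewrite in_itv /= f0 !subr0 => /andP[c0 cx] ->.
    rewrite normrM exprSr mulrA ler_wpM2r ?normr_ge0 //.
    apply: le_trans (dfb c _) _; first by lra.
    by rewrite ler_wpM2l // ger0_norm // ler_pXn2r.
  by move=> t; rewrite in_itv /= => /andP[t0 tx]; apply: fd; lra.
have [|c] := @MVT_segment R f df x 0 x0 _ (fc x 0 x1); last first.
  rewrite in_itv /= f0 !sub0r => /andP[cx c0] /eqP; rewrite eqr_oppLR => /eqP ->.
  rewrite normrN normrM normrN exprSr mulrA ler_wpM2r ?normr_ge0 //.
  apply: le_trans (dfb c _) _; first by lra.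
  by rewrite ler_wpM2l // -(normrX 2 x) ger0_norm ?sqr_ge0 //; nra.
by move=> t; rewrite in_itv /= => /andP[t0 tx]; apply: fd; lra.
Qed.

Lemma scaled_ln_taylor {R : realType} (e : R) : 0 < e -> exists2 th, 0 < th <= 2^-1 &
  forall k l m : R, `|k - 1| < th -> `|l| < th -> `|m| < th ->
    let v l := ln (1 + k * l) / k in
    `|v l - l + 2^-1 * l ^+ 2| <= e * l ^+ 2 /\ `|k * (v l * v m) - l * m| <= e * (l ^+ 2 + m ^+ 2).
Proof.
move=> e0; pose th : R := Num.min (20^-1) (e / 60).
have th0 : 0 < th by rewrite lt_min invr_gt0 divr_gt0 ?ltr0n.
have [th1 the] : th <= 20^-1 /\ th <= e / 60 by split; rewrite ge_min lexx ?orbT.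
move: th th0 th1 the => th th0 th1 the.
exists th; first by rewrite th0; lra.
move=> k l m hk hl hm v.
have [k1 k2] : 19 / 20 <= k /\ k <= 21 / 20 by move: hk; rewrite ltr_norml => /andP[? ?]; split; lra.
have vE (x : R) : `|x| < th -> exists2 w, v x = x + w &
    `|w + 2^-1 * x ^+ 2| <= 4 * th * x ^+ 2.
  move=> hx; exists (v x - x); first by ring.
  have xn := normr_ge0 x.
  have kx : `|k * x| <= 2^-1.
    rewrite normrM ger0_norm; last by lra.
    by apply: (@le_trans _ _ (21 / 20 * 20^-1)); [apply: ler_pM; lra|lra].
  have := ln_taylor2 kx; rewrite normrM (@ger0_norm _ k); last by lra.
  have yE : ln (1 + k * x) = k * v x by rewrite /v mulrCA divff ?mulr1 // gt_eqF //; lra.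
  rewrite yE; move: (v x) => y.
  have -> : k * y - k * x + 2^-1 * (k * x) ^+ 2 = k * (y - x + 2^-1 * k * x ^+ 2) by ring.
  rewrite normrM (@ger0_norm _ k); last by lra.
  have -> : 2 * (k * `|x|) ^+ 3 = k * (2 * k ^+ 2 * `|x| * `|x| ^+ 2) by ring.
  rewrite ler_pM2l; last by lra.
  rewrite -(normrX 2 x) (@ger0_norm _ (x ^+ 2)) ?sqr_ge0 // => h1.
  have -> : y - x + 2^-1 * x ^+ 2 = (y - x + 2^-1 * k * x ^+ 2) - 2^-1 * (k - 1) * x ^+ 2 by ring.
  apply: le_trans (ler_normB _ _) _; rewrite normrM (@ger0_norm _ (x ^+ 2)) ?sqr_ge0 //.
  have -> : 4 * th * x ^+ 2 = 3 * th * x ^+ 2 + th * x ^+ 2 by ring.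
  apply: lerD; last first.
    rewrite ler_wpM2r ?sqr_ge0 // normrM ger0_norm //.
    by move: (`|k - 1|) hk => t; lra.
  apply: le_trans h1 _; rewrite ler_wpM2r ?sqr_ge0 //.
  have k3 : 2 * k ^+ 2 <= 3 by nra.
  apply: ler_pM => //; last exact: ltW.
  by rewrite mulr_ge0 ?sqr_ge0.
have [w vl hw] := vE l hl; have [w' vm hw'] := vE m hm.
have small (x y : R) : `|x| < th -> `|y + 2^-1 * x ^+ 2| <= 4 * th * x ^+ 2 -> `|y| <= th * `|x|.
  move=> hx hy; have -> : y = (y + 2^-1 * x ^+ 2) - 2^-1 * x ^+ 2 by ring.
  apply: le_trans (ler_normB _ _) _; apply: le_trans (lerD hy (lexx _)) _.
  have x2 : x ^+ 2 = `|x| * `|x| by rewrite -expr2 -normrX ger0_norm ?sqr_ge0.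
  have -> : `|2^-1 * x ^+ 2| = 2^-1 * x ^+ 2 by rewrite ger0_norm // mulr_ge0 ?sqr_ge0.
  rewrite x2; have := normr_ge0 x; move: `|x| hx => t tth t0.
  by nra.
split.
  have -> : v l - l + 2^-1 * l ^+ 2 = w + 2^-1 * l ^+ 2 by rewrite vl; ring.
  by apply: le_trans hw _; rewrite ler_wpM2r ?sqr_ge0 //; lra.
have -> : k * (v l * v m) - l * m = k * (l * w' + m * w + w * w') + (k - 1) * (l * m).
  by rewrite vl vm; ring.
have {}hw := small l w hl hw; have {}hw' := small m w' hm hw'.
have nl := normr_ge0 l; have nm := normr_ge0 m.
have b1 : `|l * w'| <= th * (`|l| * `|m|) by rewrite normrM mulrCA ler_wpM2l.
have b2 : `|m * w| <= th * (`|l| * `|m|) by rewrite normrM mulrC mulrA ler_wpM2r.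
have b3 : `|w * w'| <= th * (`|l| * `|m|).
  rewrite normrM; apply: (@le_trans _ _ (th * `|l| * (1 * `|m|))); last by rewrite mul1r mulrA.
  apply: ler_pM => //; apply: le_trans hw' _; rewrite ler_wpM2r //; lra.
have b4 : `|k * (l * w' + m * w + w * w')| <= 2 * (3 * th * (`|l| * `|m|)).
  rewrite normrM (@ger0_norm _ k); last by lra.
  apply: ler_pM => //; try lra.
  apply: le_trans (ler_normD _ _) _; apply: le_trans (lerD (ler_normD _ _) (lexx _)) _.
  by lra.
have b5 : `|(k - 1) * (l * m)| <= th * (`|l| * `|m|).
  by rewrite !normrM ler_wpM2r ?mulr_ge0 // ltW.
have b6 : `|l| * `|m| <= l ^+ 2 + m ^+ 2.
  have -> : l ^+ 2 + m ^+ 2 = `|l| ^+ 2 + `|m| ^+ 2 by rewrite -!normrX !ger0_norm ?sqr_ge0.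
  by nra.
apply: le_trans (ler_normD _ _) _; apply: le_trans (lerD b4 b5) _.
apply: (@le_trans _ _ (e * (`|l| * `|m|))); last by rewrite ler_wpM2l // ltW.
have -> : 2 * (3 * th * (`|l| * `|m|)) + th * (`|l| * `|m|) = (7 * th) * (`|l| * `|m|) by ring.
by rewrite ler_wpM2r ?mulr_ge0 //; lra.
Qed.

Section MatrixForms.
Context {R : realType}.

Lemma dot_mulmx {n} (a b : 'rV[R]_n) : dot a b = (a *m b^T) ord0 ord0.
Proof. by rewrite dot_sum mxE; apply: eq_bigr => i _; rewrite mxE. Qed.

Lemma qf_mulmx {n} (X : 'M[R]_n) (a : 'rV[R]_n) : qf X a = (a *m X *m a^T) ord0 ord0.
Proof.
rewrite qf_sum exchange_big mxE; apply: eq_bigr => j _; rewrite mxE mulr_suml.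
by apply: eq_bigr => i _; rewrite !mxE; ring.
Qed.

Lemma qf_conj {m n} (A : 'M[R]_(m, n)) (X : 'M[R]_n) a : qf (A *m X *m A^T) a = qf X (a *m A).
Proof. by rewrite !qf_mulmx trmx_mul !mulmxA. Qed.

Lemma dot_conj {m n} (A : 'M[R]_(m, n)) p (a : 'rV[R]_m) : dot (p *m A^T) a = dot p (a *m A).
Proof. by rewrite !dot_mulmx trmx_mul mulmxA. Qed.

(* For [k = a_0 / b_0] and [l = (b - a) *m lamx a], with [lamx] as below, [k *: v]
   is the change of logarithmic coordinates from the weights [a] to [b]; the
   second-order term of [ln] is what produces the drift in [gen]. *)
Lemma log_change {n} (p : 'rV[R]_n) (X : 'M[R]_n) (e : R) : 0 < e ->
  exists2 th, 0 < th & forall k (l : 'rV[R]_n), `|k - 1| < th -> `|l| < th ->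
    let v := \row_j (ln (1 + k * l ord0 j) / k) in
    `|k *: v| <= 4 * `|l| /\
    dot p v + 2^-1 * k * qf X v + e / 4 * k * sq v <=
      dot p l + 2^-1 * qf (X - diag_mx p) l + e * sq l.
Proof.
move=> e0; pose A := \sum_i `|p ord0 i| + \sum_i \sum_j `|X i j|.
have A0 : 0 <= A by rewrite addr_ge0 // ?sumr_ge0 // => i _; apply: sumr_ge0.
(* Half of [e] is for the Taylor errors, whose coefficients add up to [A]; the other half absorbs
   [e / 4 * k * sq v], since [k * sq v <= 2 * sq l]. *)
have [eta [eta0 eta1 etaA]] : exists eta, [/\ 0 < eta, eta <= 2^-1 & eta * A <= e / 2].
  have A1 : 0 < 1 + A by rewrite ltr_pwDl.
  exists (Num.min 2^-1 (e / 2 / (1 + A))); split.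
  - by rewrite lt_min invr_gt0 ltr0n !divr_gt0.
  - by rewrite ge_min lexx.
  apply: (@le_trans _ _ (e / 2 / (1 + A) * A)); first by rewrite ler_wpM2r // ge_min lexx orbT.
  by rewrite mulrAC ler_pdivrMr // ler_wpM2l ?divr_ge0 ?(ltW e0) // lerDr.
have [th /andP[th0 th1] hth] := scaled_ln_taylor eta0.
exists th => // k l hk hl v.
have li j : `|l ord0 j| < th by apply: le_lt_trans (coord_le_norm l j) hl.
have vi j : `|v ord0 j - l ord0 j + 2^-1 * l ord0 j ^+ 2| <= eta * l ord0 j ^+ 2.
  by rewrite mxE; exact: (proj1 (hth k _ _ hk (li j) (li j))).
have vij i j : `|k * (v ord0 i * v ord0 j) - l ord0 i * l ord0 j| <= eta * (l ord0 i ^+ 2 + l ord0 j ^+ 2).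
  by rewrite !mxE; exact: (proj2 (hth k _ _ hk (li i) (li j))).
have l2 i := coord_sq_le l i.
move: v vi vij => v vi vij.
split.
  apply: norm_leP => [|j]; first by rewrite mulr_ge0.
  rewrite mxE normrM; apply: (@le_trans _ _ (2 * (2 * `|l|))); last by lra.
  apply: ler_pM => //; first by move: hk; rewrite ltr_norml => /andP[? ?]; rewrite ler_norml; lra.
  have := vi j; have := coord_le_norm l j; move: (li j); move: (v ord0 j) (l ord0 j) => x y.
  move=> hy yl h; have -> : x = (x - y + 2^-1 * y ^+ 2) + y - 2^-1 * y ^+ 2 by ring.
  apply: le_trans (ler_normB _ _) _; apply: le_trans (lerD (ler_normD _ _) (lexx _)) _.
  have y2 : y ^+ 2 = `|y| * `|y| by rewrite -expr2 -normrX ger0_norm ?sqr_ge0.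
  have -> : `|2^-1 * y ^+ 2| = 2^-1 * y ^+ 2 by rewrite ger0_norm // mulr_ge0 ?sqr_ge0.
  have yy : y ^+ 2 <= 2^-1 * `|y| by rewrite y2 ler_wpM2r // ltW // (lt_le_trans hy).
  have ey : eta * y ^+ 2 <= 2^-1 * y ^+ 2 by rewrite ler_wpM2r // sqr_ge0.
  by move: (y ^+ 2) (eta * _) (`|_ + 2^-1 * _|) yy ey h {y2} => s t r; move: `|y| `|l| yl (normr_ge0 l) => a b; lra.
have s1 : dot p v <= dot p l - 2^-1 * qf (diag_mx p) l + eta * (\sum_i `|p ord0 i|) * sq l.
  rewrite qf_diag !dot_sum mulr_sumr mulrAC mulr_sumr -sumrB -big_split /=; apply: ler_sum => i _.
  move: (vi i); move: (v ord0 i) => x hx.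
  have : p ord0 i * (x - l ord0 i + 2^-1 * l ord0 i ^+ 2) <= eta * sq l * `|p ord0 i|.
    apply: le_trans (ler_norm _) _; rewrite normrM mulrC ler_wpM2r //.
    by apply: le_trans hx _; rewrite ler_wpM2l // ltW.
  by move: (sq l) (p ord0 i) => s t; nra.
have s2 : k * qf X v <= qf X l + 2 * eta * (\sum_i \sum_j `|X i j|) * sq l.
  move: (sq l) l2 => s ls.
  rewrite !qf_sum mulr_sumr mulrAC mulr_sumr -big_split /=; apply: ler_sum => i _.
  rewrite !mulr_sumr -big_split /=; apply: ler_sum => j _.
  move: (vij i j) => hx.
  have : X i j * (k * (v ord0 i * v ord0 j) - l ord0 i * l ord0 j) <=
      2 * eta * s * `|X i j|.
    apply: le_trans (ler_norm _) _; rewrite normrM mulrC ler_wpM2r //.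
    apply: le_trans hx _; have -> : 2 * eta * s = eta * (2 * s) by ring.
    rewrite ler_wpM2l ?(ltW eta0) //.
    by have := ls i; have := ls j; lra.
  by move: (v ord0 i) (v ord0 j) => x1 x2; lra.
have s3 : k * sq v <= 2 * sq l.
  rewrite !sqE !dot_sum !mulr_sumr; apply: ler_sum => i _.
  move: (vij i i); move: (v ord0 i) => x; rewrite ler_norml => /andP[_ hx].
  have l20 := sqr_ge0 (l ord0 i); rewrite -expr2 in hx *.
  by rewrite -[leRHS]mulrC; nra.
rewrite qfDl qfNl.
have sq0 := sq_ge0 l; have hA : eta * A * sq l <= e / 2 * sq l by rewrite ler_wpM2r.
have hs3 : e / 4 * k * sq v <= e / 2 * sq l by rewrite -mulrA; nra.
move: s1 s2 hA hs3; rewrite /A mulrDr mulrDl.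
move: (dot p v) (dot p l) (qf X v) (qf X l) (qf _ l) (sq v) (sq l) (\sum_i `|p ord0 i|) (\sum_i \sum_j _).
by move=> x1 x2 x3 x4 x5 x6 x7 x8 x9; lra.
Qed.

End MatrixForms.

Section LogCoordinates.
Context {R : realType} {n : nat}.
Local Notation V := 'rV[R]_n.
Local Notation B := 'rV[R]_n.+1.

(** Logarithmic coordinates normalized so that the atom [ord0] has coordinate 0; the image is the
    open simplex, with inverse [logc]. *)
Definition soft (z : V) : B :=
  \row_i (oapp (fun j => expR (z ord0 j)) 1 (unlift ord0 i) / kap z).

Definition logc (b : B) : V := \row_j ln (b ord0 (lift ord0 j) / b ord0 ord0).

Lemma soft0 z : soft z ord0 ord0 = (kap z)^-1.
Proof. by rewrite mxE unlift_none /= div1r. Qed.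

Lemma softS z j : soft z ord0 (lift ord0 j) = expR (z ord0 j) / kap z.
Proof. by rewrite mxE liftK. Qed.

Lemma kap_gt0 (z : V) : 0 < kap z.
Proof. exact: lt_le_trans (kap_ge1 z). Qed.

Lemma soft_gt0 z i : 0 < soft z ord0 i.
Proof.
rewrite mxE divr_gt0 ?kap_gt0 //; case: (unlift _ _) => [j|] //=; exact: expR_gt0.
Qed.

Lemma soft_weights z : weights (soft z).
Proof.
split=> [i|]; first exact: ltW (soft_gt0 z i).
rewrite big_ord_recl soft0; under eq_bigr do rewrite softS.
by rewrite -mulr_suml -[X in X + _]mul1r -mulrDl divff // gt_eqF ?kap_gt0.
Qed.

Lemma kap_logc b : weights b -> (forall i, 0 < b ord0 i) -> kap (logc b) = (b ord0 ord0)^-1.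
Proof.
move=> [_ b1] b0; rewrite kapE; under eq_bigr do rewrite mxE lnK ?posrE ?divr_gt0 //.
rewrite -mulr_suml; move: b1; rewrite big_ord_recl => b1.
have -> : \sum_(i < n) b ord0 (lift ord0 i) = 1 - b ord0 ord0 by lra.
by rewrite mulrBl mul1r divff ?gt_eqF // addrC subrK.
Qed.

Lemma soft_logc b : weights b -> (forall i, 0 < b ord0 i) -> soft (logc b) = b.
Proof.
move=> wb b0; apply/rowP => i; case: (unliftP ord0 i) => [j|] ->.
  rewrite softS kap_logc // invrK mxE lnK ?posrE ?divr_gt0 // divfK // gt_eqF //.
by rewrite soft0 kap_logc // invrK.
Qed.

Lemma soft_continuous i : continuous (fun z : V => soft z ord0 i).
Proof.
case: (unliftP ord0 i) => [j|] ->.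
  under eq_fun do rewrite softS.
  apply: continuous_mul; last first.
    by apply: continuous_inv; [move=> z; rewrite gt_eqF ?kap_gt0|exact: kap_continuous].
  by move=> z; apply: (@continuous_comp _ _ _ (fun z : V => z ord0 j) expR); [exact: continuous_coord|exact: continuous_expR].
under eq_fun do rewrite soft0.
by apply: continuous_inv; [move=> z; rewrite gt_eqF ?kap_gt0|exact: kap_continuous].
Qed.

Lemma soft_near z e : 0 < e -> exists2 del, 0 < del & forall z', `|z' - z| < del -> `|soft z' - soft z| < e.
Proof.
move=> e0; pose g (z' : V) := \sum_i `|soft z' ord0 i - soft z ord0 i|.
have cg : continuous g.
  apply: continuous_sum => i _ x.
  apply: (@continuous_comp _ _ _ (fun z' : V => soft z' ord0 i - soft z ord0 i) (@Num.norm R R^o)).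
    by apply: continuous_sub; [exact: soft_continuous|exact: continuous_const].
  exact: norm_continuous.
have [del del0 h] := proj1 (continuous_eps g) cg z e e0; exists del => // z' zz'.
have gz : g z = 0 by rewrite /g big1 // => i _; rewrite subrr normr0.
have := h z' zz'; rewrite gz subr0 ger0_norm ?sumr_ge0 //; apply: le_lt_trans.
apply: norm_leP => [|i]; first by apply: sumr_ge0.
have -> : (soft z' - soft z) ord0 i = soft z' ord0 i - soft z ord0 i by rewrite !mxE.
by rewrite /g (bigD1 i) //= lerDl sumr_ge0.
Qed.

(** The differential of [logc] at [a], acting on row vectors from the right. *)
Definition lamx (a : B) : 'M[R]_(n.+1, n) :=
  \matrix_(i, j) ((i == lift ord0 j)%:R / a ord0 i - (i == ord0)%:R / a ord0 ord0).

Lemma lamxE (a x : B) j : (x *m lamx a) ord0 j =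
  x ord0 (lift ord0 j) / a ord0 (lift ord0 j) - x ord0 ord0 / a ord0 ord0.
Proof.
rewrite mxE; under eq_bigr do rewrite mxE mulrBr.
rewrite sumrB; congr (_ - _).
  rewrite (bigD1 (lift ord0 j)) //= eqxx big1 ?addr0 ?mul1r // => i ij.
  by rewrite (negbTE ij) mul0r mulr0.
rewrite (bigD1 ord0) //= big1 ?addr0 ?mul1r // => i ij.
by rewrite (negbTE ij) mul0r mulr0.
Qed.

(** The differential of [logc] divides by the weights and the mean cancels in the difference. The
    dependence on [a] disappears, and this makes the coefficients constant. *)
Lemma lamx_sig (a r : B) : (forall i, 0 < a ord0 i) ->
  sig a r *m lamx a = \row_j (r ord0 (lift ord0 j) - r ord0 ord0).
Proof.
move=> a0; apply/rowP => j; rewrite lamxE !mxE !mulfK ?gt_eqF //.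
by ring.
Qed.

(** With [jetY], the gradient and Hessian at [a] of b_0 V(logc b), where V has value [g], gradient
    [p] and Hessian [X] at [logc a]. In the Hessian the cross term from b_0 cancels part of the
    curvature of the logarithm, and exactly [- diag_mx p] is left. *)
Definition jetP (a : B) (g : R) (p : V) : B := g *: delta_mx ord0 ord0 + a ord0 ord0 *: (p *m (lamx a)^T).
Definition jetY (a : B) (p : V) (X : 'M[R]_n) : 'M[R]_n.+1 :=
  a ord0 ord0 *: (lamx a *m (X - diag_mx p) *m (lamx a)^T).

Lemma jetY_sym (a : B) (p : V) (X : 'M[R]_n) : (forall i j, X i j = X j i) -> forall i j, jetY a p X i j = jetY a p X j i.
Proof.
move=> Xs i j; pose S := X - diag_mx p; have St : S^T = S.
  by apply/matrixP => k l; rewrite !mxE Xs eq_sym; case: eqP => [->|].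
have Mt : (lamx a *m S *m (lamx a)^T)^T = lamx a *m S *m (lamx a)^T.
  by rewrite !trmx_mul trmxK St mulmxA.
by rewrite /jetY mxE -Mt mxE Mt [in RHS]mxE.
Qed.

Lemma jetY_gen z p X (r : B) :
  2^-1 * qf (jetY (soft z) p X) (sig (soft z) r) =
  (kap z)^-1 * gen p X (\row_j (r ord0 (lift ord0 j) - r ord0 ord0)).
Proof.
rewrite /jetY qfZl qf_conj lamx_sig; last exact: soft_gt0.
rewrite soft0 mulrCA; congr (_ * _); rewrite genE qfDl qfNl qf_diag mulrBr; congr (_ + _).
rewrite dot_sum mulr_sumr -sumrN; apply: eq_bigr => j _.
by rewrite !mxE; ring.
Qed.

(** Beyond the operator bound, [L] dominates [2 / a_i], so that within [L^-1] of [a] every weight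
    exceeds half its value at [a]. *)
Lemma lamx_bound (a : B) : (forall i, 0 < a ord0 i) -> exists2 L, 0 < L &
  (forall i, (a ord0 i)^-1 * 2 <= L) /\ forall x : B, `|x *m lamx a| <= L * `|x|.
Proof.
move=> a0; pose L := 2 * \sum_i (a ord0 i)^-1.
have ai i : (a ord0 i)^-1 * 2 <= L.
  rewrite mulrC ler_pM2l // (bigD1 i) //= lerDl sumr_ge0 // => j _.
  by rewrite invr_ge0 ltW.
have L0 : 0 < L by apply: lt_le_trans (ai ord0); rewrite mulr_gt0 // invr_gt0.
exists L => //; split=> // x; apply: norm_leP => [|j]; first by rewrite mulr_ge0 // ltW.
rewrite lamxE; apply: le_trans (ler_normB _ _) _; rewrite !normrM.
rewrite (@ger0_norm _ (a ord0 (lift ord0 j))^-1) ?invr_ge0 ?(ltW (a0 _)) //.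
rewrite (@ger0_norm _ (a ord0 ord0)^-1) ?invr_ge0 ?(ltW (a0 _)) //.
have h1 := ler_pM (normr_ge0 _) _ (coord_le_norm x (lift ord0 j)) (ai (lift ord0 j)).
have h2 := ler_pM (normr_ge0 _) _ (coord_le_norm x ord0) (ai ord0).
have := h1 _; have := h2 _; rewrite !mulr_ge0 ?invr_ge0 ?(ltW (a0 _)) // => /(_ isT) k2 /(_ isT) k1.
by lra.
Qed.

Lemma jetP_dot (a x : B) (g : R) (p : V) :
  dot (jetP a g p) x = g * x ord0 ord0 + a ord0 ord0 * dot p (x *m lamx a).
Proof.
rewrite /jetP dotDl !dotZl dot_conj; congr (_ * _ + _).
rewrite dot_sum (bigD1 ord0) //= big1 ?addr0 => [|i i0]; first by rewrite mxE !eqxx mul1r.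
by rewrite mxE (negbTE i0) andbF mul0r.
Qed.

(** On the open simplex [U b] is b_0 times the transformed function at [logc b]. The displacement is
    exact, (logc b - z)_j = ln (1 + kk l_j) with kk = a_0 / b_0, so [log_change] turns one expansion
    into the other. *)
Lemma soft_upper_jet (U : B -> R) z p X : upper_jet (fun z : V => kap z * U (soft z)) z p X ->
  simplex_upper_jet U (soft z) (jetP (soft z) (kap z * U (soft z)) p) (jetY (soft z) p X).
Proof.
move=> jet eps eps0; have wa := soft_weights z; have a0 := soft_gt0 z.
have a0k : soft z ord0 ord0 = (kap z)^-1 by exact: soft0.
have az j : expR (z ord0 j) = soft z ord0 (lift ord0 j) / soft z ord0 ord0.
  by rewrite softS soft0 invrK divfK // gt_eqF // kap_gt0.
have [L L0 [aL lamL]] := lamx_bound a0.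
have C0 : 0 < 1 + n%:R * L ^+ 2 by rewrite ltr_pwDl // mulr_ge0 // sqr_ge0.
have lamsq (x : B) : sq (x *m lamx (soft z)) <= (1 + n%:R * L ^+ 2) * sq x.
  apply: le_trans (sq_le (lamL x)) _; rewrite exprMn mulrA mulrDl mul1r.
  apply: le_trans (_ : n%:R * L ^+ 2 * sq x <= _); last by rewrite lerDr sq_ge0.
  by rewrite ler_wpM2l ?norm_sq_le // mulr_ge0 // sqr_ge0.
move: (1 + _) C0 lamsq => C C0 lamsq.
pose e := eps / C; have e0 : 0 < e by rewrite divr_gt0.
have [th th0 hth] := log_change p X e0.
have [d d0 hd] := jet (e / 4) (divr_gt0 e0 (ltr0n _ 4)).
have kz := kap_gt0 z.
move: (soft z) (kap z) wa a0 a0k az aL lamL lamsq hd kz => a k wa a0 a0k az aL lamL lamsq hd kz.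
(* Three radii: for [log_change], for the jet at displacements up to [4 * L * |b - a|], and for the
   positivity of the weights of [b]. *)
exists (Num.min (th / L) (Num.min (d / (4 * L)) L^-1)).
  by rewrite !lt_min !divr_gt0 ?mulr_gt0 // invr_gt0.
move=> b wb; rewrite !lt_min !ltr_pdivlMr ?mulr_gt0 // => /andP[bth /andP[bd bL]].
have aiL i : L^-1 <= a ord0 i / 2.
  by rewrite -[a ord0 i]invrK -invfM lef_pV2 ?posrE ?mulr_gt0 ?invr_gt0.
have bi i : a ord0 i / 2 < b ord0 i.
  have := le_lt_trans (coord_le_norm (b - a) i) (lt_le_trans bL (aiL i)).
  by rewrite !mxE ltr_norml => /andP[]; move: (a0 i); lra.
have b0 i : 0 < b ord0 i by apply: lt_trans (bi i); rewrite divr_gt0.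
pose kk := a ord0 ord0 / b ord0 ord0; pose l := (b - a) *m lamx a.
have hl : `|l| < th by apply: le_lt_trans (lamL _) _; rewrite mulrC.
have hkk : `|kk - 1| < th.
  apply: le_lt_trans bth; have -> : kk - 1 = (a - b) ord0 ord0 / b ord0 ord0.
    by rewrite /kk !mxE mulrBl divff // gt_eqF.
  rewrite normrM (@ger0_norm _ (_^-1)) ?invr_ge0 ?(ltW (b0 _)) //; apply: ler_pM => //.
  - by rewrite invr_ge0 ltW.
  - by apply: le_trans (coord_le_norm _ _) _; rewrite distrC.
  apply: le_trans (aL ord0); rewrite -[2]invrK -invfM lef_pV2 ?posrE ?divr_gt0 //.
  exact: ltW.
have [v4 hv] := hth kk l hkk hl.
have yE : logc b - z = kk *: (\row_j (ln (1 + kk * l ord0 j) / kk)).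
  apply/rowP => j.
  have -> : (logc b - z) ord0 j = ln (b ord0 (lift ord0 j) / b ord0 ord0) - z ord0 j by rewrite !mxE.
  rewrite [RHS]mxE [X in _ = _ * X]mxE [RHS]mulrC divfK; last by rewrite gt_eqF // divr_gt0.
  have -> : 1 + kk * l ord0 j = (b ord0 (lift ord0 j) / b ord0 ord0) * expR (- z ord0 j).
    rewrite expRN az /l lamxE !mxE /kk.
    by field; rewrite !gt_eqF.
  by rewrite [in RHS]lnM ?posrE ?expR_gt0 ?divr_gt0 // expRK.
move: (\row_j _) v4 hv yE => v v4 hv yE.
have yd : `|kk *: v| < d.
  apply: le_lt_trans v4 _; apply: le_lt_trans (_ : 4 * (L * `|b - a|) < _); last by rewrite mulrA mulrC.
  by rewrite ler_wpM2l //; exact: lamL.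
have := hd _ yd; rewrite -yE addrC subrK kap_logc // soft_logc // yE => hU.
have {hU} : U b <= b ord0 ord0 * (k * U a + dot p (kk *: v) + 2^-1 * qf X (kk *: v) + e / 4 * sq (kk *: v)).
  by rewrite -ler_pdivrMl.
rewrite dotZr qfZr !sqE dotZl dotZr -sqE => hU; apply: le_trans hU _.
have -> : b ord0 ord0 * (k * U a + kk * dot p v + 2^-1 * (kk ^+ 2 * qf X v) + e / 4 * (kk * (kk * sq v))) =
    b ord0 ord0 * (k * U a) + a ord0 ord0 * (dot p v + 2^-1 * kk * qf X v + e / 4 * kk * sq v).
  by rewrite /kk; field; rewrite gt_eqF.
have -> : b ord0 ord0 * (k * U a) = U a + (k * U a) * (b - a) ord0 ord0.
  by rewrite !mxE a0k; field; rewrite gt_eqF.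
rewrite jetP_dot /jetY qfZl qf_conj -/l -[leRHS]addrA -!addrA lerD2l lerD2l !addrA.
have -> : a ord0 ord0 * dot p l + 2^-1 * (a ord0 ord0 * qf (X - diag_mx p) l) + eps * sq (b - a) =
  a ord0 ord0 * (dot p l + 2^-1 * qf (X - diag_mx p) l) + eps * sq (b - a) by ring.
apply: le_trans (ler_wpM2l (ltW (a0 _)) hv) _; rewrite mulrDr lerD2l.
have a1 : a ord0 ord0 <= 1.
  by apply: le_trans (weights_norm wa); apply: le_trans (ler_norm _) (coord_le_norm _ _).
apply: (@le_trans _ _ (1 * (e * (C * sq (b - a))))); last first.
  by rewrite mul1r mulrA divfK // gt_eqF.
have esq : 0 <= e * sq l by rewrite mulr_ge0 ?sq_ge0 // ltW.
by apply: ler_pM => //; rewrite ?(ltW (a0 _)) // ler_wpM2l ?(ltW e0) //; exact: lamsq.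
Qed.

End LogCoordinates.

Lemma soft_lower_jet {R : realType} {n} (U : 'rV[R]_n.+1 -> R) (z p : 'rV[R]_n) (X : 'M[R]_n) :
  lower_jet (fun z => kap z * U (soft z)) z p X ->
  simplex_lower_jet U (soft z) (jetP (soft z) (kap z * U (soft z)) p) (jetY (soft z) p X).
Proof.
move=> jet; have jet' : upper_jet (fun z => kap z * - U (soft z)) z (- p) (- X).
  move=> e e0; have [d d0 h] := jet e e0; exists d => // y yd.
  by have := h y yd; rewrite !mulrN dotNl qfNl; lra.
have h := @soft_upper_jet R n (fun b => - U b) z (- p) (- X) jet'; move=> e e0; have [d d0 {}h] := h e e0; exists d => // b wb bd.
have := h b wb bd.
have -> : jetP (soft z) (kap z * - U (soft z)) (- p) = - jetP (soft z) (kap z * U (soft z)) p.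
  by rewrite /jetP mulrN mulNmx scaleNr scalerN opprD.
have -> : jetY (soft z) (- p) (- X) = - jetY (soft z) p X.
  rewrite /jetY; have -> : - X - diag_mx (- p) = - (X - diag_mx p) by rewrite linearN opprD.
  by rewrite mulmxN mulNmx scalerN.
by rewrite dotNl qfNl; lra.
Qed.

(** Jets come with arbitrary matrices, whereas second derivatives in [isC2] are symmetric. *)
Lemma qf_symmetrize {R : realType} {n} (X : 'M[R]_n) :
  exists Xs : 'M[R]_n, (forall i j, Xs i j = Xs j i) /\ forall r, qf Xs r = qf X r.
Proof.
exists (2^-1 *: (X + X^T)); split => [i j|r]; first by rewrite !mxE addrC.
have qT : qf X^T r = qf X r.
  rewrite !qf_sum exchange_big; apply: eq_bigr => i _; apply: eq_bigr => j _.
  by rewrite mxE [r _ _ * _]mulrC.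
by rewrite qfZl qfDl qT; field.
Qed.

(** * Comparison on each simplex, and induction on the number of atoms *)

Section SimplexComparison.
Context {R : realType} {d n : nat} {H : Type}.
Local Notation V := 'rV[R]_n.
Variables (p q beta : R) (ev : H -> 'rV[R]_d -> R) (c : @meas R d -> H -> \bar R).
Variable xs : 'I_n.+1 -> 'rV[R]_d.
Hypotheses (xs_inj : injective xs) (hp : p = 0 \/ 1 <= p) (hq : q = 0 \/ 1 <= q).
Hypothesis mev : forall rho, measurable_fun setT (ev rho : Rd R d -> R).
Hypothesis cN : forall mu rho, Pq p mu -> c mu rho != -oo%E.
Hypothesis cC : forall mu : @meas R d, supported_in xs mu -> forall e : R, 0 < e ->
  Pnbhs p mu [set nu | supported_in xs nu -> forall rho,
    (c nu rho <= c mu rho + e%:E)%E /\ (c mu rho <= c nu rho + e%:E)%E].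
Hypothesis beta0 : 0 < beta.
Hypothesis ev_bounded : forall x : 'rV[R]_d, exists M : R, forall rho, `|ev rho x - ev rho 0| <= M.
Variables u w : @meas R d -> R.
Hypotheses (cu : contP p u) (cw : contP p w).
Hypothesis usub : subsolution p q beta c ev (fun mu => (u mu)%:E).
Hypothesis wsup : supersolution p q beta c ev (fun mu => (w mu)%:E).

Definition increments (rho : H) : V := \row_j (ev rho (xs (lift ord0 j)) - ev rho (xs ord0)).

Lemma increments_offsets rho :
  \row_j (offsets ev xs rho ord0 (lift ord0 j) - offsets ev xs rho ord0 ord0) = increments rho.
Proof. by apply/rowP => j; rewrite !mxE; ring. Qed.

Lemma soft_atm_continuous (v : @meas R d -> R) : contP p v ->
  continuous (fun z : V => kap z * v (atm xs (soft z))).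
Proof.
move=> cv; apply: continuous_mul; first exact: kap_continuous.
apply/continuous_eps => z e e0.
have [del del0 h] := atm_simplex_cont xs hp cv (soft_weights z) e0.
have [t t0 ht] := soft_near z del0; exists t => // z' /ht; apply: h; exact: soft_weights.
Qed.

(** By compactness, the weights with [D >= th] keep away from the faces, where [D <= 0]. A lower
    bound [m] on all weights then confines the coordinates to [|ln m|]. *)
Lemma soft_atm_coercive (D : 'rV[R]_n.+1 -> R) th : simplex_cont D ->
  (forall b, weights b -> (exists i, b ord0 i = 0) -> D b <= 0) -> 0 < th ->
  exists r, forall z : V, th <= D (soft z) -> `|z| < r.
Proof.
move=> cD bD th0.
have [|m m0 hm] := @compact_unif R 'rV[R]_n.+1 _
  (fun e b => weights b -> th <= D b -> forall i, e <= b ord0 i) (@simplex_compact R n.+1).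
  move=> a wa; have [Da|Da] := ltP (D a) th.
    have [del del0 h] := cD a (th - D a) wa ltac:(by rewrite subr_gt0).
    exists del => // e b _ bd wb thb; exfalso; have := h b wb bd.
    by rewrite ltr_norml; move: thb; lra.
  have a0 i : 0 < a ord0 i.
    rewrite lt0r (proj1 wa i) andbT; apply/eqP => ai; have := bD a wa (ex_intro _ i ai).
    by lra.
  have [L L0 [aL _]] := lamx_bound a0.
  exists L^-1; first by rewrite invr_gt0.
  move=> e b /andP[e0 eL] bL wb _ i.
  have aiL : L^-1 <= a ord0 i / 2.
    by rewrite -[a ord0 i]invrK -invfM lef_pV2 ?posrE ?mulr_gt0 ?invr_gt0.
  have := le_lt_trans (coord_le_norm (b - a) i) bL.
  by rewrite !mxE ltr_norml; lra.
exists (`|ln m| + 1) => z thz.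
have hz := hm _ (soft_weights z) (soft_weights z) thz.
have kz := kap_gt0 z.
have km : kap z <= m^-1.
  by have := hz ord0; rewrite soft0 -[leLHS]invrK lef_pV2 ?posrE // invr_gt0.
apply: le_lt_trans (_ : `|ln m| < _); last by rewrite ltrDl.
apply: norm_leP => [|j]; first exact: normr_ge0.
have ez := expR_gt0 (z ord0 j).
have lower : ln m <= z ord0 j.
  rewrite -[leRHS]expRK ler_ln ?posrE //.
  have := hz (lift ord0 j); rewrite softS ler_pdivlMr //; apply: le_trans.
  by rewrite ler_peMr ?(ltW m0) // kap_ge1.
have upper : z ord0 j <= - ln m.
  rewrite -lnV ?posrE // -[leLHS]expRK ler_ln ?posrE ?invr_gt0 //; apply: le_trans km.
  by rewrite kapE (bigD1 j) //= addrCA lerDl addr_ge0 // sumr_ge0 // => i _; exact: expR_ge0.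
rewrite ler_norml; apply/andP; split.
  by apply: le_trans lower; rewrite lerNl; apply: le_trans (ler_norm _) _; rewrite normrN.
by apply: le_trans upper _; apply: le_trans (ler_norm _) _; rewrite normrN.
Qed.

Lemma simplex_comparison :
  (forall b, weights b -> (exists i, b ord0 i = 0) -> u (atm xs b) <= w (atm xs b)) ->
  forall b, weights b -> u (atm xs b) <= w (atm xs b).
Proof.
move=> bdry b wb.
have [|b0] := pselect (exists i, b ord0 i = 0); first exact: bdry.
have {}b0 i : 0 < b ord0 i.
  by rewrite lt0r (proj1 wb i) andbT; apply/eqP => bi; apply: b0; exists i.
suff main : forall z : V, kap z * u (atm xs (soft z)) <= kap z * w (atm xs (soft z)).
  by have := main (logc b); rewrite ler_pM2l ?kap_gt0 // soft_logc.
have [M M0 hM] := offsets_bounded xs ev_bounded.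
apply: (@comparison R n H increments (fun z rho r => c (atm xs (soft z)) rho = r%:E) beta (2 * M)).
- exact: beta0.
- move=> rho; apply: norm_leP => [|j]; first by rewrite mulr_ge0.
  rewrite -increments_offsets mxE; apply: le_trans (ler_normB _ _) _.
  have h1 := le_trans (coord_le_norm (offsets ev xs rho) (lift ord0 j)) (hM rho).
  have h2 := le_trans (coord_le_norm (offsets ev xs rho) ord0) (hM rho).
  by lra.
- by rewrite mulr_ge0.
- exact: soft_atm_continuous.
- exact: soft_atm_continuous.
- move=> z e e0.
  have [del del0 h] := Pnbhs_atm hp (soft_weights z) (cC (atm_supported xs (soft_weights z)) e0).
  have [t t0 ht] := soft_near z del0; exists t => // z' zz' rho.
  have /= hc := h _ (soft_weights z') (ht _ zz') (atm_supported xs (soft_weights z')).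
  (* Two costs within a finite distance of each other are finite together, the value -oo being
     excluded. *)
  have cfin mu nu r : Pq p nu -> (c nu rho <= c mu rho + e%:E)%E -> (c mu rho <= c nu rho + e%:E)%E ->
      c mu rho = r%:E -> exists2 r', c nu rho = r'%:E & `|r' - r| <= e.
    move=> pnu h1 h2 cr; move: h1 h2 (cN rho pnu); rewrite cr.
    case: (c nu rho) => [r'||] //; rewrite -!EFinD !lee_fin => h1 h2 _; exists r' => //.
    by rewrite ler_norml; apply/andP; split; lra.
  have [h1 h2] := hc rho.
  split=> r cr; first exact: (cfin _ _ r (atm_Pq xs p (soft_weights z')) h1 h2 cr).
  exact: (cfin _ _ r (atm_Pq xs p (soft_weights z)) h2 h1 cr).
- move=> z P X jet rho r cr; have [Xs [Xsym Xq]] := qf_symmetrize X.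
  have jets : upper_jet (fun z : V => kap z * u (atm xs (soft z))) z P Xs.
    by move=> e /jet[del del0 h]; exists del => // y /h; rewrite Xq.
  have := simplex_sub_jet xs_inj hp hq mev cN cC cu usub (jetY_sym _ _ Xsym) (soft_weights z)
    (@soft_upper_jet R n (fun b => u (atm xs b)) z P Xs jets) cr.
  have -> : gen P X (increments rho) = gen P Xs (increments rho) by rewrite !genE Xq.
  rewrite jetY_gen increments_offsets; move: (gen _ _ _) => g; rewrite -(ler_pM2l (kap_gt0 z)).
  have -> : kap z * (r + (kap z)^-1 * g) = kap z * r + g by field; rewrite gt_eqF ?kap_gt0.
  by rewrite mulrCA.
- move=> z P X jet e e0; have [Xs [Xsym Xq]] := qf_symmetrize X.
  have jets : lower_jet (fun z : V => kap z * w (atm xs (soft z))) z P Xs.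
    by move=> t /jet[del del0 h]; exists del => // y /h; rewrite Xq.
  have [rho [r [cr h]]] := simplex_super_jet xs_inj hp hq mev cN cC ev_bounded cw wsup
    (jetY_sym _ _ Xsym) (soft_weights z)
    (@soft_lower_jet R n (fun b => w (atm xs b)) z P Xs jets) (divr_gt0 e0 (kap_gt0 z)).
  exists rho, r; split => //.
  have -> : gen P X (increments rho) = gen P Xs (increments rho) by rewrite !genE Xq.
  move: h; rewrite jetY_gen increments_offsets; move: (gen _ _ _) => g; rewrite -(ler_pM2l (kap_gt0 z)).
  have -> : kap z * (r + (kap z)^-1 * g) = kap z * r + g by field; rewrite gt_eqF ?kap_gt0.
  have -> : kap z * (beta * w (atm xs (soft z)) + e / kap z) = beta * (kap z * w (atm xs (soft z))) + e.
    by field; rewrite gt_eqF ?kap_gt0.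
  by [].
- move=> th th0.
  have cD : simplex_cont (fun b : 'rV[R]_n.+1 => u (atm xs b) - w (atm xs b)).
    move=> a e wa e0; have e2 : 0 < e / 2 by rewrite divr_gt0.
    have [d1 d10 h1] := atm_simplex_cont xs hp cu wa e2; have [d2 d20 h2] := atm_simplex_cont xs hp cw wa e2.
    exists (Num.min d1 d2) => [|a' wa']; rewrite lt_min ?d10 // => /andP[k1 k2].
    by have := h1 _ wa' k1; have := h2 _ wa' k2; rewrite !ltr_norml; lra.
  have [|r hr] := @soft_atm_coercive _ th cD _ th0.
    by move=> a wa a0; rewrite subr_le0; exact: bdry.
  exists r => z; rewrite -mulrBr mulrC ler_pM2l ?kap_gt0 //; exact: hr.
Qed.

End SimplexComparison.

Section Atoms.
Context {R : realType} {d : nat} {H : Type}.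
Variables (p q beta : R) (ev : H -> 'rV[R]_d -> R) (c : @meas R d -> H -> \bar R).
Hypotheses (hp : p = 0 \/ 1 <= p) (hq : q = 0 \/ 1 <= q).
Hypothesis mev : forall rho, measurable_fun setT (ev rho : Rd R d -> R).
Hypothesis cN : forall mu rho, Pq p mu -> c mu rho != -oo%E.
Hypothesis cC : forall (N : nat) (xs : 'I_N -> 'rV[R]_d) (mu : @meas R d), supported_in xs mu ->
  forall e : R, 0 < e -> Pnbhs p mu [set nu | supported_in xs nu -> forall rho,
    (c nu rho <= c mu rho + e%:E)%E /\ (c mu rho <= c nu rho + e%:E)%E].
Hypothesis beta0 : 0 < beta.
Hypothesis ev_bounded : forall x : 'rV[R]_d, exists M : R, forall rho, `|ev rho x - ev rho 0| <= M.
Variables u w : @meas R d -> R.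
Hypotheses (cu : contP p u) (cw : contP p w).
Hypothesis usub : subsolution p q beta c ev (fun mu => (u mu)%:E).
Hypothesis wsup : supersolution p q beta c ev (fun mu => (w mu)%:E).

(** A repeated point and a vanishing weight both allow one point to be left out, so the induction
    hypothesis treats repetitions and supplies the boundary values for [simplex_comparison]. Without
    points there is no probability measure. *)
Lemma atoms_comparison N (xs : 'I_N -> 'rV[R]_d) mu : supported_in xs mu -> u mu <= w mu.
Proof.
elim: N xs mu => [|n IH] xs mu supmu.
  have [mu1] := supmu; have -> : ~` range xs = setT.
    by apply/seteqP; split => // x _ [[]].
  by rewrite mu1 => /eqP; rewrite onee_eq0.
have [xs_inj|ninj] := pselect (injective xs); last first.
  have [i [j [ij xij]]] : exists i j, i != j /\ xs i = xs j.
    apply: contrapT => h; apply: ninj => i j xij; apply: contrapT => /eqP ij.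
    by apply: h; exists i, j.
  apply: (IH (fun k => xs (lift j k))); split; first by case: supmu.
  rewrite -(proj2 supmu); congr (mu (~` _)); apply/seteqP; split => [_ [k _ <-]|_ [k _ <-]].
    by exists (lift j k).
  case: (unliftP j k) => [k' ->|->]; first by exists k'.
  rewrite -xij; case: (unliftP j i) => [k' ->|ei]; first by exists k'.
  by rewrite ei eqxx in ij.
have [b [wb enu]] := supported_atm xs_inj supmu.
have eun : eqm (atm xs b) mu by move=> A mA; rewrite enu.
rewrite (eqm_cont cu (atm_Pq xs p wb) eun) (eqm_cont cw (atm_Pq xs p wb) eun).
have hc := simplex_comparison xs_inj hp hq mev cN (@cC n.+1 xs) beta0 ev_bounded cu cw usub wsup.
apply: hc wb.
move=> {eun enu} a wa [i ai]; apply: (IH (fun k => xs (lift i k))); split; first exact: atm_prob.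
rewrite atmE //; congr (_%:E); rewrite big1 // => k _.
case: (unliftP i k) => [k' ->|->]; last by rewrite ai mul0r.
by rewrite memNset ?mulr0 //= => h; apply: h; exists k'.
Qed.

End Atoms.

(** * Density of finitely supported measures *)

Section Density.
Context {R : realType} {d : nat}.
Local Notation T := (Rd R d).

Lemma dominated_small (mu : @meas R d) (h : nat -> T -> R) (g : T -> R) (e : R) :
  (forall k, measurable_fun setT (h k)) -> (forall k x, 0 <= h k x <= g x) ->
  mu.-integrable setT (EFin \o g) ->
  (forall x t, 0 < t -> exists K, forall k, (K <= k)%N -> h k x < t) -> 0 < e ->
  exists k, (\int[mu]_x (h k x)%:E < e%:E)%E.
Proof.
move=> mh hg ig h0 e0.
have lim : (\int[mu]_x (h k x)%:E)%E @[k --> \oo] --> (\int[mu]_(x in setT) (fun _ : T => 0%E) x)%E.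
  apply: (@dominated_cvg _ T R mu setT measurableT (fun k x => (h k x)%:E) _ (EFin \o g)) => //.
  - by move=> k; apply/measurable_EFinP; exact: mh.
  - move=> x _; apply: cvg_EFin; first exact: nearW.
    apply/cvgrPdist_lt => t t0; have [K hK] := h0 x t t0.
    exists K => // k Kk /=; rewrite sub0r normrN ger0_norm; first exact: hK.
    by have /andP[] := hg k x.
  - by move=> k x _; rewrite /= lee_fin ger0_norm; have /andP[] := hg k x.
have [|k _ hk] := lim [set x | (x < e%:E)%E].
  rewrite integral0; apply: open_nbhs_nbhs; split; last by rewrite /= lte_fin.
  exact: open_ereal_lt_ereal.
by exists k; apply: (hk k) => /=.
Qed.

Definition ratpt (k : nat) : 'rV[R]_d := oapp (map_mx (@ratr R)) 0 (unpickle k : option 'rV[rat]_d).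

(** A measurable choice of a nearest point among 0 and the first [k] rational points. Starting from
    0 ensures [enorm (x - round k x) <= enorm x], which dominates the transport cost by the [p]-th
    moment. *)
Fixpoint round (k : nat) (x : 'rV[R]_d) : 'rV[R]_d :=
  if k is j.+1 then
    if enorm (x - ratpt j) < enorm (x - round j x) then ratpt j else round j x
  else 0.

Lemma measurable_round k : measurable_fun setT (round k : T -> T).
Proof.
elim: k => [|k IH]; first exact: measurable_cst.
apply: measurable_fun_ifT; last exact: IH; last exact: measurable_cst.
apply: measurable_fun_ltr.
  have -> : (fun x : T => enorm (x - ratpt k : 'rV[R]_d)) =
    (fun z : T * T => enorm (z.1 - z.2 : 'rV[R]_d)) \o (fun x : T => (x, ratpt k : T)) by [].
  by apply: measurableT_comp; [exact: measurable_enorm_sub|apply: measurable_fun_pair].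
have -> : (fun x : T => enorm (x - round k x : 'rV[R]_d)) =
  (fun z : T * T => enorm (z.1 - z.2 : 'rV[R]_d)) \o (fun x : T => (x, round k x : T)) by [].
by apply: measurableT_comp; [exact: measurable_enorm_sub|apply: measurable_fun_pair].
Qed.

Lemma round_le_enorm k x : enorm (x - round k x) <= enorm x.
Proof.
elim: k => [|k IH] /=; first by rewrite subr0.
by case: ltP => // /ltW h; apply: le_trans h IH.
Qed.

Lemma round_near k j x : (j < k)%N -> enorm (x - round k x) <= enorm (x - ratpt j).
Proof.
elim: k => // k IH; rewrite ltnS leq_eqVlt => /orP[/eqP ->|jk] /=; first by case: ltP.
by case: ltP => [/ltW h|_]; [apply: le_trans h _|]; exact: IH.
Qed.

Lemma enorm_le_norm (x : 'rV[R]_d) : enorm x <= Num.sqrt d%:R * `|x|.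
Proof.
rewrite -[`|x|]ger0_norm // -sqrtr_sqr -sqrtrM // ler_sqrt; last by rewrite mulr_ge0 // sqr_ge0.
have := sq_le (lexx `|x|); rewrite sqE dot_sum; apply: le_trans.
by apply: ler_sum => i _; rewrite expr2.
Qed.

Lemma round_cvg x e : 0 < e -> exists K, forall k, (K <= k)%N -> enorm (x - round k x) < e.
Proof.
move=> e0; have s0 : 0 < 1 + Num.sqrt d%:R :> R by rewrite ltr_pwDl // sqrtr_ge0.
have [r hr] := rat_vector_dense x (divr_gt0 e0 s0).
exists (pickle r).+1 => k /(@round_near k _ x) h; apply: le_lt_trans h _.
rewrite /ratpt pickleK /=; apply: le_lt_trans (enorm_le_norm _) _.
apply: le_lt_trans (_ : (1 + Num.sqrt d%:R) * `|map_mx (@ratr R) r - x| < e).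
  by rewrite distrC ler_wpM2r // lerDr.
by rewrite -ltr_pdivlMl // mulrC.
Qed.

Definition roundpts (k : nat) (i : 'I_k.+1) : 'rV[R]_d := if val i is j.+1 then ratpt j else 0.

Lemma round_range k x : range (@roundpts k) (round k x).
Proof.
elim: k => [|k [i _ hi]] /=; first by exists ord0.
case: ltP => _; first by exists ord_max.
by exists (widen_ord (leqnSn k.+1) i); rewrite // -hi.
Qed.

Lemma round_measure p (mu : @meas R d) k : p = 0 \/ 1 <= p -> Pq p mu ->
  exists nu : @meas R d, [/\ forall B, nu B = mu (round k @^-1` B),
    supported_in (@roundpts k) nu & Pq p nu].
Proof.
move=> hp pmu; have p0 : 0 <= p by case: hp => [->//|]; exact: le_trans.
have [nu [nuE nuint]] := pushforward_exists mu (measurable_round k).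
have nu1 : isprob nu by rewrite /isprob nuE preimage_setT; case: pmu.
exists nu; split => //.
  split=> //; rewrite nuE (_ : _ @^-1` _ = set0) ?measure0 //.
  by apply/seteqP; split => // x /=; have := round_range k x.
split=> //; rewrite nuint; first last.
- by move=> y; rewrite lee_fin powR_ge0.
- by apply/measurable_EFinP; exact: measurable_enorm_powR.
pose M := \sum_i enorm (@roundpts k i).
have bd x : `|enorm (round k x) `^ p| <= M `^ p.
  rewrite ger0_norm ?powR_ge0 // ge0_ler_powR ?nnegrE ?enorm_ge0 //.
    by apply: sumr_ge0 => i _; exact: enorm_ge0.
  have [i _ <-] := round_range k x; rewrite /M (bigD1 i) //= lerDl.
  by apply: sumr_ge0 => j _; exact: enorm_ge0.
have mf : measurable_fun setT (fun x : T => enorm (round k x) `^ p).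
  have h := measurableT_comp (measurable_enorm_powR (R := R) (d := d) p) (measurable_round k).
  exact: h.
have /integrableP[_] := bounded_integral_fin pmu mf bd.
apply: le_lt_trans; rewrite le_eqVlt; apply/orP; left; apply/eqP/eq_integral => x _.
by rewrite /= ger0_norm ?powR_ge0.
Qed.

(** The approximations are the images of [mu] under [round k]. By dominated convergence, the errors
    of the test integrals tend to 0 in the weak case, and so does the cost of the coupling given by
    [(x, round k x)] in the Wasserstein case. *)
Lemma atoms_dense p (mu : @meas R d) (A : set (@meas R d)) : p = 0 \/ 1 <= p -> Pq p mu ->
  Pnbhs p mu A -> exists N (xs : 'I_N -> 'rV[R]_d) nu, supported_in xs nu /\ A nu.
Proof.
move=> hp pmu; rewrite /Pnbhs; case: eqP => [p0|/eqP p0].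
  move=> [n [f [e [e0 [fb hA]]]]].
  have cf i := proj1 (fb i).
  have [M hM] := choice (fun i => proj2 (fb i)).
  have mf i : measurable_fun setT (f i : T -> R) by exact: measurable_continuous.
  have mfr i k : measurable_fun setT (fun x : T => f i (round k x)).
    have h := measurableT_comp (mf i) (measurable_round k).
    exact: h.
  have intf i : mu.-integrable setT (EFin \o (f i : T -> R)).
    exact: (bounded_integral_fin pmu (mf i) (hM i)).
  have intfr i k : mu.-integrable setT (EFin \o (fun x : T => f i (round k x))).
    exact: (bounded_integral_fin pmu (mfr i k) (fun x => hM i (round k x))).
  have [|||||k hk] := @dominated_small mu (fun k x => \sum_i `|f i (round k x) - f i x|)
     (fun _ => \sum_i (M i + M i)) e.
  - move=> k; apply: measurable_sum => i; apply: measurableT_comp => //.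
    exact: measurable_funB.
  - move=> k x; rewrite sumr_ge0 //=; apply: ler_sum => i _.
    by apply: le_trans (ler_normB _ _) _; apply: lerD.
  - apply: (bounded_integral_fin pmu); first exact: measurable_cst.
    by move=> x; exact: lexx.
  - move=> x t t0; pose F (y : 'rV[R]_d) := \sum_i `|f i y - f i x|.
    have cF : continuous F.
      apply: continuous_sum => i _ y.
      apply: (@continuous_comp _ _ _ (fun y => f i y - f i x) (@Num.norm R R^o)).
        by apply: continuous_sub; [exact: cf|exact: continuous_const].
      exact: norm_continuous.
    have [del del0 hdel] := proj1 (continuous_eps F) cF x t t0.
    have [K hK] := round_cvg x del0; exists K => k Kk.
    have Fx : F x = 0 by rewrite /F big1 // => i _; rewrite subrr normr0.
    have := hdel (round k x); rewrite Fx subr0 ger0_norm ?sumr_ge0 //; apply.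
    by apply: le_lt_trans (hK k Kk); rewrite distrC norm_le_enorm.
  - exact: e0.
  have [nu [nuE sup pnu]] := round_measure k hp pmu.
  exists k.+1, (@roundpts k), nu; split => //; apply: hA => // i.
  have -> : (\int[nu]_x (f i x)%:E = \int[mu]_x (f i (round k x))%:E)%E.
    rewrite (eq_measure_integral (measure_function_pushforward__canonical__measure_function_Measure mu (measurable_round k))).
      have mE : measurable_fun setT (EFin \o (f i : T -> R)) by apply/measurable_EFinP.
      by rewrite (integral_pushforward (measurable_round k) mE) //; exact: intfr.
    by move=> B _ _; rewrite nuE.
  rewrite -(integralB measurableT (intfr i k) (intf i)); apply: le_lt_trans hk.
  apply: le_trans (le_abse_integral _ _ _) _ => //.
    by apply: emeasurable_funB; exact/measurable_EFinP.
  apply: ge0_le_integral => //.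
  - by apply: measurableT_comp => //; apply: emeasurable_funB; exact/measurable_EFinP.
  - apply/measurable_EFinP; apply: measurable_sum => j; apply: measurableT_comp => //.
    exact: measurable_funB.
  - by move=> x _; rewrite -EFinB abse_EFin lee_fin (bigD1 i) //= lerDl sumr_ge0.
move=> [e [e0 hA]].
have p1 : 1 <= p by case: hp p0 => [->|//]; rewrite eqxx.
have p00 : 0 < p by exact: lt_le_trans p1.
have mh k : measurable_fun setT (fun x : T => enorm (x - round k x : 'rV[R]_d) `^ p).
  have mr : measurable_fun setT (fun x : T => (x, round k x : T)).
    by apply: measurable_fun_pair => //; exact: measurable_round.
  exact: (measurableT_comp (measurable_enorm_sub_powR (R := R) (d := d) p) mr).
have [||||k hk] := @dominated_small mu (fun k x => enorm (x - round k x) `^ p)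
   (fun x => enorm x `^ p) (e `^ p) mh.
- move=> k x; rewrite powR_ge0 /= ge0_ler_powR ?nnegrE ?enorm_ge0 ?(ltW p00) //.
  exact: round_le_enorm.
- apply/integrableP; split; first by apply/measurable_EFinP; exact: measurable_enorm_powR.
  case: pmu => _; apply: le_lt_trans; rewrite le_eqVlt; apply/orP; left; apply/eqP/eq_integral => x _.
  by rewrite /= ger0_norm ?powR_ge0.
- move=> x t t0; have s0 : 0 < t `^ p^-1 by exact: powR_gt0.
  have [K hK] := round_cvg x s0; exists K => k /hK h.
  have -> : t = (t `^ p^-1) `^ p by rewrite -powRrM mulVf ?gt_eqF // powRr1 // ltW.
  by rewrite gt0_ltr_powR ?nnegrE ?enorm_ge0 ?powR_ge0.
- exact: powR_gt0.
have [nu [nuE sup pnu]] := round_measure k hp pmu.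
exists k.+1, (@roundpts k), nu; split => //; apply: hA => //.
have mr : measurable_fun setT (fun x : T => (x, round k x : T)).
  by apply: measurable_fun_pair => //; exact: measurable_round.
have [pi [piE piint]] := pushforward_exists mu mr; exists pi; split.
  split => B mB; rewrite piE.
    by congr (mu _); apply/seteqP; split=> x //= -[].
  by rewrite nuE; congr (mu _); apply/seteqP; split=> x //= -[].
rewrite piint //; last by move=> y; rewrite lee_fin powR_ge0.
by apply/measurable_EFinP; exact: measurable_enorm_sub_powR.
Qed.

End Density.

Theorem theorem9p1 (R : realType) (d : nat) (p q beta : R)
    (H : completePseudoMetricType R) (ev : H -> 'rV[R]_d -> R)
    (c : @meas R d -> H -> \bar R) (u w : @meas R d -> R) :
  (* standing assumptions *)
  (p = 0 \/ 1 <= p) ->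
  hausdorff_space H -> (exists D : set H, countable D /\ dense D) ->
  injective ev ->
  (forall rho, measurable_fun setT (ev rho : Rd R d -> R)) ->
  (forall mu rho, Pq p mu -> c mu rho != -oo%E) ->
  measurable_c p c ->
  (* hypotheses of the theorem *)
  0 < beta ->
  (forall (N : nat) (xs : 'I_N -> 'rV[R]_d) (mu : meas), supported_in xs mu ->
     forall e : R, 0 < e ->
     Pnbhs p mu [set nu | supported_in xs nu -> forall rho,
        (c nu rho <= c mu rho + e%:E)%E /\ (c mu rho <= c nu rho + e%:E)%E]) ->
  (forall x : 'rV[R]_d, exists M : R, forall rho, `|ev rho x - ev rho 0| <= M) ->
  (q = 0 \/ 1 <= q <= p) ->
  contP p u -> contP p w ->
  subsolution p q beta c ev (fun mu => (u mu)%:E) ->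
  supersolution p q beta c ev (fun mu => (w mu)%:E) ->
  forall mu, Pq p mu -> u mu <= w mu.
Proof.
move=> hp _ _ _ mev cN _ beta0 cC ev_bounded hq cu cw usub wsup mu pmu.
have hq' : q = 0 \/ 1 <= q by case: hq => [->|/andP[]]; [left|right].
rewrite leNgt; apply/negP => wu; have e0 : 0 < (u mu - w mu) / 2 by rewrite divr_gt0 ?subr_gt0.
have [N [xs [nu [sup [unu wnu]]]]] :=
  atoms_dense hp pmu (PnbhsI hp (cu mu pmu _ e0) (cw mu pmu _ e0)).
have := atoms_comparison hp hq' mev cN cC beta0 ev_bounded cu cw usub wsup sup.
by move: unu wnu; rewrite /= !ltr_norml => /andP[? ?] /andP[? ?] ?; lra.
Qed.
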